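(* Let $n\ge 3$, let $k$ be an algebraically closed field, and let $\mathcal{C}$ be the category of tagged edges of the punctured polygon with $n$ vertices. Let $M,N$ be indecomposable objects of $\mathcal{C}$, i.e. tagged edges. Then the dimension over $k$ of $\mathrm{Ext}^1_{\mathcal{C}}(M,N)$ is equal to the crossing number $e(M,N)$ of $M$ and $N$.
   Context: Punctured polygon and tagged edges. Let $n\ge 3$ and consider a regular polygon with $n$ vertices and one puncture in its center. For vertices $a\neq b$, $\delta_{a,b}$ is the path along the boundary from $a$ to $b$ in counterclockwise direction not running through the same point twice, and $|\delta_{a,b}|$ is the number of vertices on it (including $a$ and $b$); $\delta_{a,a}$ is the boundary path from $a$ to $a$ going counterclockwise around the polygon exactly once, and $|\delta_{a,a}|=n+1$. The vertex $b$ is the counterclockwise neighbor of $a$ if $|\delta_{a,b}|=2$. An edge is a triple $(a,\alpha,b)$ with $a,b$ vertices and $\alpha$ a path from $a$ to $b$ in the punctured polygon such that $\alpha$ is homotopic (endpoints fixed) to $\delta_{a,b}$; apart from its endpoints $\alpha$ lies in the interior of the punctured polygon; $\alpha$ does not cross itself in the interior; and $|\delta_{a,b}|\ge 3$. Two edges are equivalent if they have the same start, the same end and homotopic paths; the class of $(a,\alpha,b)$ is determined by $(a,b)$ and is denoted $M_{a,b}$. The set of tagged edges is $E'=\{M_{a,b}^{\epsilon}\mid \epsilon=\pm1,\ \epsilon=1 \text{ if } a\ne b\}$; for $a\neq b$ write $M_{a,b}=M_{a,b}^1$. Crossing number. Let $\Delta^0$ be the interior of the punctured polygon (the puncture is not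 in $\Delta^0$), and let $M=M_{a,b}^{\epsilon}$, $N=M_{c,d}^{\epsilon'}$. (1) If $a\ne b$, $c\neq d$: $e(M,N)=\min\{\mathrm{Card}(\alpha\cap\beta\cap\Delta^0)\mid (a,\alpha,b)\in M_{a,b},(c,\beta,d)\in M_{c,d}\}$. (2) If $a=b$, $c\ne d$: $e(M,N)=\min\{\mathrm{Card}(\alpha\cap\beta\cap\Delta^0)\mid (c,\beta,d)\in M_{c,d}\}$ where $\alpha$ is the straight line from $a$ to the puncture. (3) If $a\neq b$, $c=d$: $e(M,N)=\min\{\mathrm{Card}(\alpha\cap\beta\cap\Delta^0)\mid (a,\alpha,b)\in M_{a,b}\}$ where $\beta$ is the straight line from $c$ to the puncture. (4) If $a=b$, $c=d$: $e(M,N)=1$ if $a\ne c$ and $\epsilon\neq\epsilon'$, and $e(M,N)=0$ otherwise. Elementary moves. Let $c$ (resp. $d$) be the counterclockwise neighbor of $a$ (resp. $b$). The elementary moves, which are certain ordered pairs of tagged edges, are exactly: (1) if $|\delta_{a,b}|=3$: $M_{a,b}\mapsto M_{a,d}$ (for $n=3$ one has $|\delta_{a,b}|=3=n$, and case (3) applies); (2) if $4\le|\delta_{a,b}|\le n-1$: $M_{a,b}\mapsto M_{c,b}$ and $M_{a,b}\mapsto M_{a,d}$; (3) if $|\delta_{a,b}|=n$ (so $d=a$): $M_{a,b}\mapsto M_{c,b}$ (only when $|\delta_{c,b}|\ge3$), $M_{a,b}\mapsto M_{a,a}^{1}$ and $M_{a,b}\mapsto M_{a,a}^{-1}$; (4)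 if $a=b$: $M_{a,a}^{\epsilon}\mapsto M_{c,a}$. Translation. $\tau:E'\to E'$ is the bijection defined as follows: if $a$ (resp. $b$) is the counterclockwise neighbor of $a'$ (resp. $b'$), then $\tau M_{a,b}=M_{a',b'}$ for $a\ne b$ and $\tau M_{a,a}^{\epsilon}=M_{a',a'}^{-\epsilon}$. For every elementary move $\alpha:Y\mapsto X$ there is an elementary move $\sigma(\alpha):\tau X\mapsto Y$. Category of tagged edges. $\mathcal{C}$ is the $k$-linear additive category whose objects are direct sums of tagged edges; morphisms from a tagged edge $M$ to a tagged edge $N$ are the $k$-vector space spanned by sequences of elementary moves from $M$ to $N$, modulo the ideal generated by the mesh relations $m_X=\sum_{\alpha:Y\mapsto X}\bigl(\tau X\stackrel{\sigma(\alpha)}{\mapsto}Y\stackrel{\alpha}{\mapsto}X\bigr)$, one for each $X\in E'$, the sum being over all elementary moves with target $X$. Ext. $\mathcal{C}$ is triangulated (via its equivalence with the cluster category of type $D_n$) with shift functor equal to $\tau$, and for tagged edges $M,N$ one defines $\mathrm{Ext}^1_{\mathcal{C}}(M,N)=\mathrm{Hom}_{\mathcal{C}}(M,\tau N)$. *)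

(* Defs.v *)
From HB Require Import structures.
From mathcomp Require Import freeg.
From mathcomp Require Import all_boot all_order all_algebra zify.
From mathcomp Require Import generic_quotient ring_quotient.
From mathcomp Require Import all_classical all_reals all_analysis.
Import Order.TTheory GRing.Theory Num.Theory.
Import numFieldNormedType.Exports.

Set Implicit Arguments.
Unset Strict Implicit.
Unset Printing Implicit Defensive.

Local Open Scope ring_scope.
Local Open Scope classical_set_scope.
Local Open Scope card_scope.

(* The vertices of the polygon are the elements of 'I_n, numbered
   counterclockwise: ordS a is the counterclockwise neighbor of a, and
   ord_pred a is the vertex whose counterclockwise neighbor is a. *)

(* Number of sides of the boundary path delta_{a,b}: a full turn if a = b. *)
Definition bsteps n (a b : 'I_n) : nat :=
  (if a < b then b - a else b + n - a)%N.

(* |delta_{a,b}|, the number of vertices on delta_{a,b}. *)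
Definition bcard n (a b : 'I_n) : nat := (bsteps a b).+1.

Section Topology.
Context {R : realType} (n : nat).
Local Notation plane := (R * R)%type.

(* The regular n-gon is inscribed in the unit circle and the puncture is 0.
   The index j is any natural number, so that [vertex] is n-periodic. *)
Definition vertex (j : nat) : plane :=
  (cos (2 * pi * j%:R / n%:R), sin (2 * pi * j%:R / n%:R)).

Definition polygon : set plane :=
  [set p | exists2 w : 'I_n -> R,
     (forall i, 0 <= w i) /\ \sum_i w i = 1 & p = \sum_i w i *: vertex i].

Definition punctured_polygon : set plane := polygon `\ 0.

(* Delta^0 *)
Definition punctured_interior : set plane := interior punctured_polygon.

(* The boundary, run through counterclockwise, one side per unit of time. *)
Definition boundary (x : R) : plane :=
  let j := Num.truncn x in
  (1 - (x - j%:R)) *: vertex j + (x - j%:R) *: vertex j.+1.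

Definition delta (a b : 'I_n) (t : R) : plane :=
  boundary (a%:R + t * (bsteps a b)%:R).

(* Homotopy in D with fixed endpoints, for paths parameterized by [0, 1]. *)
Definition path_homotopic (D : set plane) (f g : R -> plane) : Prop :=
  exists H : R * R -> plane,
    [/\ {within `[0, 1] `*` `[0, 1], continuous H},
        H @` (`[0, 1] `*` `[0, 1]) `<=` D,
        {in `[0, 1], forall t, H (0, t) = f t /\ H (1, t) = g t} &
        {in `[0, 1], forall s, H (s, 0) = f 0 /\ H (s, 1) = f 1}].

(* (a, alpha, b) is an edge; as the equivalence class of an edge is determined
   by its endpoints, [is_edge a b] is also the class M_{a,b}. *)
Definition is_edge (a b : 'I_n) (alpha : R -> plane) : Prop :=
  [/\ [/\ {within `[0, 1], continuous alpha}, alpha 0 = vertex a &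
          alpha 1 = vertex b],
      path_homotopic punctured_polygon alpha (delta a b),
      {in `]0, 1[, forall t, punctured_interior (alpha t)},
      {in `]0, 1[ &, injective alpha} &
      (3 <= bcard a b)%N].

Definition trace (alpha : R -> plane) : set plane := alpha @` `[0, 1].

(* The straight line from the vertex a to the puncture. *)
Definition spoke (a : 'I_n) (t : R) : plane := (1 - t) *: vertex a.

End Topology.

(* M_{a,b}^eps as ((a, b), eps), where true stands for 1 and false for -1. *)
Definition is_tedge n (x : 'I_n * 'I_n * bool) : bool :=
  (3 <= bcard x.1.1 x.1.2)%N && ((x.1.1 != x.1.2) ==> x.2).

Record tedge n := TEdge {
  tedge_val :> 'I_n * 'I_n * bool;
  tedgeP : is_tedge tedge_val }.

HB.instance Definition _ n := [isSub for @tedge_val n].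
HB.instance Definition _ n := [Finite of tedge n by <:].

Definition src n (M : tedge n) : 'I_n := M.1.1.
Definition tgt n (M : tedge n) : 'I_n := M.1.2.
Definition tag_sign n (M : tedge n) : bool := M.2.
Definition is_loop n (M : tedge n) : bool := src M == tgt M.

(* The paths representing M when a crossing number is computed. *)
Definition arcs (R : realType) n (M : tedge n) : set (R -> R * R) :=
  if is_loop M then [set spoke (src M)] else is_edge (src M) (tgt M).

(* m is the least cardinality of an element of C, and it is attained. *)
Definition is_min_card T (C : set (set T)) (m : nat) : Prop :=
  (exists2 A, C A & A #= `I_m) /\
  (forall A j, C A -> A #= `I_j -> (m <= j)%N).

(* e(M, N) = m *)
Definition is_crossing_number (R : realType) n (M N : tedge n) (m : nat) :
    Prop :=
  if is_loop M && is_loop N then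
    m = (src M != src N) && (tag_sign M != tag_sign N)
  else
    is_min_card
      [set trace alpha `&` trace beta `&` punctured_interior n
         | alpha in @arcs R n M & beta in @arcs R n N] m.

(* There is an elementary move M |-> N. For n = 3 the condition |delta_{a,b}| = 3
   belongs to the case |delta_{a,b}| = n, hence the bound on n in the first case.
   In the third case the target (ordS a, b) is a tagged edge only if
   |delta_{ordS a, b}| >= 3, which N : tedge n enforces, and the target (a, a)
   carries either sign. *)
Definition emove n (M N : tedge n) : bool :=
  let a := src M in let b := tgt M in
  [|| [&& bcard a b == 3, 3 < n & (src N, tgt N) == (a, ordS b)]%N,
      [&& 4 <= bcard a b, bcard a b <= n.-1 &
          ((src N, tgt N) == (ordS a, b)) ||
          ((src N, tgt N) == (a, ordS b))]%N,
      (bcard a b == n) &&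
        (((src N, tgt N) == (ordS a, b)) || ((src N, tgt N) == (a, a))) |
      (a == b) && ((src N, tgt N) == (ordS a, a))].

Lemma val_ord_pred n (a : 'I_n) :
  ord_pred a = (if a == 0 :> nat then n.-1 else a.-1)%N :> nat.
Proof.
have := ltn_ord a; rewrite /=; case: eqP => [-> n0|a0 ltan].
  by rewrite add0n modn_small // prednK.
have -> : ((a + n).-1 = a.-1 + n)%N by lia.
by rewrite modnDr modn_small //; lia.
Qed.

Lemma bcard_pred n (a b : 'I_n) : bcard (ord_pred a) (ord_pred b) = bcard a b.
Proof.
rewrite /bcard /bsteps !val_ord_pred.
have := ltn_ord a; have := ltn_ord b => bn an.
by case: eqP => a0; case: eqP => b0; case: ltnP => ?; case: ltnP => ?; lia.
Qed.

Lemma bcard_predl n (a b : 'I_n) :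
  (bcard a b <= n)%N -> bcard (ord_pred a) b = (bcard a b).+1.
Proof.
rewrite /bcard /bsteps val_ord_pred.
have := ltn_ord a; have := ltn_ord b => bn an.
by case: eqP => a0; case: (ltnP a b) => ? ?; case: ltnP => ?; lia.
Qed.

Lemma bcard_predr n (a b : 'I_n) :
  (2 < bcard a b)%N -> bcard a (ord_pred b) = (bcard a b).-1.
Proof.
rewrite /bcard /bsteps val_ord_pred.
have := ltn_ord a; have := ltn_ord b => bn an.
by case: eqP => b0; case: (ltnP a b) => ? ?; case: ltnP => ?; lia.
Qed.

Lemma bcard_eqn n (a b : 'I_n) : bcard a b = n -> ord_pred a = b.
Proof.
move=> abn; apply: val_inj; rewrite [LHS]val_ord_pred; move: abn.
rewrite /bcard /bsteps.
have := ltn_ord a; have := ltn_ord b => bn an.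
by case: eqP => a0; case: (ltnP a b) => ? ? /=; lia.
Qed.

Lemma bcardSr n (a b : 'I_n) :
  (bcard a b <= n)%N -> bcard a (ordS b) = (bcard a b).+1.
Proof. by move=> abn; rewrite -bcard_pred ordSK bcard_predl. Qed.

Lemma bcardSl n (a b : 'I_n) :
  (2 < bcard a b)%N -> bcard (ordS a) b = (bcard a b).-1.
Proof. by move=> ab2; rewrite -bcard_pred ordSK bcard_predr. Qed.

Lemma bcard_diag n (a : 'I_n) : bcard a a = n.+1.
Proof. by rewrite /bcard /bsteps ltnn addKn. Qed.

Lemma tau_subproof n (M : tedge n) :
  is_tedge (ord_pred (src M), ord_pred (tgt M),
            if is_loop M then ~~ tag_sign M else tag_sign M).
Proof.
case: M => [[[a b] e] /= M_ok]; have /andP[/= ab3 abe] := M_ok.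
rewrite /is_tedge /is_loop /src /tgt /tag_sign /= {M_ok} bcard_pred ab3 /=.
by rewrite (inj_eq (@ord_pred_inj n)); case: eqVneq abe.
Qed.

(* For a != b the sign is kept, and equal to 1. *)
Definition tau n (M : tedge n) : tedge n := TEdge (tau_subproof M).

Lemma tau_emove n (Y X : tedge n) : emove Y X -> emove (tau X) Y.
Proof.
case: Y X => [[[a b] e] /= Y_ok] [[[c d] e'] /= X_ok].
have /andP[/= Y3 _] := Y_ok; have /andP[/= X3 _] := X_ok.
rewrite /emove /tau /src /tgt; cbn [fst snd tedge_val].
rewrite bcard_pred {e e' Y_ok X_ok}.
case/or4P=> [/and3P[/eqP k3 n3 /eqP[cE dE]]
            |/and3P[k4 kn /orP[]/eqP[cE dE]]
            |/andP[/eqP kn /orP[]/eqP[cE dE]]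
            |/andP[/eqP abE /eqP[cE dE]]]; subst; rewrite ?ordSK ?ord_predK ?eqxx.
- by rewrite bcardSr; lia.
- by rewrite bcardSl //; lia.
- by rewrite bcardSr; lia.
- by rewrite bcardSl // in X3 *; lia.
- by rewrite (bcard_eqn kn) eqxx !orbT.
- by rewrite bcardSl bcard_diag /= ?eqxx ?orbT // -(bcard_diag b).
Qed.

(* The quotient of a module by a submodule: ring_quotient provides the additive
   group Quotient.quot S, on which the scaling is added here. *)
Section QuotientModule.
Local Open Scope quotient_scope.
Context (k : nzRingType) (V : lmodType k) (S : {pred V}) (S_sub : submod_closed S).

Fact subspace_closed : zmod_closed S.
Proof. exact: GRing.submod_closedB. Qed.

#[local] HB.instance Definition _ :=
  GRing.isZmodClosed.Build V S subspace_closed.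

Definition lquot : Type := Quotient.quot S.
HB.instance Definition _ := GRing.Zmodule.on lquot.
HB.instance Definition _ := ZmodQuotient.on lquot.

Lemma pi_lquotE (v w : V) : (v - w \in S) = (v == w %[mod lquot]).
Proof. exact: (Quotient.idealrBE S). Qed.

Definition lquot_scale (c : k) (x : lquot) : lquot := \pi_lquot (c *: repr x).

Lemma pi_lquot_scale c (v : V) :
  lquot_scale c (\pi_lquot v) = \pi_lquot (c *: v).
Proof.
apply/eqP; rewrite -pi_lquotE -scalerBr -[_ *: _]addr0.
have [S0 S_lin] := S_sub; apply: S_lin => //.
by rewrite pi_lquotE reprK.
Qed.

Fact lquot_scaleA c d x :
  lquot_scale c (lquot_scale d x) = lquot_scale (c * d) x.
Proof. by rewrite -[x]reprK !pi_lquot_scale scalerA !reprK. Qed.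

Fact lquot_scale1 : left_id 1 lquot_scale.
Proof. by move=> x; rewrite -[x]reprK pi_lquot_scale scale1r. Qed.

Fact lquot_scaleDr : right_distributive lquot_scale +%R.
Proof.
move=> c x y; rewrite -[x]reprK -[y]reprK !pi_lquot_scale.
by rewrite -!pi_addr pi_lquot_scale scalerDr.
Qed.

Fact lquot_scaleDl x : {morph lquot_scale^~ x : c d / c + d}.
Proof.
move=> c d; rewrite -[x]reprK !pi_lquot_scale.
by rewrite -!pi_addr scalerDl.
Qed.

HB.instance Definition _ :=
  GRing.Zmodule_isLmodule.Build k lquot
    lquot_scaleA lquot_scale1 lquot_scaleDr lquot_scaleDl.

End QuotientModule.

Section Category.
Context (k : fieldType) (n : nat).
Implicit Types L M N X Y : tedge n.

(* Sequences of elementary moves from M to N. An elementary move is a pair of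
   tagged edges, so such a sequence is given by the tagged edges it visits; M
   itself is not listed. *)
Record mpath M N := MPath {
  mpath_seq :> seq (tedge n);
  mpathP : path (@emove n) M mpath_seq && (last M mpath_seq == N) }.

HB.instance Definition _ M N := [isSub for @mpath_seq M N].
HB.instance Definition _ M N := [Choice of mpath M N by <:].

Fact cat_subproof L M N (p : mpath L M) (q : mpath M N) :
  path (@emove n) L (p ++ q) && (last L (p ++ q) == N).
Proof.
case: p q => [p /= /andP[Lp /eqP pM]] [q /= /andP[Mq qN]].
by rewrite cat_path last_cat pM Lp Mq.
Qed.

Definition mpath_cat L M N (p : mpath L M) (q : mpath M N) : mpath L N :=
  MPath (cat_subproof p q).

(* The vector space spanned by the sequences of elementary moves. *)
Notation kpath M N := {freeg (mpath M N) / k}.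

(* First f, then g. *)
Definition kcomp L M N (f : kpath L M) (g : kpath M N) : kpath L N :=
  fglift (fun p => fglift (fun q => << mpath_cat p q >>) g) f.

Fact mesh_subproof X Y : emove Y X ->
  path (@emove n) (tau X) [:: Y; X] && (last (tau X) [:: Y; X] == X).
Proof. by move=> YX; rewrite /= YX tau_emove ?eqxx. Qed.

Definition mesh_path X Y (YX : emove Y X) : mpath (tau X) X :=
  MPath (mesh_subproof YX).

(* m_X, an element of Hom from tau X to X before passing to the quotient. *)
Definition mesh X : kpath (tau X) X :=
  \sum_(y : {Y | emove Y X}) << mesh_path (valP y) >>.

(* [mesh_ideal] at M, N is the component from M to N of the ideal generated by
   the mesh relations. *)
Inductive mesh_ideal : forall M N, kpath M N -> Prop :=
| mesh_ideal_gen X : mesh_ideal (mesh X)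
| mesh_ideal_zero M N : mesh_ideal (0 : kpath M N)
| mesh_ideal_lin M N (c : k) (f g : kpath M N) :
    mesh_ideal f -> mesh_ideal g -> mesh_ideal (c *: f + g)
| mesh_ideal_compl L M N (f : kpath L M) (g : kpath M N) :
    mesh_ideal g -> mesh_ideal (kcomp f g)
| mesh_ideal_compr L M N (f : kpath L M) (g : kpath M N) :
    mesh_ideal f -> mesh_ideal (kcomp f g).

Definition mesh_pred M N : {pred kpath M N} := fun f => `[< mesh_ideal f >].

Fact mesh_pred_closed M N : submod_closed (@mesh_pred M N).
Proof.
split=> [|c f g /asboolP f0 /asboolP g0]; apply/asboolP.
  exact: mesh_ideal_zero.
exact: mesh_ideal_lin.
Qed.

Definition Hom M N : lmodType k := lquot (@mesh_pred_closed M N).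

(* Ext^1(M, N) is Hom(M, N[1]), and the shift functor of the category is tau. *)
Definition Ext1 M N : lmodType k := Hom M (tau N).

End Category.

(* V is isomorphic to k^d; in particular V is finite-dimensional. *)
Definition has_dim (k : fieldType) (V : lmodType k) (d : nat) : Prop :=
  exists f : {linear V -> 'rV[k]_d}, bijective f.

(* Main.v *)
From HB Require Import structures.
From mathcomp Require Import freeg.
From mathcomp Require Import all_boot all_order all_algebra zify ring lra.
From mathcomp Require Import generic_quotient.
From mathcomp Require Import all_classical all_reals all_analysis.
Require Import Defs.
Import Order.TTheory GRing.Theory Num.Theory.
Import numFieldNormedType.Exports.

(** Both numbers are equal to one integer, [crossing_count M N]. Number the vertices
    from the source of [M] on. On the universal cover of the punctured polygon, [M]
    then occupies an interval [[0, m]], and [N] the translates by multiples of [n]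
    of an interval [[r, r + s]]; the integer counts the translates that interleave
    with [[0, m]], with the obvious convention for loops, which are replaced by the
    straight line from their vertex to the puncture.

    Crossing number. Lifting the homotopy from an edge to the boundary path shows that
    the argument, as seen from the puncture, changes along both by the same amount
    ([edge_lift]). So edges lift to paths in a half plane between known points of its
    boundary line, and two such paths must meet if their end points interleave
    ([linked_paths_meet]); otherwise the difference of the two paths would wind once
    around the boundary of a square on which it has a continuous argument
    ([argument_on_square]). Crossings from different translates are different points
    since edges are simple, which gives the lower bound ([meet_lower]). For the upper
    bound ([meet_upper]), boundary paths are pushed inwards along parabolas with the
    same leading coefficient: two of them differ by a linear function on the
    universal cover, so they meet at most once, and only if the intervals interleave.

    Dimension. Fix [M], and grade the sequences of elementary moves out of [M] by the
    number of moves that advance the source. For each grade [i] and each [X] there is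
    an explicit subspace [predicted M i X] of [k ^ 2], found by unfolding the punctured
    polygon to a polygon with [2 * n] vertices, and each elementary move acts on these
    spaces by an explicit map. Three properties are verified case by case. The mesh
    relations act by zero ([mesh_relation]), so every element of Hom has a value. The
    spaces over the predecessors of [X] generate the one over [X] ([mesh_onto]), so
    every predicted vector is a value. Finally, the sequence formed by the spaces over
    [tau X], over the predecessors of [X] and over [X] is exact in the middle
    ([mesh_exact]); by induction on the length this implies that a combination of
    paths with value zero lies in the ideal ([mesh_kernel]). For given [X] only one
    grade contributes, so Hom from [M] to [X] is a single predicted space, and for
    [X = tau N] its dimension is [crossing_count M N] ([Ext1_dim]). *)

Set Implicit Arguments.
Unset Strict Implicit.
Unset Printing Implicit Defensive.

Local Open Scope ring_scope.
Local Open Scope classical_set_scope.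
Local Open Scope card_scope.

(** * Arguments of points and paths in the plane *)

Section Clamp.
Context {R : realType}.

Definition clamp (x : R) : R := Num.max 0 (Num.min x 1).

Lemma clamp_le0 x : x <= 0 -> clamp x = 0.
Proof. by move=> x0; rewrite /clamp (min_idPl _) ?(max_idPl _) //; lra. Qed.

Lemma clamp_ge1 x : 1 <= x -> clamp x = 1.
Proof. by move=> x1; rewrite /clamp (min_idPr _) ?(max_idPr _) //; lra. Qed.

Lemma clamp_id x : 0 <= x <= 1 -> clamp x = x.
Proof.
by move=> /andP[x0 x1]; rewrite /clamp (min_idPl _) ?(max_idPr _) //; lra.
Qed.

Lemma clamp01 x : 0 <= clamp x <= 1.
Proof.
have [x0|x0] := lerP x 0; first by rewrite clamp_le0 //; lra.
have [x1|x1] := lerP x 1; first by rewrite clamp_id; lra.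
by rewrite clamp_ge1; lra.
Qed.

Lemma continuous_clamp : continuous clamp.
Proof.
have minc : continuous ((id : R -> R) \min cst 1).
  by apply: min_fun_continuous; [by move=> ?; exact: cvg_id|exact: cst_continuous].
suff : continuous (cst 0 \max ((id : R -> R) \min cst 1)) by [].
by apply: max_fun_continuous => //; exact: cst_continuous.
Qed.

(** Turns continuity on a closed set into continuity everywhere, once the source is
    retracted onto that set; [clamp] below is such a retraction of the line. *)
Lemma within_continuous_comp (S T U : topologicalType) (A : set T)
    (f : T -> U) (g : S -> T) :
  {within A, continuous f} -> continuous g -> (forall x, A (g x)) ->
  continuous (f \o g).
Proof.
move=> /subspace_continuousP fA gc gA x.
apply: cvg_trans (fA _ (gA x)) => V /= nV.
rewrite nbhs_simpl /=.
have := gc x _ nV; rewrite /= nbhs_simpl /=.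
by apply: filterS => y /= /(_ (gA y)).
Qed.

End Clamp.

(** Continuity of composite expressions, in a form that [apply:] can use. *)
Section ContinuityRules.
Context {R : realType} {X : topologicalType}.

Lemma cont_comp (Y Z : topologicalType) (h : Y -> Z) (f : X -> Y) :
  continuous h -> continuous f -> continuous (fun x => h (f x)).
Proof. by move=> hc fc x; apply: continuous_comp; [exact: fc|exact: hc]. Qed.

Lemma cont_cst (Y : topologicalType) (y : Y) : continuous (fun _ : X => y).
Proof. exact: cst_continuous. Qed.

Lemma cont_pair (Y Z : topologicalType) (f : X -> Y) (g : X -> Z) :
  continuous f -> continuous g -> continuous (fun x => (f x, g x)).
Proof. by move=> fc gc x; apply: cvg_pair; [exact: fc|exact: gc]. Qed.

Lemma cont_add (V : normedModType R) (f g : X -> V) :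
  continuous f -> continuous g -> continuous (fun x => f x + g x).
Proof. by move=> fc gc x; apply: cvgD; [exact: fc|exact: gc]. Qed.

Lemma cont_sub (V : normedModType R) (f g : X -> V) :
  continuous f -> continuous g -> continuous (fun x => f x - g x).
Proof. by move=> fc gc x; apply: cvgB; [exact: fc|exact: gc]. Qed.

Lemma cont_mul (f g : X -> R) :
  continuous f -> continuous g -> continuous (fun x => f x * g x).
Proof. by move=> fc gc x; apply: cvgM; [exact: fc|exact: gc]. Qed.

Lemma cont_scale (V : normedModType R) (f : X -> R) (g : X -> V) :
  continuous f -> continuous g -> continuous (fun x => f x *: g x).
Proof. by move=> fc gc x; apply: cvgZ; [exact: fc|exact: gc]. Qed.

Lemma cont_fst (Y Z : topologicalType) (f : X -> Y * Z) :
  continuous f -> continuous (fun x => (f x).1).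
Proof. by move=> fc; apply: cont_comp fc => p; exact: cvg_fst. Qed.

Lemma cont_snd (Y Z : topologicalType) (f : X -> Y * Z) :
  continuous f -> continuous (fun x => (f x).2).
Proof. by move=> fc; apply: cont_comp fc => p; exact: cvg_snd. Qed.

Lemma cont_sum (V : normedModType R) n (F : nat -> X -> V) :
  (forall i, continuous (F i)) -> continuous (fun x => \sum_(0 <= i < n) F i x).
Proof.
move=> Fc; elim: n => [|n IHn].
  under [X in continuous X]eq_fun do rewrite big_geq //.
  exact: cont_cst.
under [X in continuous X]eq_fun do rewrite big_nat_recr //=.
exact: cont_add.
Qed.

End ContinuityRules.

Section Angle.
Context {R : realType}.
Local Notation plane := (R * R)%type.

Definition dir (t : R) : plane := (cos t, sin t).

(** [t] is an argument of the point [q] of the punctured plane. *)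
Definition arg_of (q : plane) (t : R) : Prop :=
  exists2 r : R, 0 < r & q = r *: dir t.

Lemma scaleE (r : R) (p : plane) : r *: p = (r * p.1, r * p.2).
Proof. by []. Qed.

Lemma cos_eq1_sin_eq0 (t : R) : cos t = 1 -> sin t = 0.
Proof. by move=> c1; apply: cos1sin0; rewrite c1 normr1. Qed.

Lemma arg_ofD q t u : cos u = 1 -> arg_of q t -> arg_of q (t + u).
Proof.
move=> cu [r r0 ->]; exists r => //.
by rewrite /dir cosD sinD cu (cos_eq1_sin_eq0 cu) !mulr0 !mulr1 subr0 addr0.
Qed.

(** Arguments are compared through [cos (t - u) = 1], which avoids mentioning the
    integer multiple of [2 * pi] by which they differ. *)
Lemma arg_of_uniq q t u : arg_of q t -> arg_of q u -> cos (t - u) = 1.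
Proof.
move=> [r r0 qE] [s s0]; rewrite {}qE !scaleE => -[ec es].
have rs : r = s.
  have : r ^+ 2 = s ^+ 2.
    by rewrite -[LHS]mulr1 -[RHS]mulr1 -{1}(cos2Dsin2 t) -(cos2Dsin2 u) !mulrDr -!exprMn ec es.
  by move/eqP; rewrite eqrXn2 ?ltW // => /eqP.
subst s; have r_neq0 : r != 0 by rewrite gt_eqF.
by rewrite cosB (mulfI r_neq0 ec) (mulfI r_neq0 es) -!expr2 cos2Dsin2.
Qed.

Lemma arg_of_neq0 q t : arg_of q t -> q <> 0.
Proof.
move=> [r r0 ->]; rewrite scaleE => -[/eqP + /eqP].
rewrite !mulf_eq0 (gt_eqF r0) /= => /eqP c0 /eqP s0.
by have := cos2Dsin2 t; rewrite c0 s0; lra.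
Qed.

Lemma cos_lt1 (t : R) : 0 < t < 2 * pi -> cos t < 1.
Proof.
move=> /andP[t0 tpi].
have : 0 < sin (t / 2) by apply: sin_gt0_pi; lra.
have -> : cos t = 1 - 2 * sin (t / 2) ^+ 2.
  have -> : cos t = cos (t / 2 *+ 2) by congr cos; rewrite mulr2n; lra.
  by rewrite cos_mulr2n cos2sin2 mulr2n; lra.
by move=> /(exprn_gt0 2); lra.
Qed.

Lemma sin_lt0 (t : R) : pi < t < 2 * pi -> sin t < 0.
Proof.
move=> /andP[t0 tpi].
have := @sin_gt0_pi _ (t - pi); rewrite sinB cospi sinpi.
by move=> H; have : 0 < sin t * -1 - cos t * 0; [apply: H; lra|lra].
Qed.

Lemma ivt01 (f : R -> R) v : continuous f ->
  (f 0 <= v <= f 1) || (f 1 <= v <= f 0) -> exists2 t : R, 0 <= t <= 1 & f t = v.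
Proof.
move=> fc H; have [|t t01 <-] := @IVT R f 0 1 v ler01 (continuous_subspaceT fc).
  by rewrite ge_min le_max; case/orP: H => /andP[-> ->]; rewrite ?orbT.
by exists t => //; rewrite in_itv in t01.
Qed.

(** A path that never visits the open lower half plane cannot wind: by the
    intermediate value theorem its argument would otherwise take a value at which
    the sine is negative. *)
Lemma sin_ge0_trap (phi : R -> R) :
  continuous phi -> (forall t : R, 0 <= t <= 1 -> 0 <= sin (phi t)) ->
  0 <= phi 0 <= pi -> 0 <= phi 1 <= pi.
Proof.
move=> cphi sphi /andP[p0 p1]; have pi0 := @pi_gt0 R.
apply/andP; split; rewrite leNgt; apply/negP => H.
- have [v [v1 v2 v3]] : exists v, [/\ - pi < v, v < 0 & phi 1 <= v].
    by have [?|?] := ltP (phi 1) (- pi / 2); [exists (- pi / 2)|exists (phi 1)];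
      split; lra.
  have [|t tin tE] := @ivt01 phi v cphi; first by apply/orP; right; lra.
  have := sphi _ tin; rewrite tE leNgt => /negP; apply.
  by have := @sin_gt0_pi _ (- v); rewrite sinN => H'; rewrite -oppr_gt0 H' //; lra.
- have [v [v1 v2 v3]] : exists v, [/\ pi < v, v < 2 * pi & v <= phi 1].
    by have [?|?] := ltP (phi 1) (3 * pi / 2);
      [exists (phi 1)|exists (3 * pi / 2)]; split; lra.
  have [|t tin tE] := @ivt01 phi v cphi; first by apply/orP; left; lra.
  have := sphi _ tin; rewrite tE leNgt => /negP; apply.
  by apply: sin_lt0; lra.
Qed.

(** Two continuous arguments of one path differ by a constant, since their
    difference stays where the cosine is [1]. *)
Lemma arg_of_path (q : R -> plane) (th ph : R -> R) :
  continuous th -> continuous ph ->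
  (forall t : R, 0 <= t <= 1 -> arg_of (q t) (th t)) ->
  (forall t : R, 0 <= t <= 1 -> arg_of (q t) (ph t)) ->
  th 1 - th 0 = ph 1 - ph 0.
Proof.
move=> thc phc qth qph.
pose psi t := (th t - ph t) - (th 0 - ph 0).
have cosd t : 0 <= t <= 1 -> cos (th t - ph t) = 1.
  by move=> t01; apply: arg_of_uniq (qth _ t01) (qph _ t01).
have z01 : 0 <= (0 : R) <= 1 by rewrite lexx ler01.
have o01 : 0 <= (1 : R) <= 1 by rewrite lexx ler01.
have cpsi t : 0 <= t <= 1 -> cos (psi t) = 1.
  move=> t01; rewrite cosB !cosd //.
  by rewrite (cos_eq1_sin_eq0 (cosd _ t01)) mul0r addr0 mulr1.
have psic : continuous psi.
  move=> t; apply: cvgB; last exact: cst_continuous.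
  by apply: cvgB; [exact: thc|exact: phc].
have psi0 : psi 0 = 0 by rewrite /psi subrr.
have /andP[l1 l2] : 0 <= psi 1 <= pi.
  apply: sin_ge0_trap => //; first by move=> t t01; rewrite cos_eq1_sin_eq0 ?lexx ?cpsi.
  by rewrite psi0 lexx pi_ge0.
suff : psi 1 = 0 by rewrite /psi; lra.
apply/eqP; rewrite eq_le l1 andbT leNgt; apply/negP => psi1.
have := cpsi _ o01; suff : cos (psi 1) < 1 by lra.
by apply: cos_lt1; have := @pi_gt0 R; lra.
Qed.

Definition dotp (p q : plane) : R := p.1 * q.1 + p.2 * q.2.
Definition detp (p q : plane) : R := p.1 * q.2 - p.2 * q.1.

(** As long as [p] and [q] make an acute angle, the angle from [p] to [q] is given
    by [atan], hence depends continuously on both. *)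
Lemma arg_of_step p q t : 0 < dotp p q -> arg_of p t ->
  arg_of q (t + atan (detp p q / dotp p q)).
Proof.
move=> d0 [r r0 pE]; set w := _ / _.
have /andP[a1 a2] := (atan_def w).1.
have ca : 0 < cos (atan w) by apply: cos_gt0_pihalf; rewrite -mulNr in a1 *; lra.
have sa : sin (atan w) = w * cos (atan w).
  by rewrite -{2}(atanK w) /tan mulfVK // gt_eqF.
exists (dotp p q / (r * cos (atan w))); first by rewrite divr_gt0 ?mulr_gt0.
have pn0 : dotp p q != 0 by rewrite gt_eqF.
have rn0 : r != 0 by rewrite gt_eqF.
have can0 : cos (atan w) != 0 by rewrite gt_eqF.
rewrite /dir cosD sinD sa scaleE /=.
have cs := cos2sin2 t.
have pw : dotp p q * w = detp p q by rewrite /w mulrC divfK.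
have E1 : r * q.1 = dotp p q * cos t - detp p q * sin t.
  by rewrite /dotp /detp pE !scaleE /=; ring: cs.
have E2 : r * q.2 = dotp p q * sin t + detp p q * cos t.
  by rewrite /dotp /detp pE !scaleE /=; ring: cs.
rewrite [q]surjective_pairing; congr pair; apply: (mulfI rn0).
  by rewrite E1 -pw; field; rewrite rn0 can0.
by rewrite E2 -pw; field; rewrite rn0 can0.
Qed.

Lemma arg_of_exists (q : plane) :
  q <> 0 -> exists2 t, 0 <= t <= 2 * pi & arg_of q t.
Proof.
move=> q0; have [r r0 rE] : exists2 r, 0 < r & q.1 ^+ 2 + q.2 ^+ 2 = r ^+ 2.
  exists (Num.sqrt (q.1 ^+ 2 + q.2 ^+ 2)); last first.
    by rewrite sqr_sqrtr // addr_ge0 ?sqr_ge0.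
  rewrite sqrtr_gt0 lt_neqAle addr_ge0 ?sqr_ge0 // andbT eq_sym.
  rewrite paddr_eq0 ?sqr_ge0 // !sqrf_eq0; apply/negP => /andP[/eqP a /eqP b].
  by apply: q0; rewrite [q]surjective_pairing a b.
have rn0 : r != 0 by rewrite gt_eqF.
have c1 : -1 <= q.1 / r <= 1.
  rewrite ler_pdivlMr // ler_pdivrMr // mul1r mulN1r.
  by have := sqr_ge0 q.2; apply: contraTT => /nandP[]; rewrite -ltNge => ?; nra.
have pi0 := @pi_gt0 R.
have [a0 api] : 0 <= acos (q.1 / r) /\ acos (q.1 / r) <= pi.
  by rewrite acos_ge0 ?acos_lepi.
have cE : cos (acos (q.1 / r)) = q.1 / r by apply: acosK; rewrite in_itv.
have sq : Num.sqrt (1 - (q.1 / r) ^+ 2) = `|q.2 / r|.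
  rewrite -sqrtr_sqr; congr Num.sqrt.
  have -> : 1 = (q.1 ^+ 2 + q.2 ^+ 2) / r ^+ 2 :> R by rewrite rE divff ?expf_neq0.
  by field.
suff [s s02 [sE1 sE2]] :
    exists2 s, 0 <= s <= 2 * pi & cos s = q.1 / r /\ sin s = q.2 / r.
  exists s => //; exists r => //; rewrite /dir sE1 sE2 scaleE /= [LHS]surjective_pairing.
  by congr pair; rewrite mulrC divfK.
have [q2|q2] := leP 0 (q.2 / r).
  exists (acos (q.1 / r)); first by lra.
  by rewrite sin_acos // sq ger0_norm.
exists (- acos (q.1 / r) + pi *+ 2); first by rewrite mulr2n; lra.
by rewrite cosD2pi sinD2pi sinN cosN sin_acos // sq ltr0_norm // opprK.
Qed.

End Angle.

(** * Lifting the argument over a square, and linked paths *)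

Section Lifting.
Context {R : realType}.
Local Notation plane := (R * R)%type.

Definition unit_square : set plane := [set p | 0 <= p.1 <= 1 /\ 0 <= p.2 <= 1].

Lemma unit_square_compact : compact unit_square.
Proof.
have -> : unit_square = `[0, 1] `*` `[0, 1].
  by apply/seteqP; split=> -[s t] /=; rewrite /unit_square /= !in_itv.
by apply: compact_setX; exact: segment_compact.
Qed.

Lemma dotp_gt0 (p : plane) : p <> 0 -> 0 < dotp p p.
Proof.
move=> p0; rewrite /dotp -!expr2 lt_neqAle addr_ge0 ?sqr_ge0 // andbT eq_sym.
rewrite paddr_eq0 ?sqr_ge0 // !sqrf_eq0; apply/negP => /andP[/eqP a /eqP b].
by apply: p0; rewrite [p]surjective_pairing a b.
Qed.

Lemma dotp_continuous (X : topologicalType) (f g : X -> plane) :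
  continuous f -> continuous g -> continuous (fun x => dotp (f x) (g x)).
Proof.
move=> fc gc; apply: cont_add; apply: cont_mul.
- exact: cont_fst.
- exact: cont_fst.
- exact: cont_snd.
- exact: cont_snd.
Qed.

Lemma detp_continuous (X : topologicalType) (f g : X -> plane) :
  continuous f -> continuous g -> continuous (fun x => detp (f x) (g x)).
Proof.
move=> fc gc; apply: cont_sub; apply: cont_mul.
- exact: cont_fst.
- exact: cont_snd.
- exact: cont_snd.
- exact: cont_fst.
Qed.

(** Uniform continuity in the form that argument lifting needs: along the ray from
    the origin to a point of the square, a step of relative length [1 / N] turns [F]
    by less than a right angle. The step length is taken as an extra variable tending
    to [0], and compactness makes one bound valid for all points. *)
Lemma small_steps (F : plane -> plane) :
  continuous F -> (forall p, unit_square p -> F p <> 0) ->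
  exists2 N : nat, (0 < N)%N & forall p i, unit_square p -> (i < N)%N ->
    0 < dotp (F ((i%:R / N%:R) *: p)) (F ((i.+1%:R / N%:R) *: p)).
Proof.
move=> Fc F0.
pose K := `[(0 : R), 1] `*` unit_square.
have Kc : compact K.
  by apply: compact_setX; [exact: segment_compact|exact: unit_square_compact].
pose G (w : R * plane * R) :=
  dotp (F (w.1.1 *: w.1.2)) (F ((w.1.1 + w.2) *: w.1.2)).
have idc : continuous (fun w : R * plane * R => w) by move=> w; exact: cvg_id.
have Gc : continuous G.
  apply: dotp_continuous; apply: cont_comp Fc _; apply: cont_scale.
  - exact/cont_fst/cont_fst.
  - exact/cont_snd/cont_fst.
  - by apply: cont_add; [exact/cont_fst/cont_fst|exact: cont_snd].
  - exact/cont_snd/cont_fst.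
have G0 w : K w -> \forall w' \near w & d \near (0 : R), 0 < G (w', d).
  case: w => s p [/= s01 Kp].
  have Gw : 0 < G ((s, p), 0).
    rewrite /G /= addr0; apply/dotp_gt0/F0; case: Kp => /andP[? ?] /andP[? ?].
    move: s01; rewrite in_itv /= scaleE => /andP[? ?].
    by split=> /=; apply/andP; split; nra.
  exact: (Gc ((s, p), 0) [set r | 0 < r] (lt_nbhsr Gw)).
have [e /= e0 He] := iffLR (compact_near_coveringP K) Kc _ _ (fun d w => 0 < G (w, d)) _ G0.
have N0 : (0 < (Num.truncn (e^-1)).+1)%N by [].
move: (Num.truncn _).+1 (truncnS_gt e^-1) N0 => N eN N0.
exists N => // p i Kp iN.
have N0' : 0 < N%:R :> R by rewrite ltr0n.
have := He N%:R^-1 _ (i%:R / N%:R, p) _; rewrite /G /=.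
have -> : i%:R / N%:R + N%:R^-1 = i.+1%:R / N%:R :> R by rewrite -natr1 mulrDl mul1r.
apply.
  rewrite /= sub0r normrN ger0_norm ?invr_ge0 ?ltW //.
  by rewrite -[ltRHS]invrK ltf_pV2 ?posrE ?invr_gt0.
split=> //=; rewrite in_itv /= divr_ge0 ?ler0n //= ler_pdivrMr // mul1r.
by rewrite ler_nat ltnW.
Qed.

Lemma arg_of_continuous_step (X : topologicalType) (f g : X -> plane) :
  continuous f -> continuous g -> (forall x, 0 < dotp (f x) (g x)) ->
  continuous (fun x => atan (detp (f x) (g x) / dotp (f x) (g x))).
Proof.
move=> fc gc fg0; apply: cont_comp; first by move=> x; exact: continuous_atan.
apply: cont_mul; first exact: detp_continuous.
by move=> x; apply: cvgV; [rewrite gt_eqF|exact: dotp_continuous].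
Qed.

(** The argument is obtained by adding up the small turns along the ray from the
    origin, so that no gluing over the square is needed; precomposition with [clamp]
    makes it continuous on the whole plane. *)
Lemma argument_on_square (F : plane -> plane) :
  continuous F -> (forall p, unit_square p -> F p <> 0) ->
  exists2 th : plane -> R, continuous th &
    forall p, unit_square p -> arg_of (F p) (th p).
Proof.
move=> Fc F0; have [N N0 HN] := small_steps Fc F0.
have N0' : 0 < N%:R :> R by rewrite ltr0n.
have [t0 _ t0E] : exists2 t0, 0 <= t0 <= 2 * pi & arg_of (F 0) t0.
  by apply/arg_of_exists/F0; split=> /=; rewrite lexx ler01.
pose sq (p : plane) : plane := (clamp p.1, clamp p.2).
have sqin p : unit_square (sq p) by split; exact: clamp01.
have sqid p : unit_square p -> sq p = p.
  by case: p => s t [s01 t01]; rewrite /sq /= !clamp_id.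
have idc : continuous (fun p : plane => p) by move=> p; exact: cvg_id.
have sqc : continuous sq.
  by apply: cont_pair; apply: cont_comp continuous_clamp _; [exact: cont_fst|exact: cont_snd].
pose f i (p : plane) := F ((i%:R / N%:R) *: sq p).
have fc i : continuous (f i) by apply: cont_comp Fc _; apply: cont_scale => //; exact: cont_cst.
pose w i p := if (i < N)%N then atan (detp (f i p) (f i.+1 p) / dotp (f i p) (f i.+1 p)) else 0.
exists (fun p => t0 + \sum_(0 <= i < N) w i p).
  apply: cont_add; first exact: cont_cst.
  apply: cont_sum => i; rewrite /w; case: (i < N)%N (HN^~ i) => [HNi|_]; last exact: cont_cst.
  by apply: arg_of_continuous_step => // p; apply: HNi.
move=> p Kp.
suff H j : (j <= N)%N -> arg_of (f j p) (t0 + \sum_(0 <= i < j) w i p).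
  by have := H N (leqnn N); rewrite /f divff ?gt_eqF // scale1r sqid.
elim: j => [_|j IHj jN]; first by rewrite big_geq // addr0 /f mul0r scale0r.
rewrite big_nat_recr //= addrA {2}/w jN; apply: arg_of_step; first exact: HN.
exact/IHj/ltnW.
Qed.

(** A path in the closed upper half plane that ends on the real axis: only the two
    ends of the axis remain possible for its final direction. *)
Lemma upper_half_arg (q : R -> plane) (phi : R -> R) :
  continuous phi -> (forall t : R, 0 <= t <= 1 -> arg_of (q t) (phi t)) ->
  (forall t : R, 0 <= t <= 1 -> 0 <= (q t).2) -> (q 1).2 = 0 ->
  0 <= phi 0 <= pi -> phi 1 = if 0 < (q 1).1 then 0 else pi.
Proof.
move=> phic qphi q2 q12 phi0.
have o01 : 0 <= (1 : R) <= 1 by rewrite lexx ler01.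
have sq (t : R) : 0 <= t <= 1 -> exists2 r : R, 0 < r & q t = (r * cos (phi t), r * sin (phi t)).
  by move=> /qphi [r r0 ->]; exists r.
have /andP[p0 p1] : 0 <= phi 1 <= pi.
  apply: sin_ge0_trap => // t t01; have := q2 _ t01.
  by have [r r0 ->] := sq _ t01; rewrite /= pmulr_rge0.
have [r r0 qE] := sq _ o01; move: q12; rewrite qE /= pmulr_rgt0 //.
move=> /eqP; rewrite mulf_eq0 (gt_eqF r0) /= => /eqP s0.
have [p1'|] := ltP (phi 1) pi; last first.
  by move=> p1'; have -> : phi 1 = pi; [lra|rewrite cospi; case: ifP => //; lra].
have [p0'|] := ltP 0 (phi 1).
  by have := @sin_gt0_pi _ (phi 1); rewrite s0 ltxx p0' p1' => /(_ isT).
by move=> p0'; have -> : phi 1 = 0; [lra|rewrite cos0 ltr01].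
Qed.

Lemma arg_ofN (q : plane) t u : cos u = -1 -> arg_of q t -> arg_of (- q) (t + u).
Proof.
move=> cu [r r0 ->]; exists r => //.
have su : sin u = 0 by apply: cos1sin0; rewrite cu normrN1.
by rewrite /dir cosD sinD cu su !mulr0 !mulrN1 subr0 addr0 !scaleE /= !mulrN.
Qed.

(** Consider the winding of [f s - g t] around the boundary of the square of all
    [(s, t)]. On each side one of [f] and [g] stands still on the line that bounds
    the half plane, so the difference stays on one side of that line, and its
    argument changes by [- pi], [- pi], [0] and [0]. If the difference never vanished,
    it would have a continuous argument on the square, and the total change would
    be [0]. *)
Lemma linked_paths_meet (f g : R -> plane) (A B C D : R) :
  continuous f -> continuous g ->
  (forall t : R, 0 <= t <= 1 -> 0 <= (f t).2) ->
  (forall t : R, 0 <= t <= 1 -> 0 <= (g t).2) ->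
  f 0 = (A, 0) -> f 1 = (B, 0) -> g 0 = (C, 0) -> g 1 = (D, 0) ->
  A < C -> C < B -> B < D ->
  exists s t : R, [/\ 0 <= s <= 1, 0 <= t <= 1 & f s = g t].
Proof.
move=> fc gc f2 g2 f0 f1 g0 g1 AC CB BD; apply: contrapT => nomeet.
have z01 : 0 <= (0 : R) <= 1 by rewrite lexx ler01.
have o01 : 0 <= (1 : R) <= 1 by rewrite lexx ler01.
have idc : continuous (fun p : plane => p) by move=> p; exact: cvg_id.
have idR : continuous (fun t : R => t) by move=> t; exact: cvg_id.
pose F p := f p.1 - g p.2.
have [||th0 th0c th0P] := @argument_on_square F.
- by apply: cont_sub; apply: cont_comp => //; [exact: cont_fst|exact: cont_snd].
- move=> [s t] [/= s01 t01] /subr0_eq st; apply: nomeet; by exists s, t.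
have sq00 : unit_square ((0, 0) : plane) by [].
have [c [c1 thc]] : exists c, cos c = 1 /\ th0 (0, 0) + c = pi.
  exists (pi - th0 (0, 0)); split; last by lra.
  apply: arg_of_uniq (th0P _ sq00); rewrite /F /= f0 g0.
  by exists (C - A); [lra|rewrite /dir cospi sinpi scaleE /=; congr pair => /=; lra].
pose th p := th0 p + c.
have thP p : unit_square p -> arg_of (F p) (th p).
  by move=> Kp; apply: arg_ofD c1 (th0P _ Kp).
have thC : continuous th by apply: cont_add => //; exact: cont_cst.
have th00 : th (0, 0) = pi by exact: thc.
have pi0 := @pi_gt0 R.
have side (q : R -> plane) phi : continuous q -> (forall t : R, 0 <= t <= 1 -> unit_square (q t)) ->
    phi = th \o q -> continuous phi /\ (forall t : R, 0 <= t <= 1 -> arg_of (F (q t)) (phi t)).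
  by move=> qc q01 ->; split; [apply: cont_comp qc|move=> t t01; apply/thP/q01].
(* bottom side: the difference stays in the upper half plane *)
have th10 : th (1, 0) = 0.
  have [||pc pP] := side (fun s => (s, 0)) _ _ _ erefl.
  - by apply: cont_pair => //; exact: cont_cst.
  - by move=> t t01; split.
  rewrite [LHS](upper_half_arg pc pP) /F /= ?f1 ?g0 /= ?subr0 //.
  - by rewrite subr_gt0 CB.
  - by move=> t t01; rewrite subr0 f2.
  - by rewrite th00 lexx ltW.
(* right side: the difference stays in the lower half plane *)
have th11 : th (1, 1) = - pi.
  have [||pc pP] := side (fun t => (1, t)) _ _ _ erefl.
  - by apply: cont_pair => //; exact: cont_cst.
  - by move=> t t01; split.
  have pc' : continuous (fun t => (th \o pair 1) t + pi) by apply: cont_add => //; exact: cont_cst.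
  have pP' (t : R) : 0 <= t <= 1 -> arg_of (- F (1, t)) ((th \o pair 1) t + pi).
    by move=> t01; apply: arg_ofN (pP _ t01); exact: cospi.
  suff : th (1, 1) + pi = 0 by lra.
  rewrite [LHS](upper_half_arg pc' pP') /F /= ?f1 ?g1 /= ?subr0 ?oppr0 //.
  - by rewrite opprB subr_gt0 BD.
  - by move=> t t01; rewrite sub0r opprK g2.
  - by rewrite th10 add0r lexx ltW.
(* left side: the difference stays in the lower half plane *)
have th01 : th (0, 1) = pi.
  have [||pc pP] := side (fun t => (0, t)) _ _ _ erefl.
  - by apply: cont_pair => //; exact: cont_cst.
  - by move=> t t01; split.
  have pc' : continuous (fun t => (th \o pair 0) t - pi) by apply: cont_sub => //; exact: cont_cst.
  have pP' (t : R) : 0 <= t <= 1 -> arg_of (- F (0, t)) ((th \o pair 0) t - pi).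
    by move=> t01; apply: arg_ofN (pP _ t01); rewrite cosN cospi.
  suff : th (0, 1) - pi = 0 by lra.
  rewrite [LHS](upper_half_arg pc' pP') /F /= ?f0 ?g1 /= ?subr0 ?oppr0 //.
  - by rewrite opprB subr_gt0 (lt_trans AC) ?(lt_trans CB).
  - by move=> t t01; rewrite sub0r opprK g2.
  - by rewrite th00 subrr lexx ltW.
(* top side: the difference stays in the upper half plane *)
have : th (1, 1) = pi.
  have [||pc pP] := side (fun s => (s, 1)) _ _ _ erefl.
  - by apply: cont_pair => //; exact: cont_cst.
  - by move=> t t01; split.
  rewrite [LHS](upper_half_arg pc pP) /F /= ?f1 ?g1 /= ?subr0 //.
  - by rewrite subr_gt0 ltNge ltW.
  - by move=> t t01; rewrite subr0 f2.
  - by rewrite th01 lexx ltW.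
by rewrite th11; lra.
Qed.

End Lifting.

(** * Polar coordinates adapted to the regular polygon *)

Section Polygon.
Context {R : realType}.
Local Notation plane := (R * R)%type.

Lemma truncn_itvP (x : R) : 0 <= x -> 0 <= x - (Num.truncn x)%:R < 1.
Proof.
by move=> x0; have := truncn_itv x0; rewrite -natr1 => /andP[? ?]; apply/andP; split; lra.
Qed.

Lemma truncnE (x : R) j : j%:R <= x < j%:R + 1 -> Num.truncn x = j.
Proof. by move=> jx; apply: truncn_def; rewrite -natr1. Qed.

(** Functions given piecewise between consecutive integers, as a sum that makes
    their continuity plain. *)
Lemma piecewise_sum (V : zmodType) (G : nat -> R -> V) N (x : R) :
  (forall j, G j 1 = G j.+1 0) -> 0 <= x < N%:R ->
  G (Num.truncn x) (x - (Num.truncn x)%:R) =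
    G 0%N 0 + \sum_(0 <= j < N) (G j (clamp (x - j%:R)) - G j 0).
Proof.
move=> G1 /andP[x0 xN]; have /andP[u0 u1] := truncn_itvP x0.
set m := Num.truncn x in u0 u1 *.
have mN : (m < N)%N by rewrite -(ltr_nat R); lra.
rewrite (big_cat_nat (leq0n m) (ltnW mN)) /= (big_ltn mN).
rewrite [X in _ = _ + (X + _)](_ : _ = G m 0 - G 0%N 0); last first.
  rewrite -(telescope_sumr (G^~ 0)) //; apply: eq_big_nat => j /andP[_ jm].
  rewrite clamp_ge1 ?G1 // lerBrDr addrC natr1 (le_trans (_ : _ <= m%:R)) ?ler_nat //.
  by lra.
rewrite [X in _ = _ + (_ + (_ + X))]big1_seq ?addr0; last first.
  move=> j /=; rewrite mem_index_iota => /andP[mj _].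
  rewrite clamp_le0 ?subrr //; move: mj; rewrite -(ler_nat R) -natr1; lra.
by rewrite clamp_id ?u0 ?ltW // addrA subrKC [RHS]addrC subrK.
Qed.

Lemma piecewise_continuous (V : normedModType R) (G : nat -> R -> V) N
    (X : topologicalType) (f : X -> R) :
  (forall j, continuous (G j)) -> (forall j, G j 1 = G j.+1 0) ->
  continuous f -> (forall x, 0 <= f x < N%:R) ->
  continuous (fun x => G (Num.truncn (f x)) (f x - (Num.truncn (f x))%:R)).
Proof.
move=> Gc G1 fc fN.
under [X in continuous X]eq_fun do rewrite (piecewise_sum G1 (fN _)).
apply: cont_add; first exact: cont_cst.
apply: cont_sum => j; apply: cont_sub; last exact: cont_cst.
apply: cont_comp (Gc j) _; apply: cont_comp continuous_clamp _.
by apply: cont_sub => //; exact: cont_cst.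
Qed.

Context {n : nat}.
Hypothesis hn : (3 <= n)%N.

Let n_gt0 : 0 < n%:R :> R. Proof. by rewrite ltr0n; lia. Qed.

(** Half of the angle under which a side is seen from the puncture. *)
Definition side_half : R := pi / n%:R.

Lemma side_half_bound : 0 < side_half < pi / 2.
Proof.
rewrite /side_half divr_gt0 ?pi_gt0 //= ltr_pM2l ?pi_gt0 //.
by rewrite ltf_pV2 ?posrE ?(ltr_nat R 2).
Qed.

Lemma cos_side_half : 0 < cos side_half.
Proof. by apply: cos_gt0_pihalf; have := side_half_bound; have := @pi_gt0 R; lra. Qed.

Lemma tan_side_half : 0 < tan side_half.
Proof.
rewrite /tan divr_gt0 ?cos_side_half //.
by apply: sin_gt0_pi; have := side_half_bound; have := @pi_gt0 R; lra.
Qed.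

Lemma vertexE j : @vertex R n j = dir (2 * side_half * j%:R).
Proof. by rewrite /vertex /dir /side_half; congr (cos _, sin _); ring. Qed.

Lemma vertexDn j : @vertex R n (j + n) = vertex n j.
Proof.
rewrite !vertexE /dir natrD mulrDr.
have -> : 2 * side_half * n%:R = pi *+ 2.
  by rewrite /side_half mulr2n; field; rewrite gt_eqF.
by rewrite cosD2pi sinD2pi.
Qed.

Lemma boundaryD (x : R) : 0 <= x -> boundary n (x + n%:R) = boundary n x.
Proof.
move=> x0; rewrite /boundary.
have -> : Num.truncn (x + n%:R) = (Num.truncn x + n)%N.
  by apply: truncnE; rewrite natrD; have := truncn_itvP x0; lra.
by rewrite -addSn !vertexDn natrD; congr (_ *: _ + _ *: _); ring.
Qed.

Lemma boundary_nat j : boundary n (j%:R : R) = vertex n j.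
Proof. by rewrite /boundary natrK subrr subr0 scale1r scale0r addr0. Qed.

Lemma boundary_continuous (X : topologicalType) (f : X -> R) N :
  continuous f -> (forall x, 0 <= f x < N%:R) ->
  continuous (fun x => boundary n (f x)).
Proof.
move=> fc fN; pose G j (u : R) : plane := (1 - u) *: vertex n j + u *: vertex n j.+1.
apply: (@piecewise_continuous _ G N) => //.
  move=> j; apply: cont_add; apply: cont_scale; try exact: cont_cst.
    by apply: cont_sub; [exact: cont_cst|move=> u; exact: cvg_id].
  by move=> u; exact: cvg_id.
by move=> j; rewrite /G subrr !scale0r scale1r subr0 scale1r add0r addr0.
Qed.

(** The argument of the point at position [u] on a side, measured from the first
    end of the side. *)
Definition side_arg (u : R) : R :=
  side_half + atan ((2 * u - 1) * tan side_half).

Let tanKs : atan (tan side_half) = side_half.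
Proof. by apply: tanK; rewrite in_itv /=; have := side_half_bound; have := @pi_gt0 R; lra. Qed.

Lemma side_arg0 : side_arg 0 = 0.
Proof. by rewrite /side_arg mulr0 sub0r mulN1r atanN tanKs subrr. Qed.

Lemma side_arg1 : side_arg 1 = 2 * side_half.
Proof. by rewrite /side_arg mulr1 (_ : 2 - 1 = 1) ?mul1r ?tanKs; lra. Qed.

Lemma side_arg_lt u v : u < v -> side_arg u < side_arg v.
Proof.
move=> uv; rewrite ltrD2l; apply: lt_atan.
by rewrite ltr_pM2r ?tan_side_half //; lra.
Qed.

Lemma side_arg_le u v : u <= v -> side_arg u <= side_arg v.
Proof. by rewrite le_eqVlt => /orP[/eqP -> //|/side_arg_lt /ltW]. Qed.

(** A continuous argument of the boundary path; it identifies positions on the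
    boundary, counted in sides, with angles. *)
Definition boundary_arg (x : R) : R :=
  2 * side_half * (Num.truncn x)%:R + side_arg (x - (Num.truncn x)%:R).

Lemma boundary_arg_nat j : boundary_arg j%:R = 2 * side_half * j%:R.
Proof. by rewrite /boundary_arg natrK subrr side_arg0 addr0. Qed.

Lemma boundary_argD x : 0 <= x -> boundary_arg (x + n%:R) = boundary_arg x + 2 * pi.
Proof.
move=> x0; rewrite /boundary_arg.
have -> : Num.truncn (x + n%:R) = (Num.truncn x + n)%N.
  by apply: truncnE; rewrite natrD; have := truncn_itvP x0; lra.
rewrite natrD (_ : x + _ - (_ + _) = x - (Num.truncn x)%:R); last by ring.
by rewrite /side_half; field; rewrite gt_eqF.
Qed.

Lemma boundary_arg_continuous (X : topologicalType) (f : X -> R) N :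
  continuous f -> (forall x, 0 <= f x < N%:R) ->
  continuous (fun x => boundary_arg (f x)).
Proof.
move=> fc fN; pose G j (u : R) := 2 * side_half * j%:R + side_arg u.
apply: (@piecewise_continuous _ G N) => //.
  move=> j; apply: cont_add; first exact: cont_cst.
  apply: cont_add; first exact: cont_cst.
  apply: cont_comp; first by move=> u; exact: continuous_atan.
  apply: cont_mul; last exact: cont_cst.
  apply: cont_sub; last exact: cont_cst.
  by apply: cont_mul; [exact: cont_cst|move=> u; exact: cvg_id].
by move=> j; rewrite /G side_arg0 side_arg1 -natr1; ring.
Qed.

Lemma boundary_arg_lt x y : 0 <= x -> x < y -> boundary_arg x < boundary_arg y.
Proof.
move=> x0 xy; have y0 : 0 <= y by lra.
have /andP[u0 u1] := truncn_itvP x0; have /andP[v0 v1] := truncn_itvP y0.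
have := le_truncn (ltW xy); rewrite /boundary_arg.
rewrite leq_eqVlt => /orP[/eqP ->|].
  by rewrite ltrD2l; apply: side_arg_lt; lra.
rewrite -(ler_nat R) -natr1 => xy1.
have h0 : 0 < side_half by have := side_half_bound; lra.
have := side_arg_lt u1; rewrite side_arg1 => a1.
have := side_arg_le v0; rewrite side_arg0 => a2.
by nra.
Qed.

Lemma boundary_arg_inj x y : 0 <= x -> 0 <= y ->
  boundary_arg x = boundary_arg y -> x = y.
Proof.
move=> x0 y0 xy; have [H|H|//] := ltgtP x y.
  by have := boundary_arg_lt x0 H; lra.
by have := boundary_arg_lt y0 H; lra.
Qed.

(** In the frame given by the midpoint of a side, the point at position [u] has
    coordinates [cos side_half] and [(2 * u - 1) * sin side_half]. The lower bound on
    the radius is the inradius. *)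
Lemma boundary_polar x : 0 <= x ->
  exists2 r : R, cos side_half <= r & boundary n x = r *: dir (boundary_arg x).
Proof.
move=> x0; rewrite /boundary /boundary_arg /side_arg !vertexE -[(Num.truncn x).+1%:R]natr1.
set j := Num.truncn x; set u := x - j%:R.
set psi := atan _; set mu := 2 * side_half * j%:R + side_half.
have /andP[a1 a2] := (atan_def ((2 * u - 1) * tan side_half)).1.
rewrite -/psi in a1 a2; have cpsi : 0 < cos psi by apply: cos_gt0_pihalf; lra.
have spsi : sin psi = (2 * u - 1) * tan side_half * cos psi.
  by rewrite -{1}(atanK ((2 * u - 1) * tan side_half)) /tan mulfVK // gt_eqF.
have sh : sin side_half = tan side_half * cos side_half.
  by rewrite /tan mulfVK // gt_eqF ?cos_side_half.
exists (cos side_half / cos psi).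
  by rewrite ler_pdivlMr // ler_piMr ?cos_le1 ?ltW ?cos_side_half.
have -> : 2 * side_half * j%:R + (side_half + psi) = mu + psi by rewrite /mu; ring.
have -> : 2 * side_half * (j%:R + 1) = mu + side_half by rewrite /mu; ring.
have -> : 2 * side_half * j%:R = mu - side_half by rewrite /mu; ring.
move: mu psi cpsi spsi {a1 a2} => mu psi cpsi spsi.
rewrite /dir !scaleE /= cosB sinB !cosD !sinD spsi sh.
by congr pair => /=; field; rewrite gt_eqF.
Qed.

Lemma boundary_arg_of x h : 0 <= x -> 0 < h ->
  arg_of (h *: boundary n x) (boundary_arg x).
Proof.
move=> x0 h0; have [r r0 ->] := boundary_polar x0.
exists (h * r); last by rewrite scalerA.
by rewrite mulr_gt0 // (lt_le_trans cos_side_half).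
Qed.

(** In the coordinates [(x, h)], the punctured plane is a half plane modulo
    translation of [x] by [n]. *)
Lemma cone_inj (x y h k : R) : 0 <= x -> x <= y -> y < x + 2 * n%:R -> 0 < h -> 0 < k ->
  h *: boundary n x = k *: boundary n y ->
  h = k /\ (y = x \/ y = x + n%:R).
Proof.
move=> x0 xy yx h0 k0 E; have y0 : 0 <= y by lra.
have := boundary_arg_of x0 h0; rewrite E => ax; have ay := boundary_arg_of y0 k0.
have c1 := arg_of_uniq ay ax.
have y2 : boundary_arg y < boundary_arg x + 4 * pi.
  have := @boundary_arg_lt y (x + n%:R + n%:R) y0.
  by rewrite !boundary_argD //; [move=> H; have := H _; lra|lra].
have y1 : boundary_arg x <= boundary_arg y.
  by case: (ltgtP x y) xy => // [/boundary_arg_lt-/(_ x0)/ltW //|-> //].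
have pi0 := @pi_gt0 R.
have yE : y = x \/ y = x + n%:R.
  have [yx'|yx'] := eqVneq (boundary_arg y) (boundary_arg x).
    by left; apply: boundary_arg_inj.
  have [yx2|yx2] := eqVneq (boundary_arg y) (boundary_arg x + 2 * pi).
    right; apply: boundary_arg_inj; rewrite ?boundary_argD //; lra.
  have no (z : R) : cos z = 1 -> ~~ (0 < z < 2 * pi).
    by move=> z1; apply/negP => /cos_lt1; rewrite z1 ltxx.
  have lt1 : boundary_arg x < boundary_arg y by rewrite lt_neqAle eq_sym yx'.
  have := no _ c1; rewrite subr_gt0 lt1 /= -leNgt => le2.
  have : cos (boundary_arg y - boundary_arg x - 2 * pi) = 1.
    by rewrite -cosD2pi -[RHS]c1 mulr2n; congr cos; ring.
  move/no; rewrite subr_gt0 lt_neqAle le2 andbT negb_and negbK.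
  case/orP => [/eqP H|]; last by rewrite -leNgt; lra.
  by move: yx2; rewrite H addrC subrK eqxx.
split=> //.
have bE : boundary n y = boundary n x by case: yE => -> //; rewrite boundaryD.
move: E; rewrite bE; have [r r0 ->] := boundary_polar x0.
rewrite !scalerA => E; have {r0} r0 : 0 < r by rewrite (lt_le_trans cos_side_half).
have : dotp ((h * r) *: dir (boundary_arg x)) (dir (boundary_arg x)) =
       dotp ((k * r) *: dir (boundary_arg x)) (dir (boundary_arg x)) by rewrite E.
rewrite /dotp /dir !scaleE /= -!mulrA -!mulrDr -!expr2 cos2Dsin2 !mulr1.
by apply: mulIf; rewrite gt_eqF.
Qed.

End Polygon.

(** * The shape of the punctured polygon *)

Section PolygonShape.
Context {R : realType}.
Local Notation plane := (R * R)%type.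
Context {n : nat}.
Hypothesis hn : (3 <= n)%N.
Local Notation polygon := (@polygon R n).
Local Notation vertex := (@vertex R n).

Lemma polygon_convex p q (t : R) :
  0 <= t <= 1 -> polygon p -> polygon q -> polygon ((1 - t) *: p + t *: q).
Proof.
move=> /andP[t0 t1] [v [v0 v1] ->] [w [w0 w1] ->].
exists (fun i => (1 - t) * v i + t * w i).
  split=> [i|]; first by rewrite addr_ge0 ?mulr_ge0 // subr_ge0.
  by rewrite big_split /= -!mulr_sumr v1 w1; ring.
rewrite !scaler_sumr -big_split /=; apply: eq_bigr => i _.
by rewrite [RHS]scalerDl !scalerA.
Qed.

Lemma vertex_modn j : vertex (j %% n) = vertex j.
Proof.
rewrite [in RHS](divn_eq j n); elim: (j %/ n)%N => [//|k IHk].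
by rewrite mulSn -addnA addnC vertexDn.
Qed.

Lemma polygon_vertex j : polygon (vertex j).
Proof.
have jn : (j %% n < n)%N by rewrite ltn_mod; lia.
pose i0 := Ordinal jn.
exists (fun i => (i == i0)%:R).
  split=> [i|]; first by rewrite ler0n.
  by rewrite (bigD1 i0) //= eqxx big1 ?addr0 // => i /negPf ->.
rewrite (bigD1 i0) //= eqxx scale1r big1 ?addr0 ?vertex_modn //.
by move=> i /negPf ->; rewrite scale0r.
Qed.

Lemma polygon_boundary (x : R) : 0 <= x -> polygon (boundary n x).
Proof.
move=> x0; have := truncn_itvP x0 => /andP[? ?].
by apply: polygon_convex; [lra|exact: polygon_vertex|exact: polygon_vertex].
Qed.

(** By the intermediate value theorem, over one full turn. *)
Lemma boundary_arg_surj (t : R) : 0 <= t <= 2 * pi ->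
  exists2 x : R, 0 <= x & boundary_arg (n := n) x = t.
Proof.
move=> t02; pose f (s : R) := clamp s * n%:R.
have fc : continuous f.
  by apply: cont_mul; [exact: continuous_clamp|exact: cont_cst].
have fn s : 0 <= f s <= n%:R.
  by have := clamp01 s; have := ler0n R n; rewrite /f => ? /andP[? ?]; apply/andP; split; nra.
have [||s s01 sE] := @ivt01 _ (fun s => boundary_arg (n := n) (f s)) t.
- apply: (boundary_arg_continuous hn (N := n.+1)) => // s.
  by have := fn s; rewrite -natr1; lra.
- apply/orP; left; rewrite /f clamp_le0 // clamp_ge1 // mul0r mul1r.
  rewrite (boundary_arg_nat hn 0) (boundary_arg_nat hn) mulr0 /side_half.
  by rewrite mulrA divfK // pnatr_eq0; lia.
- by exists (f s) => //; have /andP[] := fn s.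
Qed.

(** The puncture lies between the vertex [0] and the boundary point opposite to it. *)
Lemma polygon0 : polygon 0.
Proof.
have [|x x0 xpi] := @boundary_arg_surj pi; first by have := @pi_gt0 R; lra.
have [r r0 xE] := boundary_polar hn x0; have c0 := cos_side_half (R := R) hn.
have r1 : 0 < 1 + r by lra.
have := polygon_convex (t := (1 + r)^-1) _ (polygon_vertex 0) (polygon_boundary x0).
rewrite xE vertexE mulr0 xpi /dir sin0 cos0 cospi sinpi !scaleE /=.
set p := (_, _) + _ => H; suff -> : 0 = p.
  by apply: H; rewrite invr_ge0 ltW //= invf_le1 //; lra.
by congr pair => /=; field; rewrite gt_eqF.
Qed.

Lemma polygon_cone (x h : R) : 0 <= x -> 0 <= h <= 1 -> polygon (h *: boundary n x).
Proof.
move=> x0 h01; have := polygon_convex h01 polygon0 (polygon_boundary x0).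
by rewrite scaler0 add0r.
Qed.

(** The ray through [p] meets the boundary at distance at least [cos side_half]. *)
Lemma polygon_ball (p : plane) : dotp p p <= cos (side_half (R := R) (n := n)) ^+ 2 -> polygon p.
Proof.
move=> pc; have [->|/eqP p0] := eqVneq p 0; first exact: polygon0.
have [t t02 [r r0 pE]] := arg_of_exists p0.
have [x x0 xt] := boundary_arg_surj t02.
have [s s0 bE] := boundary_polar hn x0; have c0 := cos_side_half (R := R) hn.
have -> : p = (r / s) *: boundary n x.
  by rewrite bE xt scalerA divfK // gt_eqF //; lra.
apply: polygon_cone => //; apply/andP; split; first by apply: divr_ge0; lra.
rewrite ler_pdivrMr ?mul1r; last by lra.
apply: le_trans s0.
rewrite -ler_sqr ?nnegrE; try by rewrite ltW.
apply: le_trans pc; rewrite pE /dotp !scaleE /= le_eqVlt.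
by apply/orP; left; apply/eqP; rewrite -[LHS]mulr1 -(cos2Dsin2 t); ring.
Qed.

Lemma near_pos (f : plane -> R) p : continuous f -> 0 < f p -> \forall q \near p, 0 < f q.
Proof. by move=> fc fp; exact: (fc p _ (lt_nbhsr fp)). Qed.

Lemma punctured_cone (x h : R) : 0 <= x -> 0 < h <= 1 ->
  punctured_polygon n (h *: boundary n x).
Proof.
move=> x0 /andP[h0 h1]; split; first by apply: polygon_cone => //; lra.
by apply: arg_of_neq0 (boundary_arg_of hn x0 h0).
Qed.

(** By convexity, scaling the inscribed disc by [1 - h] and centering it at
    [h *: boundary n x] keeps it inside the polygon. *)
Lemma punctured_interior_cone (x h : R) : 0 <= x -> 0 < h < 1 ->
  punctured_interior n (h *: boundary n x).
Proof.
move=> x0 /andP[h0 h1]; set p := h *: boundary n x.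
have c0 := cos_side_half (R := R) hn; set c := cos _ in c0.
have h1' : 0 < 1 - h by lra.
pose g (q : plane) := (1 - h)^-1 *: (q - p).
have idc : continuous (fun q : plane => q) by move=> q; exact: cvg_id.
have gc : continuous g.
  by apply: cont_scale; [exact: cont_cst|apply: cont_sub => //; exact: cont_cst].
have n1 : \forall q \near p, 0 < c ^+ 2 - dotp (g q) (g q).
  apply: near_pos; first by apply: cont_sub; [exact: cont_cst|exact: dotp_continuous].
  by rewrite /g subrr scaler0 /dotp /= !mulr0 addr0 subr0 exprn_gt0.
have n2 : \forall q \near p, 0 < dotp q p.
  apply: near_pos; first by apply: dotp_continuous => //; exact: cont_cst.
  by apply/dotp_gt0/(punctured_cone x0 _).2; lra.
rewrite /punctured_interior /interior; near=> q; split.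
  have -> : q = (1 - (1 - h)) *: boundary n x + (1 - h) *: g q.
    by rewrite /g scalerA divff ?gt_eqF // scale1r subKr subrKC.
  apply: polygon_convex; [lra|exact: polygon_boundary|].
  have : 0 < c ^+ 2 - dotp (g q) (g q) by near: q.
  by rewrite subr_gt0 => /ltW; exact: polygon_ball.
move=> /= q0; have : 0 < dotp q p by near: q.
by rewrite q0 /dotp /= !mul0r addr0 ltxx.
Unshelve. all: by end_near.
Qed.

Lemma dotp_dir (t : R) : dotp (dir t) (dir t) = 1.
Proof. by rewrite /dotp /= -!expr2 cos2Dsin2. Qed.

Lemma dotpZ (r s : R) (p q : plane) : dotp (r *: p) (s *: q) = r * s * dotp p q.
Proof. by rewrite /dotp !scaleE /=; ring. Qed.

Lemma dotp_vertex j : dotp (vertex j) (vertex j) = 1.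
Proof. by rewrite vertexE dotp_dir. Qed.

Lemma dotp_suml m (w : 'I_m -> R) (v : 'I_m -> plane) q :
  dotp (\sum_i w i *: v i) q = \sum_i w i * dotp (v i) q.
Proof.
elim/big_rec2: _ => [|i y1 y2 _ <-]; first by rewrite /dotp /= !mul0r addr0.
by rewrite /dotp !scaleE /=; ring.
Qed.

(** Tested against the direction of [p], a convex combination of unit vectors is at
    most [1]. *)
Lemma polygon_le1 p : polygon p -> dotp p p <= 1.
Proof.
move=> Kp; have [->|/eqP p0] := eqVneq p 0.
  by rewrite /dotp /= !mulr0 addr0 ler01.
have [t t02 [r r0 pE]] := arg_of_exists p0.
have : dotp p (dir t) = r by rewrite pE -[dir t in X in dotp _ X]scale1r dotpZ dotp_dir !mulr1.
have : dotp p (dir t) <= 1.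
  case: Kp => w [w0 w1] ->; rewrite dotp_suml -w1; apply: ler_sum => i _.
  rewrite -[leRHS]mulr1 ler_wpM2l // vertexE /dotp /= -cosB; exact: cos_le1.
by rewrite pE dotpZ dotp_dir; nra.
Qed.

(** An interior point can be moved a little further away from the puncture without
    leaving the disc. *)
Lemma punctured_interior_lt1 (p : plane) : punctured_interior n p -> dotp p p < 1.
Proof.
move=> Kp; have p0 : p <> 0 by move: (interior_subset Kp) => -[].
have pp0 := dotp_gt0 p0.
pose g (s : R) : plane := s *: p.
have gc : continuous g by apply: cont_scale; [move=> s; exact: cvg_id|exact: cont_cst].
have : \forall s \near (1 : R), punctured_polygon n (g s).
  by apply: gc; rewrite /g scale1r.
move=> [e /= e0 He].
have : polygon (g (1 + e / 2)).
  apply: (He _ _).1; rewrite /= opprD addrA subrr sub0r normrN gtr0_norm; lra.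
by move/polygon_le1; rewrite dotpZ => H; nra.
Qed.

End PolygonShape.

(** * Lifting edges to the universal cover *)

Section Crossings.
Context {R : realType}.
Local Notation plane := (R * R)%type.

Lemma in01 (t : R) : 0 <= t <= 1 -> t \in `[0, 1].
Proof. by move=> t01; rewrite inE /= in_itv. Qed.

Lemma in01oo (t : R) : 0 < t < 1 -> t \in `]0, 1[.
Proof. by move=> t01; rewrite inE /= in_itv. Qed.

(** The half plane of [linked_paths_meet] is the universal cover of the punctured
    disc, and the polygon touches the unit circle only at its vertices; this is why
    the edges are regarded as paths in the disc. *)
Definition disc_arc (al : R -> plane) :=
  [/\ continuous (al \o clamp), dotp (al 0) (al 0) = 1, dotp (al 1) (al 1) = 1 &
      forall t : R, 0 < t < 1 -> dotp (al t) (al t) < 1].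

(** [th] lifts [al] to the universal cover of the punctured plane. *)
Definition lifts (th : R -> R) (al : R -> plane) (A B : R) :=
  [/\ continuous th, forall t : R, 0 <= t <= 1 -> arg_of (al t) (th t),
      th 0 = A & th 1 = B].

Lemma arg_of_eq (p q : plane) t :
  arg_of p t -> arg_of q t -> dotp p p = dotp q q -> p = q.
Proof.
move=> [r r0 ->] [s s0 ->]; rewrite !dotpZ dotp_dir !mulr1 -!expr2 => /eqP.
by rewrite eqrXn2 ?ltW // => /eqP ->.
Qed.

Lemma disc_arc_ends al t : disc_arc al -> 0 <= t <= 1 ->
  dotp (al t) (al t) = 1 -> t = 0 \/ t = 1.
Proof.
move=> [_ _ _ al1] /andP[t0 t1] alt.
have [->|t0'] := eqVneq t 0; first by left.
have [->|t1'] := eqVneq t 1; first by right.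
have := al1 t; rewrite alt ltxx !lt_neqAle t0 t1 t1' eq_sym t0' /=.
by move/(_ isT).
Qed.

(** The lifted paths are [(th, 1 - |al|^2)]: on a ray from the puncture, the second
    coordinate determines the point. The crossing is not at an end, because only the
    ends have second coordinate [0] and the four ends are distinct. *)
Lemma linked_arcs_cross al be th ph (A B C D : R) :
  disc_arc al -> disc_arc be -> lifts th al A B -> lifts ph be C D ->
  A < C -> C < B -> B < D ->
  exists s t : R, [/\ 0 < s < 1, 0 < t < 1, al s = be t & th s = ph t].
Proof.
move=> ald bed [thc thP th0 th1] [phc phP ph0 ph1] AC CB BD.
have [alc al0 al1 al01] := ald; have [bec be0 be1 be01] := bed.
pose f s := (th s, 1 - dotp (al (clamp s)) (al (clamp s))).
pose g t := (ph t, 1 - dotp (be (clamp t)) (be (clamp t))).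
have le1 ga t : disc_arc ga -> 0 <= t <= 1 -> dotp (ga t) (ga t) <= 1.
  move=> [_ ga0 ga1 ga01] /andP[t0 t1].
  have [->|t0'] := eqVneq t 0; first by rewrite ga0.
  have [->|t1'] := eqVneq t 1; first by rewrite ga1.
  by apply/ltW/ga01; rewrite !lt_neqAle t0 t1 t1' eq_sym t0'.
have clamp0 : clamp (0 : R) = 0 by exact: clamp_le0.
have clamp1 : clamp (1 : R) = 1 by exact: clamp_ge1.
have [||t t01|t t01|||||s [t [s01 t01 [thph E]]]] :=
    @linked_paths_meet R f g A B C D _ _ _ _ _ _ _ _ AC CB BD.
- apply: cont_pair => //; apply: cont_sub; first exact: cont_cst.
  by apply: (@dotp_continuous _ _ (al \o clamp) (al \o clamp)).
- apply: cont_pair => //; apply: cont_sub; first exact: cont_cst.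
  by apply: (@dotp_continuous _ _ (be \o clamp) (be \o clamp)).
- by rewrite /= clamp_id // subr_ge0; exact: le1.
- by rewrite /= clamp_id // subr_ge0; exact: le1.
- by rewrite /f clamp0 al0 th0 subrr.
- by rewrite /f clamp1 al1 th1 subrr.
- by rewrite /g clamp0 be0 ph0 subrr.
- by rewrite /g clamp1 be1 ph1 subrr.
move: E; rewrite !clamp_id // => /(can_inj (subKr 1)) E.
have alE : al s = be t by apply: arg_of_eq (thP _ s01) _ E; rewrite thph; exact: phP.
have neq : ~ dotp (al s) (al s) = 1.
  move=> H; have := disc_arc_ends ald s01 H; rewrite alE in H.
  have := disc_arc_ends bed t01 H; move: thph.
  by case=> [H1 [H2|H2] [H3|H3]]; move: H1; rewrite H2 H3 ?th0 ?th1 ?ph0 ?ph1; lra.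
have in01 (u : R) : 0 <= u <= 1 -> u != 0 -> u != 1 -> 0 < u < 1.
  by move=> /andP[u0 u1] u0' u1'; rewrite !lt_neqAle u0 u1 u1' eq_sym u0'.
exists s, t; split=> //; apply: in01 => //; apply/negP => /eqP e.
- by apply: neq; rewrite e.
- by apply: neq; rewrite e.
- by apply: neq; rewrite alE e.
- by apply: neq; rewrite alE e.
Qed.

Context {n : nat}.
Lemma bsteps_le (a b : 'I_n) : (bsteps a b <= n)%N.
Proof.
have := ltn_ord a; have := ltn_ord b => bn an.
by rewrite /bsteps; case: (ltnP a b); lia.
Qed.

Lemma delta_range (a b : 'I_n) (t : R) : 0 <= t <= 1 ->
  0 <= a%:R + t * (bsteps a b)%:R < (2 * n)%:R.
Proof.
move=> /andP[t0 t1].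
have : a%:R + 1 <= n%:R :> R by rewrite natr1 ler_nat.
have : (bsteps a b)%:R <= n%:R :> R by rewrite ler_nat bsteps_le.
rewrite natrM; have := ler0n R a; have := ler0n R (bsteps a b).
by move=> *; apply/andP; split; nra.
Qed.

Lemma delta_param_continuous (a b : 'I_n) :
  continuous (fun t : R => a%:R + clamp t * (bsteps a b)%:R).
Proof.
apply: cont_add; first exact: cont_cst.
by apply: cont_mul; [exact: continuous_clamp|exact: cont_cst].
Qed.

Definition vertex_offset (a c : 'I_n) : nat := (if a <= c then c - a else c + n - a)%N.

Lemma vertex_offset_lt (a c : 'I_n) : (vertex_offset a c < n)%N.
Proof.
have := ltn_ord a; have := ltn_ord c => cn an.
by rewrite /vertex_offset; case: (leqP a c); lia.
Qed.

Lemma vertex_offsetP (a c : 'I_n) : (a + vertex_offset a c = c \/ a + vertex_offset a c = c + n)%N.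
Proof.
have := ltn_ord a; have := ltn_ord c => cn an.
by rewrite /vertex_offset; case: (leqP a c); lia.
Qed.

Hypothesis hn : (3 <= n)%N.
Local Notation h := (side_half (R := R) (n := n)).

Lemma side_half_gt0 : 0 < h. Proof. by have /andP[] := side_half_bound (R := R) hn. Qed.

Lemma edge_disc_arc a b al : @is_edge R n a b al -> disc_arc al.
Proof.
move=> [[alc al0 al1] _ ali _ _]; split.
- apply: within_continuous_comp alc continuous_clamp _ => x.
  by rewrite /= in_itv /=; exact: clamp01.
- by rewrite al0 dotp_vertex.
- by rewrite al1 dotp_vertex.
- by move=> t t01; apply: (@punctured_interior_lt1 _ n); exact/ali/in01oo.
Qed.

(** Lifting the homotopy from an edge to the boundary path shows that the argument
    changes along the edge as it does along the boundary. *)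
Lemma edge_lift a b al (A : R) : @is_edge R n a b al ->
  cos (A - 2 * h * a%:R) = 1 ->
  exists th, lifts th al A (A + 2 * h * (bsteps a b)%:R).
Proof.
move=> [[_ al0 al1] [H [Hc HD Hends Hside]] _ _ _] cA.
have z01 : 0 <= (0 : R) <= 1 by rewrite lexx ler01.
have o01 : 0 <= (1 : R) <= 1 by rewrite lexx ler01.
have idR : continuous (fun t : R => t) by move=> t; exact: cvg_id.
pose sq (p : plane) : plane := (clamp p.1, clamp p.2).
have [||Th Thc ThP] := @argument_on_square R (H \o sq).
- apply: within_continuous_comp Hc _ _.
    apply: cont_pair; apply: cont_comp continuous_clamp _.
      by apply: cont_fst => p; exact: cvg_id.
    by apply: cont_snd => p; exact: cvg_id.
  by move=> p; split; rewrite /= in_itv /= clamp01.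
- move=> p _; have : punctured_polygon n ((H \o sq) p).
    by apply: HD; exists (sq p) => //; split; rewrite /= in_itv /= clamp01.
  by case.
have Thbox (s t : R) : 0 <= s <= 1 -> 0 <= t <= 1 -> arg_of (H (s, t)) (Th (s, t)).
  by move=> s01 t01; have := ThP (s, t) (conj s01 t01); rewrite /= /sq /= !clamp_id.
have sideC (t : R) : 0 <= t <= 1 -> (forall s : R, 0 <= s <= 1 -> H (s, t) = H (0, t)) ->
    Th (1, t) = Th (0, t).
  move=> t01 Ht; apply/eqP; rewrite -subr_eq0; apply/eqP.
  rewrite (@arg_of_path _ (fun s => H (s, t)) (fun s => Th (s, t)) (fun _ => Th (0, t))) ?subrr //.
  - by apply: cont_comp Thc _; apply: cont_pair => //; exact: cont_cst.
  - exact: cont_cst.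
  - by move=> s s01; exact: Thbox.
  - by move=> s s01; rewrite Ht //; exact: Thbox.
have s0 : Th (1, 0) = Th (0, 0).
  by apply: sideC => // s s01; rewrite (Hside _ (in01 s01)).1 (Hside _ (in01 z01)).1.
have s1 : Th (1, 1) = Th (0, 1).
  by apply: sideC => // s s01; rewrite (Hside _ (in01 s01)).2 (Hside _ (in01 z01)).2.
pose ph (t : R) := boundary_arg (n := n) (a%:R + clamp t * (bsteps a b)%:R : R).
have topE : Th (1, 1) - Th (1, 0) = ph 1 - ph 0.
  apply: (@arg_of_path _ (delta a b) (fun t => Th (1, t)) ph).
  - by apply: cont_comp Thc _; apply: cont_pair => //; exact: cont_cst.
  - have rg (t : R) : 0 <= a%:R + clamp t * (bsteps a b)%:R < (2 * n)%:R.
      by apply: delta_range; exact: clamp01.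
    exact: (boundary_arg_continuous hn (@delta_param_continuous a b) rg).
  - by move=> t t01; rewrite -(Hends _ (in01 t01)).2; exact: Thbox.
  - move=> t t01; rewrite /ph clamp_id // /delta -[boundary _ _]scale1r.
    by apply: (boundary_arg_of hn); rewrite ?ltr01 //; case/andP: (delta_range a b t01).
have phE : ph 1 - ph 0 = 2 * h * (bsteps a b)%:R.
  rewrite /ph clamp_ge1 // clamp_le0 // mul1r mul0r addr0 -natrD.
  by rewrite !(boundary_arg_nat hn) natrD; ring.
exists (fun t => Th (0, t) + (A - Th (0, 0))); split.
- apply: cont_add; last exact: cont_cst.
  by apply: cont_comp Thc _; apply: cont_pair => //; exact: cont_cst.
- move=> t t01; apply: arg_ofD; last by rewrite -(Hends _ (in01 t01)).1; exact: Thbox.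
  have c1 : cos (Th (0, 0) - 2 * h * a%:R) = 1.
    apply: arg_of_uniq (Thbox _ _ z01 z01) _.
    rewrite (Hends _ (in01 z01)).1 al0 vertexE.
    by exists 1; rewrite ?scale1r.
  rewrite (_ : A - _ = (A - 2 * h * a%:R) - (Th (0, 0) - 2 * h * a%:R)); last by ring.
  by rewrite cosB cA c1 (cos_eq1_sin_eq0 cA) mul0r addr0 mulr1.
- by rewrite subrKC.
- by rewrite -phE -topE s0 s1; ring.
Qed.

Local Notation meet al be := (trace al `&` trace be `&` punctured_interior n).

Lemma meetP a b al be (s t : R) : @is_edge R n a b al ->
  0 < s < 1 -> 0 <= t <= 1 -> al s = be t -> meet al be (al s).
Proof.
move=> [_ _ ali _ _] s01 t01 E; split; last exact/ali/in01oo.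
split; first by exists s => //=; rewrite in_itv /= !ltW //; case/andP: s01.
by rewrite E; exists t => //=; rewrite in_itv.
Qed.

Lemma card_ge1 T (X : set T) j x : X x -> X #= `I_j -> (1 <= j)%N.
Proof.
by move=> Xx /card_set_bijP [f [fI _ _]]; apply: leq_ltn_trans (fI _ Xx).
Qed.

Lemma card_ge2 T (X : set T) j x y : X x -> X y -> x <> y -> X #= `I_j -> (2 <= j)%N.
Proof.
move=> Xx Xy xy Xj; case: j Xj => [|[|//]] Xj.
  by have := card_ge1 Xx Xj.
have /card_set_bijP [f [fI finj _]] := Xj.
have /= := fI _ Xx; have /= := fI _ Xy; rewrite !ltnS !leqn0 => /eqP fy /eqP fx.
by exfalso; apply: xy; apply: finj; rewrite ?inE // fx fy.
Qed.

Lemma side_half_n : 2 * h * n%:R = 2 * pi.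
Proof. by rewrite /side_half; field; rewrite pnatr_eq0; lia. Qed.

Lemma cos_vertex_offset (a c : 'I_n) : cos (2 * h * (a + vertex_offset a c)%:R - 2 * h * c%:R) = 1 :> R.
Proof.
case: (vertex_offsetP a c) => ->; first by rewrite subrr cos0.
by rewrite natrD mulrDr addrC addKr side_half_n mulr_natl cos2pi.
Qed.

End Crossings.

(** * Crossings that cannot be avoided *)

(** On the universal cover, [M] occupies the interval [[0, m]] and [N] the intervals
    [[r, r + s]] modulo [n]. The two summands count the translates of the latter that
    interleave with [[0, m]]: only [[r, r + s]] and [[r - n, r + s - n]] can. A loop
    counts as a ray over its vertex, crossed when the vertex is strictly inside the
    other interval; for two loops the value is the one prescribed by the signs. *)
Definition crossing_count n (M N : tedge n) : nat :=
  let m := bsteps (src M) (tgt M) in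
  let s := bsteps (src N) (tgt N) in
  let r := vertex_offset (src M) (src N) in
  if is_loop M then
    if is_loop N then nat_of_bool ((src M != src N) && (tag_sign M != tag_sign N))
    else (n < r + s)%N
  else if is_loop N then nat_of_bool (0 < r < m)%N
  else ([&& 0 < r, r < m & m < r + s] + (n < r + s < n + m))%N.

Section LowerBound.
Context {R : realType}.
Local Notation plane := (R * R)%type.
Context {n : nat}.
Hypothesis hn : (3 <= n)%N.
Local Notation h := (side_half (R := R) (n := n)).
Local Notation meet al be := (trace al `&` trace be `&` @punctured_interior R n).

Lemma ltr_h (i j : nat) : (i < j)%N -> 2 * h * i%:R < 2 * h * j%:R.
Proof. by move=> ij; rewrite ltr_pM2l ?ltr_nat // mulr_gt0 ?side_half_gt0. Qed.

Lemma lifts_shift th al (A B c : R) : cos c = 1 ->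
  lifts th al A B -> lifts (fun t => th t + c) al (A + c) (B + c).
Proof.
move=> c1 [thc thP th0 th1]; split; rewrite ?th0 ?th1 //.
  by apply: cont_add => //; exact: cont_cst.
by move=> t t01; apply: arg_ofD c1 (thP _ t01).
Qed.

Lemma cos_2pi : cos (2 * pi) = 1 :> R.
Proof. by rewrite mulr_natl cos2pi. Qed.

Lemma cos_N2pi : cos (- (2 * pi)) = 1 :> R.
Proof. by rewrite cosN cos_2pi. Qed.

Lemma meetC al be : meet al be = meet be al.
Proof. by rewrite [trace al `&` _]setIC. Qed.

Lemma oo_cc (t : R) : 0 < t < 1 -> 0 <= t <= 1.
Proof. by move=> /andP[t0 t1]; rewrite !ltW. Qed.

(** A spoke is a ray of constant argument, so it is crossed whenever the argument
    of an arc passes that of the spoke. *)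
Lemma spoke_cross a b c be ph (C D T : R) : @is_edge R n a b be ->
  lifts ph be C D -> C < T -> T < D -> cos (T - 2 * h * (c : 'I_n)%:R) = 1 ->
  exists p, meet (spoke c) be p.
Proof.
move=> beE [phc phP ph0 ph1] CT TD cT.
have bed := edge_disc_arc beE; have [_ be0 be1 be01] := bed.
have [|t t01 tE] := @ivt01 _ ph T phc; first by rewrite ph0 ph1 (ltW CT) (ltW TD).
have t01' : 0 < t < 1.
  have [t0 t1] := andP t01; rewrite !lt_neqAle t0 t1 !andbT.
  apply/andP; split; apply/eqP => e; move: tE.
    by rewrite -e ph0; lra.
  by rewrite e ph1; lra.
have [r r0 bE] := phP _ t01.
have r1 : r < 1.
  have := be01 _ t01'; rewrite bE dotpZ dotp_dir; nra.
exists (be t); split; last by case: beE => _ _ ali _ _; exact/ali/in01oo.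
split; last by exists t => //=; rewrite in_itv.
exists (1 - r); first by rewrite /= in_itv /=; lra.
rewrite /spoke subKr bE tE vertexE; congr (_ *: _).
set y := 2 * h * c%:R in cT *; rewrite /dir -[T](subrK y) (cosD (T - y)) (sinD (T - y)) cT (cos_eq1_sin_eq0 cT).
by rewrite !mul0r !mul1r subr0 add0r.
Qed.

(** Each interleaving translate yields a crossing. Two crossings that come from
    different translates are different points: as the edges do not cross themselves,
    equal points would have equal parameters, but the arguments differ by a full turn. *)
Lemma meet_lower (M N : tedge n) al be j : ~~ (is_loop M && is_loop N) ->
  @arcs R n M al -> arcs N be -> meet al be #= `I_j -> (crossing_count M N <= j)%N.
Proof.
rewrite /crossing_count /arcs.
have := vertex_offset_lt (src M) (src N); have := cos_vertex_offset (R := R) hn (src M) (src N).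
set a := src M; set b := tgt M; set c := src N; set d := tgt N.
set m := bsteps a b; set s := bsteps c d; set r := vertex_offset a c => cr rn.
have c0 : cos (2 * h * a%:R - 2 * h * a%:R) = 1 :> R by rewrite subrr cos0.
have hnn : 2 * h * n%:R = 2 * pi := side_half_n hn.
have E i k : 2 * h * i%:R + 2 * h * k%:R = 2 * h * (i + k)%:R by rewrite natrD mulrDr.
case: (boolP (is_loop M)) => [Ml|Ml]; case: (boolP (is_loop N)) => [Nl|Nl] //= _.
- move=> -> beE Xj; case: (ltnP n (r + s)) => // rs.
  have [ph phl] := edge_lift hn beE cr; rewrite E in phl.
  have [|||p Xp] := @spoke_cross _ _ a _ _ _ _ (2 * h * (a + n)%:R) beE phl.
  + by apply: ltr_h; rewrite ltn_add2l.
  + by apply: ltr_h; rewrite -addnA ltn_add2l.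
  + by rewrite natrD mulrDr hnn addrC addKr cos_2pi.
  exact: card_ge1 Xp Xj.
- move=> alE -> Xj; case: (boolP (0 < r < m)%N) => // /andP[r0 rm].
  have [th thl] := edge_lift hn alE c0; rewrite E in thl.
  have [|||p Xp] := @spoke_cross _ _ c _ _ _ _ (2 * h * (a + r)%:R) alE thl.
  + by apply: ltr_h; rewrite -{1}[val a]addn0 ltn_add2l.
  + by apply: ltr_h; rewrite ltn_add2l.
  + exact: cr.
  by rewrite meetC in Xp; exact: card_ge1 Xp Xj.
- move=> alE beE Xj.
  have ald := edge_disc_arc alE; have bed := edge_disc_arc beE.
  have [th thl] := edge_lift hn alE c0; rewrite E in thl.
  have [ph phl] := edge_lift hn beE cr; rewrite E in phl.
  have phl' := lifts_shift cos_N2pi phl.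
  have X1 : [&& 0 < r, r < m & m < r + s]%N -> exists u v : R,
      [/\ 0 < u < 1, 0 < v < 1, al u = be v & th u = ph v].
    move=> /and3P[r0 rm ms]; apply: linked_arcs_cross ald bed thl phl _ _ _.
    + by apply: ltr_h; rewrite -{1}[val a]addn0 ltn_add2l.
    + by apply: ltr_h; rewrite ltn_add2l.
    + by apply: ltr_h; rewrite -addnA ltn_add2l.
  have X2 : (n < r + s < n + m)%N -> exists u v : R,
      [/\ 0 < u < 1, 0 < v < 1, al u = be v & th u = ph v - 2 * pi].
    move=> /andP[nr rm].
    have [|||v [u [v01 u01 uv E']]] := linked_arcs_cross bed ald phl' thl.
    + by rewrite ltrBlDr -hnn E; apply: ltr_h; rewrite ltn_add2l.
    + by rewrite ltrBrDr -hnn E; apply: ltr_h; rewrite -addnA ltn_add2l.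
    + by rewrite ltrBlDr -hnn E; apply: ltr_h; rewrite -!addnA ltn_add2l [ltnRHS]addnC.
    by exists u, v.
  case: (boolP [&& 0 < r, r < m & m < r + s]%N) X1 => [_ /(_ isT)|_ _];
    case: (boolP (n < r + s < n + m)%N) X2 => [_ /(_ isT)|_ _] //=.
  + move=> [u2 [v2 [u2I v2I E2 T2]]] [u1 [v1 [u1I v1I E1 T1]]].
    have X1 := meetP alE u1I (oo_cc v1I) E1; have X2 := meetP alE u2I (oo_cc v2I) E2.
    apply: card_ge2 X1 X2 _ Xj => e12.
    have [_ _ _ alinj _] := alE; have [_ _ _ beinj _] := beE.
    have u12 : u1 = u2 by apply: alinj => //; exact: in01oo.
    have v12 : v1 = v2 by apply: beinj; rewrite -?E1 -?E2 //; exact: in01oo.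
    by move: T2; rewrite -u12 -v12 T1; have := @pi_gt0 R; lra.
  + move=> [u1 [v1 [u1I v1I E1 T1]]].
    exact: card_ge1 (meetP alE u1I (oo_cc v1I) E1) Xj.
  + move=> [u1 [v1 [u1I v1I E1 T1]]].
    exact: card_ge1 (meetP alE u1I (oo_cc v1I) E1) Xj.
Qed.

End LowerBound.

(** * Parabolic edges *)

Section UpperBound.
Context {R : realType}.
Local Notation plane := (R * R)%type.
Context {n : nat}.
Hypothesis hn : (3 <= n)%N.
Local Notation meet al be := (trace al `&` trace be `&` @punctured_interior R n).

Definition arc_depth (k m x : R) : R := k * (x * (m - x)).

(** The boundary path from [a] to [b], pushed inwards along a parabola. *)
Definition bulge (k : R) (a b : 'I_n) (t : R) : plane :=
  (1 - arc_depth k (bsteps a b)%:R (t * (bsteps a b)%:R)) *: delta a b t.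

Lemma arc_depth_bounds (k m x : R) : 0 < k -> k * m ^+ 2 <= 1 -> 0 < x < m -> 0 < arc_depth k m x < 1.
Proof.
move=> k0 km /andP[x0 xm]; rewrite /arc_depth.
have xm0 : 0 < x * (m - x) by rewrite mulr_gt0 // subr_gt0.
have xm1 : x * (m - x) < m ^+ 2 by nra.
rewrite mulr_gt0 //=; apply: lt_le_trans km; by rewrite ltr_pM2l.
Qed.

Lemma bsteps_end (a b : 'I_n) : vertex n (a + bsteps a b) = @vertex R n b.
Proof.
have := ltn_ord a; have := ltn_ord b => bn an.
suff [->|->] : (a + bsteps a b = b \/ a + bsteps a b = b + n)%N by [|rewrite vertexDn].
by rewrite /bsteps; case: (ltnP a b); lia.
Qed.

Lemma delta_clamp_continuous (X : topologicalType) (f : X -> R) (a b : 'I_n) :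
  continuous f -> continuous (fun x => delta a b (clamp (f x)) : plane).
Proof.
move=> fc; pose g x := a%:R + clamp (f x) * (bsteps a b)%:R.
have gc : continuous g by apply: (cont_comp (@delta_param_continuous _ _ a b) fc).
have rg x : 0 <= g x < (2 * n)%:R by apply: delta_range; rewrite ?clamp01.
exact: boundary_continuous gc rg.
Qed.

Lemma clamp_within (X : topologicalType) (U : topologicalType) (A : set X) (g : X -> X) (f : X -> U) :
  continuous (f \o g) -> (forall x, A x -> g x = x) -> {within A, continuous f}.
Proof.
move=> fg gA.
have E : {in A, (f \o g : subspace A -> U) =1 f}.
  by move=> x; rewrite inE /= => /gA ->.
by apply: (subspace_eq_continuous E); exact: continuous_subspaceT.
Qed.

(** The position on the boundary increases along the path and covers less than one
    full turn up to its ends, so the path is simple; letting the depth shrink to [0]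
    is the homotopy to the boundary path. *)
Lemma bulge_is_edge (k : R) (a b : 'I_n) :
  0 < k -> k * (bsteps a b)%:R ^+ 2 <= 1 -> (3 <= bcard a b)%N ->
  is_edge a b (bulge k a b).
Proof.
move=> k0 km ab3; set m := bsteps a b in km *.
have m0 : 0 < m%:R :> R by rewrite ltr0n /m; move: ab3; rewrite /bcard; lia.
have delta0 : delta a b 0 = @vertex R n a by rewrite /delta mul0r addr0 boundary_nat.
have delta1 : delta a b 1 = @vertex R n b.
  by rewrite /delta mul1r -natrD boundary_nat bsteps_end.
have depth01 (t : R) : 0 < t < 1 -> 0 < arc_depth k m%:R (t * m%:R) < 1.
  move=> /andP[t0 t1]; apply: arc_depth_bounds => //.
  by rewrite mulr_gt0 //= -{2}[m%:R]mul1r ltr_pM2r.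
have depth0 : arc_depth k m%:R (0 * m%:R) = 0 by rewrite /arc_depth; ring.
have depth1 : arc_depth k m%:R (1 * m%:R) = 0 by rewrite /arc_depth; ring.
have depth01c (t : R) : 0 <= t <= 1 -> 0 <= arc_depth k m%:R (t * m%:R) < 1.
  move=> /andP[t0 t1].
  have [->|t0'] := eqVneq t 0; first by rewrite depth0 lexx ltr01.
  have [->|t1'] := eqVneq t 1; first by rewrite depth1 lexx ltr01.
  have t01 : 0 < t < 1 by rewrite !lt_neqAle t0 t1 t1' eq_sym t0'.
  by have /andP[/ltW -> ->] := depth01 _ t01.
have x_ge0 (t : R) : 0 <= t <= 1 -> 0 <= a%:R + t * m%:R.
  by move=> t01; have /andP[] := delta_range a b t01.
pose F (p : plane) := (1 - (1 - p.1) * arc_depth k m%:R (p.2 * m%:R)) *: delta a b p.2.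
have Fc : continuous (fun p : plane => F (p.1, clamp p.2)).
  have idc : continuous (fun q : plane => q) by move=> q; exact: cvg_id.
  have cs : continuous (fun p : plane => clamp p.2 * m%:R).
    by apply: cont_mul; [apply: cont_comp continuous_clamp _; exact: (cont_snd idc)|exact: cont_cst].
  apply: cont_scale; last by apply: delta_clamp_continuous; exact: (cont_snd idc).
  apply: cont_sub; first exact: cont_cst.
  apply: cont_mul; first by apply: cont_sub; [exact: cont_cst|exact: (cont_fst idc)].
  apply: cont_mul; first exact: cont_cst.
  by apply: cont_mul => //; apply: cont_sub => //; exact: cont_cst.
have FE t : F (0, t) = bulge k a b t by rewrite /F /= subr0 mul1r.
split=> //.
- split.
  + apply: (@clamp_within _ _ _ clamp); last by move=> x; rewrite /= in_itv; exact: clamp_id.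
    have -> : bulge k a b \o clamp = (fun x => F (((0, x) : plane).1, clamp ((0, x) : plane).2)).
      by apply/funext => x; rewrite FE.
    apply: (cont_comp Fc); apply: cont_pair; first exact: cont_cst.
    by move=> x; exact: cvg_id.
  + by rewrite /bulge depth0 subr0 scale1r.
  + by rewrite /bulge depth1 subr0 scale1r.
- exists F; split.
  + apply: (@clamp_within _ _ _ (fun p => (p.1, clamp p.2))); first exact: Fc.
    by move=> [x y] [_] /=; rewrite in_itv /= => y01; rewrite clamp_id.
  + move=> _ [[x y] [/= + +] <-]; rewrite !in_itv /= => x01 y01.
    apply: (punctured_cone hn); first exact: x_ge0.
    by have := depth01c _ y01; rewrite /=; move: (arc_depth _ _ _) x01 => z; nra.
  + by move=> t _; rewrite FE; split=> //; rewrite /F /= subrr mul0r subr0 scale1r.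
  + move=> s _; rewrite /F /= depth0 depth1 !mulr0 !subr0 !scale1r.
    by rewrite /bulge depth0 depth1 !subr0 !scale1r.
- move=> t; rewrite inE /= in_itv /= => t01.
  apply: (punctured_interior_cone hn); first by apply: x_ge0; exact: oo_cc.
  by have := depth01 _ t01; lra.
- move=> t u; rewrite !inE /= !in_itv /= => t01 u01.
  have /andP[d1 d2] := depth01 _ t01; have /andP[d3 d4] := depth01 _ u01.
  wlog tu : t u t01 u01 d1 d2 d3 d4 / t <= u.
    move=> H; case: (leP t u) => tu E; first exact: H.
    by symmetry; apply: H => //; exact: ltW.
  have mn : m%:R <= n%:R :> R by rewrite ler_nat bsteps_le.
  have tum : (u - t) * m%:R < m%:R.
    by rewrite -{2}[m%:R]mul1r ltr_pM2r //; move: t01 u01 => /andP[? ?] /andP[? ?]; lra.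
  move=> E; have [|||||_ H] := cone_inj hn _ _ _ _ _ E.
  + by apply: x_ge0; exact: oo_cc.
  + by rewrite lerD2l ler_pM2r.
  + by rewrite -/m; have := ler0n R n; nra.
  + by rewrite subr_gt0.
  + by rewrite subr_gt0.
  have : (u - t) * m%:R < n%:R by apply: lt_le_trans mn.
  case: H; rewrite -/m => H; last by nra.
  by move=> _; apply: (mulIf (lt0r_neq0 m0)); lra.
Qed.

End UpperBound.

(** * Crossings of parabolic edges *)

Lemma card_le_seq (T : choiceType) (X : set T) (l : seq T) :
  (forall p, X p -> p \in l) -> exists2 j, X #= `I_j & (j <= size l)%N.
Proof.
move=> Xl; have [j Xj] : finite_set X.
  by apply: (sub_finite_set (B := [set` l])); [exact: Xl|exact: finite_seq].
exists j => //; rewrite -card_le_II.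
case: l Xl => [|x l] Xl.
  have X0 : X = set0 by apply/seteqP; split=> // p /Xl.
  by rewrite -(card_le_eql Xj) X0 card_ge0.
rewrite -(card_le_eql Xj).
apply: card_le_trans (card_image_le (nth x (x :: l)) _).
apply: subset_card_le => p /Xl pl; exists (index p (x :: l)); last exact: nth_index.
by rewrite /= -index_mem in pl *.
Qed.

Section ArcIntersections.
Context {R : realType}.
Local Notation plane := (R * R)%type.
Context {n : nat}.
Hypothesis hn : (3 <= n)%N.
Local Notation meet al be := (trace al `&` trace be `&` @punctured_interior R n).

Definition bulge_pt (k m : R) (a : 'I_n) (x : R) : plane :=
  (1 - arc_depth k m x) *: boundary n (a%:R + x).

Lemma bulge_trace (k : R) (a b : 'I_n) p :
  0 < k -> k * (bsteps a b)%:R ^+ 2 <= 1 -> (3 <= bcard a b)%N ->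
  trace (bulge k a b) p -> punctured_interior n p ->
  exists2 x : R, 0 < x < (bsteps a b)%:R & p = bulge_pt k (bsteps a b)%:R a x.
Proof.
move=> k0 km ab3 [t /= + <-] Kp; rewrite in_itv /= => t01.
exists (t * (bsteps a b)%:R) => //.
have m0 : 0 < (bsteps a b)%:R :> R by rewrite ltr0n; move: ab3; rewrite /bcard; lia.
have ed := bulge_is_edge hn k0 km ab3.
have [[_ e0 e1] _ _ _ _] := ed.
have := punctured_interior_lt1 Kp; have [t0 t1] := andP t01.
have [->|t0'] := eqVneq t 0; first by rewrite e0 dotp_vertex ltxx.
have [->|t1'] := eqVneq t 1; first by rewrite e1 dotp_vertex ltxx.
have {t0 t0'} t0 : 0 < t by rewrite lt_neqAle t0 eq_sym t0'.
have {t1 t1'} t1 : t < 1 by rewrite lt_neqAle t1 t1'.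
by move=> _; rewrite mulr_gt0 //= -{2}[(bsteps a b)%:R]mul1r ltr_pM2r.
Qed.

Lemma boundary_vertex_offset (a c : 'I_n) (y : R) : 0 <= y ->
  boundary n (c%:R + y) = boundary n ((a + vertex_offset a c)%:R + y).
Proof.
move=> y0; case: (vertex_offsetP a c) => -> //.
by rewrite natrD addrAC boundaryD // addr_ge0.
Qed.

(** Two arcs over [(0, m)] and [(r, r + s)] can only meet at the same position of the
    universal cover, or at positions that differ by one full turn. *)
Lemma bulge_pt_eq (k l : R) (m s : nat) (a c : 'I_n) (x y : R) :
  (m < n)%N -> (s < n)%N -> arc_depth k m%:R x < 1 -> arc_depth l s%:R y < 1 ->
  0 < x < m%:R -> 0 < y < s%:R ->
  bulge_pt k m%:R a x = bulge_pt l s%:R c y ->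
  arc_depth k m%:R x = arc_depth l s%:R y /\
  (x = (vertex_offset a c)%:R + y \/ x + n%:R = (vertex_offset a c)%:R + y).
Proof.
move=> mn sn kx ly /andP[x0 xm] /andP[y0 ys].
rewrite /bulge_pt (boundary_vertex_offset a c (ltW y0)) => E.
have rn := vertex_offset_lt a c; set r := vertex_offset a c in E rn *.
have R1 : m%:R + 1 <= n%:R :> R by rewrite natr1 ler_nat.
have R2 : s%:R + 1 <= n%:R :> R by rewrite natr1 ler_nat.
have R3 : r%:R + 1 <= n%:R :> R by rewrite natr1 ler_nat.
have a0 := ler0n R a; have r0 := ler0n R r; rewrite natrD in E.
have k1 : 0 < 1 - arc_depth k m%:R x by rewrite subr_gt0.
have l1 : 0 < 1 - arc_depth l s%:R y by rewrite subr_gt0.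
have [xy|xy] := leP x (r%:R + y).
  by have [|||e H] := cone_inj hn _ _ _ k1 l1 E; lra.
by have [|||e H] := cone_inj hn _ _ _ l1 k1 (esym E); lra.
Qed.

(** Both sides are quadratic with the same leading coefficient, so that the equation
    is linear in [x]; for nested intervals the inner parabola lies strictly above the
    outer one. *)
Lemma arc_depth_meet_same (k m s r x y : R) : 0 < k -> 0 < x < m -> 0 < y < s -> 0 <= r ->
  x = r + y -> arc_depth k m x = arc_depth k s y -> (r = 0 -> s <> m) ->
  [/\ 0 < r, r < m, m < r + s & x = r * (r + s) / (2 * r + s - m)].
Proof.
move=> k0 /andP[x0 xm] /andP[y0 ys] r0 xE /(mulfI (lt0r_neq0 k0)) E rs.
have lin : x * (2 * r + s - m) = r * (r + s).
  have yE : y = x - r by lra.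
  by move: E; rewrite yE => E; nra.
have {}r0 : 0 < r.
  rewrite lt_neqAle r0 andbT; apply/eqP => r0'; rewrite -r0' in lin rs.
  have : x * (s - m) = 0 by nra.
  by move/eqP; rewrite mulf_eq0 (gt_eqF x0) /= subr_eq0 => /eqP; apply: rs.
have mrs : m < r + s.
  rewrite ltNge; apply/negP => H; subst x.
  have : (r + y) * (s - y) <= (r + y) * (m - (r + y)) by rewrite ler_pM2l //; lra.
  by rewrite E; nra.
split=> //; first by lra.
by rewrite -lin mulfK // gt_eqF //; lra.
Qed.

(** The same computation for the translate by one full turn. *)
Lemma arc_depth_meet_turn (k m s r x y t : R) : 0 < k -> 0 < x < m -> 0 < y < s -> r < t ->
  x + t = r + y -> arc_depth k m x = arc_depth k s y ->
  [/\ t < r + s, r + s < t + m &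
      x = (t - r) * (s - (t - r)) / (m - s + 2 * (t - r))].
Proof.
move=> k0 /andP[x0 xm] /andP[y0 ys] r0 xE /(mulfI (lt0r_neq0 k0)) E.
have yE : y = x + (t - r) by lra.
have q0 : 0 < t - r by lra.
move: (t - r) q0 yE (erefl : t - r = t - r) => q q0 yE qE; subst y.
have lin : x * (m - s + 2 * q) = q * (s - q) by nra.
have H : s - q < m.
  rewrite ltNge; apply/negP => H.
  have : (x + q) * (m - x) <= (x + q) * (s - (x + q)) by rewrite ler_pM2l //; lra.
  by rewrite -E; nra.
split; [lra|lra|].
by rewrite -lin mulfK // gt_eqF //; lra.
Qed.

Lemma spoke_trace (a : 'I_n) (p : plane) : trace (spoke a) p -> punctured_interior n p ->
  exists2 v : R, 0 < v & p = v *: vertex n a.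
Proof.
move=> [t /= + <-] /interior_subset [_ p0]; rewrite in_itv /= => /andP[_ t1].
exists (1 - t) => //; rewrite subr_gt0 lt_neqAle t1 andbT; apply/eqP => t1'.
by apply: p0; rewrite /spoke t1' subrr scale0r.
Qed.

(** All edges are taken parabolic with the same leading coefficient, except that a
    tagged edge is compared with a shallower copy of itself, which does not meet it.
    Then each translate contributes at most one point, and only if it interleaves. *)
Lemma meet_upper (M N : tedge n) : ~~ (is_loop M && is_loop N) ->
  exists al be, [/\ @arcs R n M al, arcs N be &
    exists2 j, meet al be #= `I_j & (j <= crossing_count M N)%N].
Proof.
have nn0 : 0 < n%:R :> R by rewrite ltr0n; lia.
have Lb (L : tedge n) : (3 <= bcard (src L) (tgt L))%N by case/andP: (tedgeP L).
have Lm (L : tedge n) : ~~ is_loop L -> (bsteps (src L) (tgt L) < n)%N.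
  rewrite /is_loop => ab; have := ltn_ord (src L); have := ltn_ord (tgt L).
  rewrite /bsteps; case: (ltngtP (src L) (tgt L)) ab => [||/val_inj ->]; first lia.
    lia.
  by rewrite eqxx.
pose k0 : R := n%:R ^- 2.
have k00 : 0 < k0 by rewrite invr_gt0 exprn_gt0.
have ks k s : 0 < k <= k0 -> (s < n)%N -> k * s%:R ^+ 2 <= 1 :> R.
  move=> /andP[kp kk] sn; apply: le_trans (_ : k0 * n%:R ^+ 2 <= 1); last first.
    by rewrite mulVf // gt_eqF // exprn_gt0.
  apply: ler_pM => //; first exact: ltW.
  by rewrite ler_pXn2r ?nnegrE ?ler0n // ler_nat ltnW.
rewrite /crossing_count /arcs.
have := Lm M; have := Lm N; have := Lb M; have := Lb N; have := vertex_offset_lt (src M) (src N).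
set a := src M; set b := tgt M; set c := src N; set d := tgt N.
set m := bsteps a b; set s := bsteps c d; set r := vertex_offset a c.
move=> rn cd3 ab3 sn mn.
have kk0 : 0 < k0 <= k0 by rewrite k00 lexx.
have arc_depth_lt1 k t x : 0 < k <= k0 -> (t < n)%N -> 0 < x < t%:R -> arc_depth k t%:R x < 1 :> R.
  move=> kk tn xt; have /andP[kp _] := kk.
  by have /andP[] := arc_depth_bounds kp (ks _ _ kk tn) xt.
case: (boolP (is_loop M)) => [Ml|Ml]; case: (boolP (is_loop N)) => [Nl|Nl] //= _.
- exists (spoke a), (bulge k0 c d); split=> //.
    by apply: bulge_is_edge => //; apply: ks => //; exact: sn.
  pose P := bulge_pt k0 s%:R c (n%:R - r%:R).
  have [|j Xj jl] := @card_le_seq _ (meet (spoke a) (bulge k0 c d)) (nseq (n < r + s)%N P).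
    move=> p [[pa pb] Kp]; have [v v0 pv] := spoke_trace pa Kp.
    have [y ys pE] := bulge_trace k00 (ks _ _ kk0 (sn Nl)) cd3 pb Kp.
    have l1 : 0 < 1 - arc_depth k0 s%:R y by rewrite subr_gt0 arc_depth_lt1 // sn.
    have [y0 ys'] := andP ys; have S := sn Nl.
    have S1 : s%:R + 1 <= n%:R :> R by rewrite natr1 ler_nat.
    have R1 : r%:R + 1 <= n%:R :> R by rewrite natr1 ler_nat.
    have a0 := ler0n R a; have r0 := ler0n R r.
    have E : v *: boundary n a%:R = (1 - arc_depth k0 s%:R y) *: boundary n (a%:R + r%:R + y).
      by rewrite boundary_nat -pv pE /bulge_pt (boundary_vertex_offset a c (ltW y0)) natrD.
    have [|||_ H] := cone_inj hn _ _ _ v0 l1 E; try lra.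
    have yE : y = n%:R - r%:R by case: H; lra.
    have -> : (n < r + s)%N by rewrite -(ltr_nat R) natrD; lra.
    by rewrite inE /P -yE pE.
  by exists j => //; rewrite size_nseq in jl.
- exists (bulge k0 a b), (spoke c); split=> //.
    by apply: bulge_is_edge => //; apply: ks => //; exact: mn.
  pose P := bulge_pt k0 m%:R a r%:R.
  have [|j Xj jl] := @card_le_seq _ (meet (bulge k0 a b) (spoke c)) (nseq (0 < r < m)%N P).
    move=> p [[pa pb] Kp]; have [v v0 pv] := spoke_trace pb Kp.
    have [x xm pE] := bulge_trace k00 (ks _ _ kk0 (mn Ml)) ab3 pa Kp.
    have l1 : 0 < 1 - arc_depth k0 m%:R x by rewrite subr_gt0 arc_depth_lt1 // mn.
    have [x0 xm'] := andP xm; have S := mn Ml.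
    have S1 : m%:R + 1 <= n%:R :> R by rewrite natr1 ler_nat.
    have R1 : r%:R + 1 <= n%:R :> R by rewrite natr1 ler_nat.
    have a0 := ler0n R a; have r0 := ler0n R r.
    have E : v *: boundary n (a%:R + r%:R) = (1 - arc_depth k0 m%:R x) *: boundary n (a%:R + x).
      have := boundary_vertex_offset a c (lexx (0 : R)); rewrite !addr0 boundary_nat natrD => <-.
      by rewrite -pv pE.
    have xE : x = r%:R.
      have [xr|xr] := leP x r%:R.
        by have [|||_ H] := cone_inj hn _ _ _ l1 v0 (esym E); lra.
      by have [|||_ H] := cone_inj hn _ _ _ v0 l1 E; lra.
    have -> : (0 < r < m)%N by rewrite -!(ltr_nat R) -xE x0.
    by rewrite inE /P -xE pE.
  by exists j => //; rewrite size_nseq in jl.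
- pose k1 := if (r == 0%N) && (s == m) then k0 / 2 else k0.
  have kk1 : 0 < k1 <= k0 by rewrite /k1; case: ifP => _; lra.
  have [k10 _] := andP kk1.
  have S := sn Nl; have T := mn Ml.
  exists (bulge k0 a b), (bulge k1 c d); split.
  + by apply: bulge_is_edge => //; apply: ks.
  + by apply: bulge_is_edge => //; apply: ks.
  pose P1 := bulge_pt k0 m%:R a (r%:R * (r%:R + s%:R) / (2 * r%:R + s%:R - m%:R)).
  pose P2 := bulge_pt k0 m%:R a
    ((n%:R - r%:R) * (s%:R - (n%:R - r%:R)) / (m%:R - s%:R + 2 * (n%:R - r%:R))).
  have [|j Xj jl] := @card_le_seq _ (meet (bulge k0 a b) (bulge k1 c d))
    (nseq [&& 0 < r, r < m & m < r + s]%N P1 ++ nseq (n < r + s < n + m)%N P2).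
    move=> p [[pa pb] Kp].
    have [x xm pE] := bulge_trace k00 (ks _ _ kk0 T) ab3 pa Kp.
    have [y ys pE'] := bulge_trace k10 (ks _ _ kk1 S) cd3 pb Kp.
    have E := pE'; rewrite pE in E.
    have [e H] := bulge_pt_eq T S (arc_depth_lt1 _ _ _ kk0 T xm) (arc_depth_lt1 _ _ _ kk1 S ys) xm ys E.
    rewrite -/r in H; have r0 := ler0n R r.
    have R1 : r%:R < n%:R :> R by rewrite ltr_nat.
    move: e; rewrite /k1; case: ifP => [/andP[/eqP r_0 /eqP s_m]|rs] e.
      (* the two arcs are one edge: the shallower one lies strictly outside *)
      have S1 : s%:R + 1 <= n%:R :> R by rewrite natr1 ler_nat.
      move: H; rewrite r_0 add0r => -[xy|]; last by lra.
      move: e; rewrite /arc_depth -xy s_m; have [x0 xm'] := andP xm.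
      have : 0 < x * (m%:R - x) by rewrite mulr_gt0 ?subr_gt0.
      by nra.
    case: H => H.
      have [|A1 A2 A3 A4] := arc_depth_meet_same k00 xm ys r0 H e.
        move=> r_0 s_m; move/negP: rs; apply.
        by rewrite -(eqr_nat R) r_0 eqxx -(eqr_nat R) s_m eqxx.
      have -> : [&& 0 < r, r < m & m < r + s]%N.
        by rewrite -!(ltr_nat R) natrD A1 A2 A3.
      by rewrite mem_cat inE /P1 -A4 pE eqxx.
    have [A1 A2 A3] := arc_depth_meet_turn k00 xm ys R1 H e.
    have -> : (n < r + s < n + m)%N.
      by rewrite -!(ltr_nat R) !natrD A1 A2.
    by rewrite mem_cat [in X in _ || X]inE /P2 -A3 pE eqxx orbT.
  by exists j => //; rewrite size_cat !size_nseq in jl.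
Qed.

End ArcIntersections.

(** * The crossing number *)

Lemma crossing_numberP (R : realType) n (M N : tedge n) :
  (3 <= n)%N -> is_crossing_number R M N (crossing_count M N).
Proof.
move=> hn; rewrite /is_crossing_number.
case: ifPn => [/andP[Ml Nl]|MN]; first by rewrite /crossing_count Ml Nl.
split; last first.
  by move=> _ j [al Mal [be Nbe <-]]; exact: meet_lower.
have [al [be [Mal Nbe [j Xj jm]]]] := meet_upper (R := R) hn MN.
exists (trace al `&` trace be `&` @punctured_interior R n).
  by exists al => //; exists be.
suff -> : crossing_count M N = j by [].
by apply/eqP; rewrite eqn_leq jm (meet_lower hn MN Mal Nbe Xj).
Qed.

(** * The predicted morphism spaces and their meshes *)

(** The punctured polygon is the quotient of a polygon with [2 * n] vertices by the
    central symmetry, and an edge of it that is not a loop corresponds to two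
    diagonals that are exchanged by the symmetry. In the larger polygon the morphisms
    out of a diagonal form a rectangle, the hammock, each of whose objects receives a
    line. Hence the morphisms out of [M] to an edge get one summand if the first
    diagonal lies in the hammock, and one if the second does. A loop corresponds to a
    diameter, which is fixed by the symmetry, and its two signs stand for the two
    eigenspaces. To have one description in all characteristics, the coordinates of
    [k ^ 2] record the contributions of paths through loops of sign [1] and [-1]:
    [RegDiag] is where only the first summand is present (the diagonal of [k ^ 2]),
    [RegQuot] where only the second is (the quotient by the diagonal, represented on
    the first axis), [RegAll] where both are, and [RegLoop] is the region of loops. *)
Inductive region := RegZero | RegDiag | RegAll | RegQuot | RegLoop.

Section Regions.
Context (k : fieldType).
Local Notation V := (k^o * k^o)%type.

(* [m] is the number of sides of the starting tagged edge *)
Context (n m : nat).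

(** In the universal cover of the quiver of elementary moves, the position of a tagged
    edge is given by the grade [i], the number of moves that have advanced the source
    since leaving [M], and by its number [s] of sides. *)
Definition hammock (i : int) (s : nat) : bool :=
  [&& 0 <= i, i + 2 <= m%:Z & m%:Z <= i + s%:Z].
Definition mirror_hammock (i : int) (s : nat) : bool :=
  [&& n%:Z <= i + s%:Z, i + s%:Z + 2 <= m%:Z + n%:Z & i + 2 <= n%:Z].

Definition region_at (i : int) (s : nat) : region :=
  if s == n then if (0 <= i) && (i + 2 <= m%:Z) then RegLoop else RegZero
  else if hammock i s then if mirror_hammock i s then RegAll else RegDiag
  else if mirror_hammock i s then RegQuot else RegZero.

(** The action of an elementary move depends, up to sign, only on the region in which
    the move arrives. *)
Definition push (r : region) (e : bool) (w : V) : V :=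
  match r with
  | RegZero => (0, 0)
  | RegDiag | RegAll => w
  | RegQuot => (w.1 - w.2, 0)
  | RegLoop => if e then (w.1, 0) else (0, w.2)
  end.

Definition in_region (r : region) (e : bool) (w : V) : Prop :=
  match r with
  | RegZero => w.1 = 0 /\ w.2 = 0
  | RegDiag => w.1 = w.2
  | RegAll => True
  | RegQuot => w.2 = 0
  | RegLoop => if e then w.2 = 0 else w.1 = 0
  end.

Context (ms : bool).
(** Paths that start at a loop of sign [ms] only reach one of the two axes. *)
Definition on_axis (w : V) : Prop :=
  if m == n then if ms then w.2 = 0 else w.1 = 0 else True.

Definition in_space (i : int) (s : nat) (e : bool) (w : V) : Prop :=
  in_region (region_at i s) e w /\ on_axis w.

Hypothesis n3 : (3 <= n)%N.
Hypothesis m2 : (2 <= m <= n)%N.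

Lemma push_linear r e c (w w' : V) : push r e (c *: w + w') = c *: push r e w + push r e w'.
Proof.
case: w w' => [a b] [a' b']; case: r; case: e => //=; congr pair => /=;
  by rewrite ?scaler0 ?addr0 // scalerBr opprD addrACA.
Qed.

(** Most combinations of regions cannot occur at neighbouring positions, and [lia]
    discards them as soon as they appear; the few that remain are settled by [vfin]. *)
Ltac dcase b := let H := fresh "h" in
  case: (boolP b) => H; rewrite ?/hammock ?/mirror_hammock in H; try (exfalso; lia).

Lemma region_at_lt (i : int) s : (s < n)%N ->
  region_at i s = if hammock i s then if mirror_hammock i s then RegAll else RegDiag else if mirror_hammock i s then RegQuot else RegZero.
Proof. by move=> sn; rewrite /region_at ltn_eqF. Qed.

Lemma region_at_loop (i : int) : region_at i n = if (0 <= i) && (i + 2 <= m%:Z) then RegLoop else RegZero.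
Proof. by rewrite /region_at eqxx. Qed.

Ltac dreg i s := rewrite ?(@region_at_lt i s); [|lia..]; dcase (hammock i s); dcase (mirror_hammock i s).
Ltac dregn i := rewrite (region_at_loop i); dcase ((0 <= i) && (i + 2 <= m%:Z)).

Lemma pairD (a b c d : k^o) : (a, b) + (c, d) = (a + c, b + d) :> V.
Proof. by []. Qed.

Ltac vstart := unfold in_space, on_axis; case: (eqVneq m n) => mn; case: ms.

Ltac vintro := repeat (match goal with
    | |- _ /\ _ -> _ => case
    | |- True -> _ => move=> _
    | |- (_, _) = (_, _) -> _ => case
    | |- (_ = _) -> _ => let H := fresh "e" in move=> H; try subst
    | |- _ -> _ => let H := fresh "x" in move=> H
    end).

Ltac vhyps := repeat match goal with
    | e : _ - 0 = _ |- _ => rewrite subr0 in e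
    | e : _ = _ - 0 |- _ => rewrite subr0 in e
    | e : _ + 0 = _ |- _ => rewrite addr0 in e
    | e : 0 + _ = _ |- _ => rewrite add0r in e
    | e : _ - _ = 0 |- _ => move/subr0_eq: e => e
    | e : 0 = _ - _ |- _ => move/esym/subr0_eq: e => e
    end; try subst.

Ltac vfin := rewrite /= ?pairD; vintro; vhyps;
  rewrite ?pairD ?addr0 ?add0r ?subrr ?subr0 ?sub0r ?opprK ?oppr0 //; try by [repeat split|lia].

(** This lemma and the next two are the mesh relations, with signs left out, for an
    edge that is neither a loop nor a target of moves from loops, for an edge that is
    the target of moves from two loops, and for a loop. *)
Lemma mesh_mid (i : int) s w : (2 <= s)%N -> (s + 2 <= n)%N -> in_space (i - 1) s true w ->
  push (region_at i s) true (push (region_at (i - 1) s.+1) true w) =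
  push (region_at i s) true (push (region_at i s.-1) true w).
Proof.
move=> s2 sn []; case: w => a b + _.
dreg (i - 1) s; dreg i s; dreg (i - 1) s.+1; dreg i s.-1.
all: vfin.
Qed.

Lemma mesh_fork (i : int) s w : s.+1 = n -> in_space (i - 1) s true w ->
  push (region_at i s) true (push (region_at (i - 1) n) true w + push (region_at (i - 1) n) false w) =
  push (region_at i s) true (push (region_at i s.-1) true w).
Proof.
move=> sn []; case: w => a b + _.
dreg (i - 1) s; dreg i s; dregn (i - 1); dreg i s.-1.
all: vfin.
Qed.

Lemma mesh_end (i : int) e w : in_space (i - 1) n (~~ e) w ->
  push (region_at i n) e (push (region_at i n.-1) true w) = 0.
Proof.
move=> []; case: w => a b + _; case: e.
all: dregn (i - 1); dregn i; dreg i n.-1.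
all: vfin.
Qed.

Lemma step_source (i : int) s e e' w : (2 <= s < n)%N -> in_space (i - 1) s.+1 e w ->
  in_space i s e' (push (region_at i s) e' w).
Proof.
move=> /andP[s2 sn]; case: w => a b.
have [sn'|sn'] : s.+1 = n \/ (s.+1 < n)%N by lia.
{ rewrite sn'; vstart; dregn (i - 1); dreg i s; case: e.
  all: vfin. }
vstart; dreg (i - 1) s.+1; dreg i s.
  all: vfin.
Qed.

Lemma step_target (i : int) s e e' w : (2 < s <= n)%N -> in_space i s.-1 e w ->
  in_space i s e' (push (region_at i s) e' w).
Proof.
move=> /andP[s2 sn]; case: w => a b.
have [sn'|sn'] : s = n \/ (s < n)%N by lia.
{ rewrite sn'; vstart; dregn i; dreg i n.-1; case: e'.
  all: vfin. }
vstart; dreg i s; dreg i s.-1.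
  all: vfin.
Qed.

(** Exactness in the middle of the first kind of mesh; the next two lemmas treat the
    other kinds. Unless the space at [i - 1] is zero, one of its two maps to the
    predecessors is the identity, and the witness is read off there. *)
Lemma exact_mid (i : int) s u l : (2 <= s)%N -> (s + 2 <= n)%N ->
  in_space (i - 1) s.+1 true u -> in_space i s.-1 true l ->
  push (region_at i s) true u = push (region_at i s) true l ->
  exists w, [/\ in_space (i - 1) s true w, push (region_at (i - 1) s.+1) true w = u &
    push (region_at i s.-1) true w = l].
Proof.
move=> s2 sn uP lP ul.
exists (match region_at (i - 1) s with RegZero => (0, 0) | _ =>
          match region_at (i - 1) s.+1 with RegZero => l | _ => u end end).
case: u uP ul => a b; case: l lP => c d.
vstart; dreg (i - 1) s; dreg i s; dreg (i - 1) s.+1; dreg i s.-1.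
all: vfin.
Qed.

Lemma exact_fork (i : int) s u1 u2 l : s.+1 = n ->
  in_space (i - 1) n true u1 -> in_space (i - 1) n false u2 -> in_space i s.-1 true l ->
  push (region_at i s) true (u1 + u2) = push (region_at i s) true l ->
  exists w, [/\ in_space (i - 1) s true w, push (region_at (i - 1) n) true w = u1,
    push (region_at (i - 1) n) false w = u2 & push (region_at i s.-1) true w = l].
Proof.
move=> sn u1P u2P lP ul.
exists (match region_at (i - 1) s with RegZero => (0, 0) | RegQuot => l | _ => u1 + u2 end).
case: u1 u1P ul => a b; case: u2 u2P => a' b'; case: l lP => c d.
vstart; dreg (i - 1) s; dreg i s; dregn (i - 1); dreg i s.-1.
all: vfin.
Qed.

(** If [l] is in [RegQuot], the lift to the axis of sign [-1] has the opposite sign,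
    as the quotient by the diagonal identifies [(0, - c)] with [(c, 0)]. *)
Lemma exact_end (i : int) e l : in_space i n.-1 true l -> push (region_at i n) e l = (0, 0) ->
  exists w, in_space (i - 1) n (~~ e) w /\ push (region_at i n.-1) true w = l.
Proof.
move=> lP l0.
exists (match region_at i n.-1 with RegZero | RegDiag => (0, 0) | RegQuot => if e then (0, - l.1) else l
          | _ => l end).
case: l lP l0 => c d; case: e.
all: vstart; dregn (i - 1); dregn i; dreg i n.-1.
all: vfin.
Qed.

(** Again there is one statement for each kind of mesh. The alternative [i = 0] is the
    start of all paths, which has no predecessor that counts. *)
Lemma onto_mid (i : int) s w : (2 <= s)%N -> (s + 2 <= n)%N -> in_space i s true w ->
  [\/ w = (0, 0), i = 0 /\ s = m,
      in_space (i - 1) s.+1 true w /\ push (region_at i s) true w = w |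
      [/\ (3 <= s)%N, in_space i s.-1 true w & push (region_at i s) true w = w]].
Proof.
move=> s2 sn; case: w => a b; have [i0|i0] := eqVneq i 0;
  have [sm|sm] := eqVneq s m.
all: vstart; dreg i s; dreg (i - 1) s.+1; dreg i s.-1; rewrite /=; vintro.
all: first [by apply: Or41|by apply: Or42|
  by apply: Or43; rewrite ?subr0|by apply: Or44; rewrite ?subr0; split=> //; lia].
Qed.

Lemma onto_fork (i : int) s w : s.+1 = n -> in_space i s true w ->
  [\/ w = (0, 0), i = 0 /\ s = m,
      exists u1 u2, [/\ in_space (i - 1) n true u1, in_space (i - 1) n false u2 &
        push (region_at i s) true u1 + push (region_at i s) true u2 = w] |
      [/\ (3 <= s)%N, in_space i s.-1 true w & push (region_at i s) true w = w]].
Proof.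
move=> sn; case: w => a b; have [i0|i0] := eqVneq i 0;
  have [sm|sm] := eqVneq s m.
all: vstart; dreg i s; dregn (i - 1); dreg i s.-1; rewrite /=; vintro.
all: first [by apply: Or41|by apply: Or42|
  by apply: Or43; exists (a, 0), (0, b); rewrite !pairD ?subr0 !addr0 ?add0r|
  by apply: Or43; exists (a, 0), (0, 0); rewrite !pairD ?subr0 !addr0 ?add0r|
  by apply: Or43; exists (0, 0), (0, b); rewrite !pairD ?subr0 !addr0 ?add0r|
  by apply: Or44; rewrite ?subr0; split=> //; lia].
Qed.

Lemma onto_end (i : int) e w : in_space i n e w ->
  [\/ w = (0, 0), [/\ i = 0, n = m & e = ms] |
    exists l, in_space i n.-1 true l /\ push (region_at i n) e l = w].
Proof.
case: w => a b; have [i0|i0] := eqVneq i 0; have [sm|sm] := eqVneq n m; case: e.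
all: vstart; dregn i; dreg i n.-1; rewrite /=; vintro.
all: first [by apply: Or31|by apply: Or32|
  by apply: Or33; exists (a, b)|by apply: Or33; exists (a, a)|by apply: Or33; exists (b, b)|
  by apply: Or33; exists (a, 0)|by apply: Or33; exists (0, b)].
Qed.
End Regions.

(** * Positions of tagged edges and elementary moves *)

Section TaggedEdges.
Context {n : nat}.
Implicit Types X Y Z : tedge n.

Definition steps X : nat := bsteps (src X) (tgt X).

Lemma bsteps_inj (a b c : 'I_n) : bsteps a b = bsteps a c -> b = c.
Proof.
have := ltn_ord a; have := ltn_ord b; have := ltn_ord c => cn bn an.
rewrite /bsteps; case: (ltnP a b) => ab; case: (ltnP a c) => ac E; apply: val_inj => /=; lia.
Qed.

Lemma bsteps_eqn (a b : 'I_n) : (bsteps a b == n) = (a == b).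
Proof.
have := ltn_ord a; have := ltn_ord b => bn an.
rewrite -val_eqE /= /bsteps; case: (ltnP a b) => ab; lia.
Qed.

Lemma bsteps_range (a b : 'I_n) : (0 < bsteps a b <= n)%N.
Proof.
have := ltn_ord a; have := ltn_ord b => bn an.
rewrite /bsteps; case: (ltnP a b) => ab; lia.
Qed.

Lemma bsteps_onto (a : 'I_n) s : (0 < s <= n)%N -> exists b, bsteps a b = s.
Proof.
move=> /andP[s0 sn]; have := ltn_ord a => an.
have [H|H] := ltnP (a + s) n.
  by exists (Ordinal H); rewrite /bsteps /=; case: ltnP; lia.
have H' : (a + s - n < n)%N by lia.
by exists (Ordinal H'); rewrite /bsteps /=; case: ltnP; lia.
Qed.

Lemma steps_range X : (2 <= steps X <= n)%N.
Proof.
have /andP[+ _] := tedgeP X; rewrite -/(src X) -/(tgt X) /bcard ltnS => ->.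
by case/andP: (bsteps_range (src X) (tgt X)).
Qed.

Lemma is_loopE X : is_loop X = (steps X == n).
Proof. by rewrite /steps bsteps_eqn. Qed.

Lemma tag_sign_lt X : (steps X < n)%N -> tag_sign X.
Proof.
move=> Xn; have /andP[_] := tedgeP X; rewrite -/(src X) -/(tgt X).
by rewrite -bsteps_eqn ltn_eqF.
Qed.

Lemma tedge_eqP X Y :
  src X = src Y -> steps X = steps Y -> tag_sign X = tag_sign Y -> X = Y.
Proof.
rewrite /steps => sXY; rewrite sXY => /bsteps_inj tXY eXY; apply: val_inj => /=.
rewrite [LHS]surjective_pairing [X in (X, _)]surjective_pairing.
rewrite [RHS]surjective_pairing [X in _ = (X, _)]surjective_pairing.
by congr (_, _, _).
Qed.

Lemma tedge_ex (a : 'I_n) s e : (2 <= s <= n)%N -> (s < n)%N ==> e ->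
  exists X, [/\ src X = a, steps X = s & tag_sign X = e].
Proof.
move=> /andP[s2 sn] se; have [|b bE] := @bsteps_onto a s; first by lia.
have ok : is_tedge (a, b, e).
  rewrite /is_tedge /= /bcard bE ltnS s2 /= -bsteps_eqn bE.
  by move: se; rewrite ltn_neqAle sn andbT.
by exists (TEdge ok).
Qed.

(** This relation and the next one compare numbers of sides rather than targets, so
    that positions of tagged edges can be computed with. *)
Definition source_move Y X := (src X == ordS (src Y)) && (steps Y == (steps X).+1).

Definition target_move Y X := (src X == src Y) && (steps X == (steps Y).+1).

Lemma target_source_moveF Y X : target_move Y X -> source_move Y X = false.
Proof. by rewrite /source_move => /andP[_ /eqP ->]; apply/negP => /andP[_ /eqP]; lia. Qed.

Lemma source_target_moveF Y X : source_move Y X -> target_move Y X = false.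
Proof. by move=> H; apply/negP => /target_source_moveF; rewrite H. Qed.

Lemma val_ordS (a : 'I_n) : ordS a = (if a.+1 == n then 0 else a.+1)%N :> nat.
Proof.
rewrite /=; case: eqP => [->|an]; first by rewrite modnn.
by rewrite modn_small //; have := ltn_ord a; lia.
Qed.

Hypothesis hn : (3 <= n)%N.

Lemma source_moveE Y X : source_move Y X = ((src X, tgt X) == (ordS (src Y), tgt Y)).
Proof.
rewrite /source_move xpair_eqE; case: eqVneq => //= sX.
have /andP[X2 Xn] := steps_range X; have /andP[Y2 Yn] := steps_range Y.
have := @bcardSl n (src Y) (tgt Y); rewrite /bcard !ltnS -/(steps Y) => /(_ Y2) /= E.
apply/eqP/eqP => [H|H].
  apply: (@bsteps_inj (ordS (src Y))); apply: succn_inj.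
  by rewrite E -sX H.
by rewrite -E -sX -H.
Qed.

Lemma target_moveE Y X : target_move Y X = ((src X, tgt X) == (src Y, ordS (tgt Y))).
Proof.
rewrite /target_move xpair_eqE; case: eqVneq => //= sX.
have /andP[X2 Xn] := steps_range X; have /andP[Y2 Yn] := steps_range Y.
have E : bsteps (src Y) (ordS (tgt Y)) =
    (if steps Y == n then 1 else (steps Y).+1)%N.
  have := ltn_ord (src Y); have := ltn_ord (tgt Y).
  rewrite /steps /bsteps val_ordS => bn an.
  by do 4! case: ifP; lia.
apply/eqP/eqP => [H|H].
  apply: (@bsteps_inj (src Y)); rewrite E -sX -/(steps X) H.
  by case: eqP => //; lia.
have : steps X = bsteps (src Y) (ordS (tgt Y)) by rewrite /steps sX H.
by rewrite E; case: eqP => //; lia.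
Qed.

Lemma emoveE Y X : emove Y X = source_move Y X || target_move Y X.
Proof.
rewrite source_moveE target_moveE /emove /bcard -/(steps Y).
have /andP[X2 Xn] := steps_range X; have /andP[Y2 Yn] := steps_range Y.
have sE : ((src X, tgt X) == (ordS (src Y), tgt Y)) -> steps Y = (steps X).+1.
  by rewrite -source_moveE => /andP[_ /eqP].
have tE : ((src X, tgt X) == (src Y, ordS (tgt Y))) -> steps X = (steps Y).+1.
  by rewrite -target_moveE => /andP[_ /eqP].
have tE' : (steps Y).+1 = n -> ordS (tgt Y) = src Y.
  by move=> H; rewrite -(@bcard_eqn n (src Y) (tgt Y)) ?ord_predK // /bcard -/(steps Y).
have lE : (src Y == tgt Y) = (steps Y == n) by rewrite -bsteps_eqn.
rewrite lE.
move: sE tE; case S: (_ == (ordS (src Y), tgt Y)); case T: (_ == (src Y, ordS (tgt Y)));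
  move=> sE tE; try (have {}sE := sE isT); try (have {}tE := tE isT); rewrite /=.
- lia.
- have [Yn'|Yn'] := eqVneq (steps Y) n.
    have Yl : src Y = tgt Y by apply/eqP; rewrite lE Yn'.
    by rewrite Yl in S *; rewrite S !orbT.
  lia.
- have [Yn'|Yn'] := eqVneq (steps Y).+1 n.
    by rewrite (tE' Yn') in T *; rewrite ?Yn' ?eqxx T !orbT.
  lia.
- have [Yn'|Yn'] := eqVneq (steps Y) n.
    have Yl : src Y = tgt Y by apply/eqP; rewrite lE Yn'.
    by move: S; rewrite Yl => ->; rewrite !andbF; lia.
  have [Yn''|Yn''] := eqVneq (steps Y).+1 n.
    by move: T; rewrite (tE' Yn'') => ->; rewrite !andbF.
  by rewrite !andbF.
Qed.

End TaggedEdges.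

Section Preds.
Context {n : nat}.
Implicit Types X Y Z : tedge n.

Lemma src_pred X Y : src X = ordS (src Y) -> src Y = ord_pred (src X).
Proof. by move=> ->; rewrite ordSK. Qed.

Lemma source_moveI Y X : src Y = ord_pred (src X) -> steps Y = (steps X).+1 -> source_move Y X.
Proof. by rewrite /source_move => -> ->; rewrite ord_predK !eqxx. Qed.

Lemma source_preds_mid X : (steps X + 2 <= n)%N ->
  exists U, [/\ tag_sign U, steps U = (steps X).+1 & forall Y, source_move Y X = (Y == U)].
Proof.
have /andP[X2 _] := steps_range X => Xn.
have [||U [sU stU eU]] := @tedge_ex n (ord_pred (src X)) (steps X).+1 true; rewrite ?implybT //.
  by apply/andP; lia.
exists U; split=> // Y; apply/idP/eqP => [/andP[/eqP sY /eqP stY]|->].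
  apply: tedge_eqP; rewrite ?sU ?stU //; first exact: src_pred.
  by rewrite !tag_sign_lt //; lia.
by apply: source_moveI; rewrite ?sU ?stU.
Qed.

Lemma source_preds_fork X : (steps X).+1 = n ->
  exists U1 U2, [/\ tag_sign U1, ~~ tag_sign U2, steps U1 = n, steps U2 = n &
    forall Y, source_move Y X = (Y == U1) || (Y == U2)].
Proof.
have /andP[X2 _] := steps_range X => Xn.
have ex e : exists U, [/\ src U = ord_pred (src X), steps U = n & tag_sign U = e].
  by apply: tedge_ex; rewrite ?ltnn //; lia.
have [U1 [sU1 stU1 eU1]] := ex true; have [U2 [sU2 stU2 eU2]] := ex false.
exists U1, U2; split=> //; rewrite ?eU2 // => Y.
apply/idP/orP => [/andP[/eqP sY /eqP stY]|[/eqP->|/eqP->]].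
- by case eY: (tag_sign Y); [left|right]; apply/eqP/tedge_eqP;
    rewrite ?sU1 ?sU2 ?stU1 ?stU2 ?eU1 ?eU2 ?stY // ?(src_pred sY).
- by apply: source_moveI; rewrite ?sU1 ?stU1.
- by apply: source_moveI; rewrite ?sU2 ?stU2.
Qed.

Lemma source_preds_end X Y : steps X = n -> source_move Y X = false.
Proof.
by have := steps_range Y => Yr Xn; apply/negP => /andP[_ /eqP]; lia.
Qed.

Lemma target_preds X : (3 <= steps X)%N ->
  exists L, [/\ tag_sign L, steps L = (steps X).-1 & forall Y, target_move Y X = (Y == L)].
Proof.
have /andP[_ Xn] := steps_range X => X3.
have [||L [sL stL eL]] := @tedge_ex n (src X) (steps X).-1 true; rewrite ?implybT //.
  by apply/andP; lia.
exists L; split=> // Y; apply/idP/eqP => [/andP[/eqP sY /eqP stY]|->].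
  apply: tedge_eqP; rewrite ?sL ?stL // ?stY //.
  by rewrite !tag_sign_lt //; lia.
by rewrite /target_move sL stL eqxx /=; apply/eqP; lia.
Qed.

Lemma target_move_none X Y : steps X = 2%N -> target_move Y X = false.
Proof.
by have := steps_range Y => Yr Xn; apply/negP => /andP[_ /eqP]; lia.
Qed.

Lemma steps_tau X : steps (tau X) = steps X.
Proof. by apply: succn_inj; exact: bcard_pred. Qed.

Lemma src_tau X : src (tau X) = ord_pred (src X).
Proof. by []. Qed.

Lemma tag_sign_tau X : tag_sign (tau X) = if steps X == n then ~~ tag_sign X else tag_sign X.
Proof. by rewrite -is_loopE. Qed.

Lemma source_move_tau Y X : source_move Y X = target_move (tau X) Y.
Proof.
by rewrite /source_move /target_move src_tau steps_tau [src X == _]eq_sym (can2_eq (@ordSK _) (@ord_predK _)).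
Qed.

Lemma target_move_tau Y X : target_move Y X = source_move (tau X) Y.
Proof. by rewrite /source_move /target_move src_tau steps_tau ord_predK eq_sym. Qed.

Lemma sum_preds (V : zmodType) (F : tedge n -> V) X : (3 <= n)%N ->
  \sum_(y : {Y | emove Y X}) F (val y) = \sum_(Y | source_move Y X) F Y + \sum_(Y | target_move Y X) F Y.
Proof.
move=> hn; transitivity (\sum_(Y | emove Y X) F Y).
  rewrite [RHS](reindex_omap (val : {Y | emove Y X} -> tedge n) insub) /=.
    by apply: eq_bigl => y; rewrite valK eqxx (valP y).
  by move=> Y YX; rewrite insubT.
rewrite (bigID (source_move^~ X)) /=; congr (_ + _); apply: eq_bigl => Y.
  by rewrite emoveE // andbC; case: (source_move Y X).
rewrite emoveE //; case S: (source_move Y X); first by rewrite source_target_moveF ?andbF.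
by rewrite andbT.
Qed.
End Preds.

(** * A representation of the mesh relations *)

Section Representation.
Context (k : fieldType) {n : nat} (M : tedge n).
Local Notation V := (k^o * k^o)%type.
Local Notation m := (steps M).
Implicit Types (X Y : tedge n) (i : int) (w : V).

Definition at_grade i X : Prop :=
  exists q : int, (src M)%:Z + i = (src X)%:Z + q * n%:Z.

Lemma at_grade_source_move i Y X : source_move Y X -> at_grade i X <-> at_grade (i - 1) Y.
Proof.
move=> /andP[/eqP sX _]; have := val_ordS (src Y); rewrite -sX => E.
split=> -[q qE]; move: E; case: eqP => yn E.
- by exists (q - 1); move: qE; rewrite E mulrBl; lia.
- by exists q; move: qE; rewrite E; lia.
- by exists (q + 1); move: qE; rewrite E mulrDl; lia.
- by exists q; move: qE; rewrite E; lia.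
Qed.

Lemma at_grade_target_move i Y X : target_move Y X -> at_grade i X <-> at_grade i Y.
Proof. by rewrite /at_grade => /andP[/eqP -> _]. Qed.

Hypothesis hn : (3 <= n)%N.

(** The space of values at grade [i] of the combinations of sequences of elementary
    moves from [M] to [X]. *)
Definition predicted i X w : Prop :=
  in_space n m (tag_sign M) i (steps X) (tag_sign X) w /\ (w = (0, 0) \/ at_grade i X).

Definition push_to i X : V -> V := push (region_at n m i (steps X)) (tag_sign X).

Lemma push_to_linear i X c w w' : push_to i X (c *: w + w') = c *: push_to i X w + push_to i X w'.
Proof. exact: push_linear. Qed.

Lemma push_to0 i X : push_to i X 0 = 0.
Proof. by have := push_to_linear i X (-1) 0 0; rewrite scaler0 addr0 scaleN1r addNr. Qed.

Lemma push_toZ i X c w : push_to i X (c *: w) = c *: push_to i X w.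
Proof. by have := push_to_linear i X c w 0; rewrite push_to0 !addr0. Qed.

Lemma push_toD i X w w' : push_to i X (w + w') = push_to i X w + push_to i X w'.
Proof. by have := push_to_linear i X 1 w w'; rewrite !scale1r. Qed.

Lemma m_range : (2 <= m <= n)%N. Proof. exact: steps_range. Qed.

Lemma in_space0 i s e : in_space n m (tag_sign M) i s e ((0, 0) : V).
Proof.
split; last by rewrite /on_axis; case: ifP => _ //; case: ifP.
by case: region_at => //=; case: e.
Qed.

Lemma predicted0 i X : predicted i X 0.
Proof. by split; [exact: in_space0|left]. Qed.

Lemma in_spaceZ i s e c w : in_space n m (tag_sign M) i s e w -> in_space n m (tag_sign M) i s e (c *: w).
Proof.
case: w => a b [wR wA]; split.
  move: wR; case: region_at => //=.
  - by move=> [-> ->]; rewrite !scaler0.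
  - by move=> ->.
  - by move=> ->; rewrite scaler0.
  - by case: e => ->; rewrite scaler0.
move: wA; rewrite /on_axis; case: ifP => _ //.
by case: ifP => _ /= ->; rewrite scaler0.
Qed.

Lemma predictedZ i X c w : predicted i X w -> predicted i X (c *: w).
Proof.
move=> [wP wL]; split; first exact: in_spaceZ.
by case: wL => [->|H]; [left; rewrite scaler0|right].
Qed.

Definition grade_sign i : k := (-1) ^ i.

Lemma grade_signB1 i : grade_sign (i - 1) = - grade_sign i.
Proof. by rewrite /grade_sign expfzDr ?oppr_eq0 ?oner_eq0 // exprN1 invrN1 mulrN1. Qed.

Lemma grade_sign_sq i : grade_sign i * grade_sign i = 1.
Proof. by rewrite /grade_sign -expfzMl mulrNN mulr1 exp1rz. Qed.

(** The grades are handled all at once, by letting an elementary move act on functions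
    of the grade. The signs of the moves that advance the target make the two ways
    around a mesh cancel. *)
Definition move_act Y X (v : int -> V) : int -> V := fun i =>
  if source_move Y X then push_to i X (v (i - 1)) else grade_sign i *: push_to i X (v i).

Lemma source_move_predicted i Y X w : source_move Y X -> predicted (i - 1) Y w -> predicted i X (push_to i X w).
Proof.
move=> YX [wP wL]; have /andP[X2 _] := steps_range X; have /andP[_ Yn] := steps_range Y.
have /andP[_ /eqP stY] := YX; rewrite stY in wP Yn.
split; first by apply: step_source wP; rewrite ?m_range ?X2.
case: wL => [->|L]; first by left; exact: push_to0.
by right; rewrite (at_grade_source_move _ YX).
Qed.

Lemma target_move_predicted i Y X w : target_move Y X -> predicted i Y w -> predicted i X (push_to i X w).
Proof.
move=> YX [wP wL]; have /andP[_ Xn] := steps_range X; have /andP[Y2 _] := steps_range Y.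
have /andP[_ /eqP stX] := YX; rewrite -[steps Y]/(steps Y).+1.-1 -stX in wP.
split; first by apply: step_target wP; rewrite ?m_range // Xn stX ltnS Y2.
case: wL => [->|L]; first by left; exact: push_to0.
by right; rewrite (at_grade_target_move _ YX).
Qed.

Lemma move_act_predicted Y X v : emove Y X -> (forall i, predicted i Y (v i)) -> forall i, predicted i X (move_act Y X v i).
Proof.
rewrite emoveE // /move_act => YX vS i; case: ifP YX => [YX _|_ /= YX].
  exact: source_move_predicted YX (vS _).
by apply: predictedZ; exact: target_move_predicted YX (vS _).
Qed.

(** In the mesh of an edge with two sides, no move advances the target: the missing
    term would belong to an edge with one side, on which the prediction vanishes. *)
Lemma region_at_one i : region_at n m i 1 = RegZero.
Proof.
rewrite region_at_lt; last by lia.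
have := m_range => mr.
have -> : hammock m i 1 = false by apply/negP => /and3P[]; lia.
by have -> : mirror_hammock n m i 1 = false by apply/negP => /and3P[]; lia.
Qed.

Lemma mesh_relation X v i : (forall j, predicted j (tau X) (v j)) ->
  \sum_(y : {Y | emove Y X}) move_act (val y) X (move_act (tau X) (val y) v) i = 0.
Proof.
move=> vS; rewrite (sum_preds (fun Y => move_act Y X (move_act (tau X) Y v) i)) //.
have /andP[X2 Xn] := steps_range X.
have [] := vS (i - 1); rewrite steps_tau tag_sign_tau; set w := v (i - 1) => wP _.
have sE Y : source_move Y X -> move_act Y X (move_act (tau X) Y v) i = - grade_sign i *: push_to i X (push_to (i - 1) Y w).
  move=> YX; rewrite /move_act YX ifN; last by rewrite target_source_moveF // -source_move_tau.
  by rewrite push_toZ grade_signB1.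
have tE Y : target_move Y X -> move_act Y X (move_act (tau X) Y v) i = grade_sign i *: push_to i X (push_to i Y w).
  by move=> YX; rewrite /move_act target_source_moveF // -target_move_tau YX.
rewrite (eq_bigr _ sE) (eq_bigr _ tE) -!scaler_sumr scaleNr.
set S := \sum_(_ | source_move _ _) _; set T := \sum_(_ | target_move _ _) _.
suff -> : S = T by rewrite addNr.
have TE : T = push_to i X (push (region_at n m i (steps X).-1) true w).
  rewrite /T; have [X3|X3] := leqP 3 (steps X).
    have [L [eL stL LX]] := target_preds X3.
    by rewrite (eq_bigl _ _ LX) big_pred1_eq /push_to stL eL.
  have X2' : steps X = 2%N by lia.
  by rewrite (eq_bigl _ _ (fun Y => target_move_none Y X2')) big_pred0_eq X2' region_at_one /= -[(0, 0)]/(0 : V) push_to0.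
rewrite TE /S => {S T TE sE tE}.
have [Xn'|Xn'] := eqVneq (steps X) n.
  rewrite (eq_bigl _ _ (fun Y => source_preds_end Y Xn')) big_pred0_eq.
  rewrite Xn' eqxx in wP; by rewrite /push_to Xn' (mesh_end hn m_range wP).
have {Xn Xn'} Xn : (steps X < n)%N by rewrite ltn_neqAle Xn'.
rewrite (ltn_eqF Xn) (tag_sign_lt Xn) in wP.
have eX := tag_sign_lt Xn.
have [Xn'|Xn'] := eqVneq (steps X).+1 n.
  have [U1 [U2 [eU1 eU2 stU1 stU2 UX]]] := source_preds_fork Xn'.
  have U12 : U2 != U1 by apply/eqP => U; move: eU2; rewrite U eU1.
  rewrite (eq_bigl _ _ UX) (bigD1 U1) ?eqxx //= (bigD1 U2) ?eqxx ?orbT //=.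
  rewrite big_pred0 ?addr0; last first.
    by move=> Y; case: (Y == U1); case: (Y == U2).
  by rewrite -push_toD /push_to stU1 stU2 eU1 (negPf eU2) eX (mesh_fork hn m_range Xn' wP).
have [|U [eU stU UX]] := @source_preds_mid _ X; first by lia.
have Xn2 : (steps X + 2 <= n)%N by lia.
by rewrite (eq_bigl _ _ UX) big_pred1_eq /push_to stU eU eX (mesh_mid hn m_range X2 Xn2 wP).
Qed.

End Representation.

(** * Exactness along the meshes *)

Section Exactness.
Context (k : fieldType) {n : nat} (M : tedge n).
Hypothesis hn : (3 <= n)%N.
Local Notation V := (k^o * k^o)%type.
Local Notation m := (steps M).
Local Notation predicted := (predicted (k := k) M).
Local Notation push_to := (push_to (k := k) M).
Local Notation mr := (m_range M).
Local Notation grade_sign := (grade_sign k).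
Implicit Types (X Y : tedge n) (i : int) (w : V).

(** The signs are absorbed into the vectors at the predecessors of the first kind, so
    that the three sign-free exactness lemmas apply. *)
Lemma mesh_exact X i (vY : tedge n -> V) :
  (forall Y, source_move Y X -> predicted (i - 1) Y (vY Y)) ->
  (forall Y, target_move Y X -> predicted i Y (vY Y)) ->
  \sum_(y : {Y | emove Y X}) (if source_move (val y) X then push_to i X (vY (val y))
                              else grade_sign i *: push_to i X (vY (val y))) = 0 ->
  exists w, [/\ predicted (i - 1) (tau X) w,
    forall Y, source_move Y X -> vY Y = grade_sign (i - 1) *: push_to (i - 1) Y w &
    forall Y, target_move Y X -> vY Y = push_to i Y w].
Proof.
move=> vs vt; have [L|nL] := pselect (at_grade M i X); last first.
  move=> _; exists 0; split=> [|Y YX|Y YX]; first exact: predicted0.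
  - case: (vs _ YX) => _ [->|]; first by rewrite push_to0 scaler0.
    by rewrite -(at_grade_source_move _ _ YX).
  - case: (vt _ YX) => _ [->|]; first by rewrite push_to0.
    by rewrite -(at_grade_target_move _ _ YX).
rewrite (sum_preds (fun Y => if source_move Y X then push_to i X (vY Y) else grade_sign i *: push_to i X (vY Y))) //.
rewrite (eq_bigr (fun Y => push_to i X (vY Y))) => [|Y ->] //.
rewrite [X in _ + X](eq_bigr (fun Y => grade_sign i *: push_to i X (vY Y))); last first.
  by move=> Y /target_source_moveF ->.
rewrite -scaler_sumr.
have grade_sign2 w : grade_sign (i - 1) *: (grade_sign (i - 1) *: w) = w by rewrite scalerA grade_sign_sq scale1r.
have sumP (P : pred (tedge n)) : \sum_(Y | P Y) push_to i X (vY Y) = push_to i X (\sum_(Y | P Y) vY Y).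
  by elim/big_rec2: _ => [|Y a b _ ->]; rewrite ?push_to0 ?push_toD.
rewrite !sumP => /eqP; rewrite addr_eq0 -scaleNr -grade_signB1 => /eqP.
move/(congr1 (fun w => grade_sign (i - 1) *: w)); rewrite grade_sign2.
rewrite -push_toZ scaler_sumr => E.
have /andP[X2 Xn] := steps_range X.
set l := \sum_(Y | target_move Y X) vY Y in E.
have [lP lT] : in_space n m (tag_sign M) i (steps X).-1 true l /\
    forall Y, target_move Y X -> [/\ tag_sign Y, steps Y = (steps X).-1 & vY Y = l].
  have [X3|X3] := leqP 3 (steps X).
    have [U [eU stU UX]] := target_preds X3.
    rewrite /l (eq_bigl _ _ UX) big_pred1_eq.
    have [] := vt U _; first by rewrite UX eqxx.
    by rewrite stU eU => uP _; split=> // Y; rewrite UX => /eqP ->.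
  have X2' : steps X = 2%N by lia.
  rewrite /l (eq_bigl _ _ (fun Y => target_move_none Y X2')) big_pred0_eq.
  by split; [exact: in_space0|move=> Y; rewrite target_move_none].
have tau_lift w : in_space n m (tag_sign M) (i - 1) (steps X) (tag_sign (tau X)) w -> predicted (i - 1) (tau X) w.
  move=> wP; split; first by rewrite steps_tau.
  case: L => q qE; right.
  have := val_ord_pred (src X); rewrite -src_tau; case: eqP => x0 sE.
    by exists (q - 1); move: qE (ltn_ord (src X)); rewrite sE x0 mulrBl; lia.
  by exists q; move: qE; rewrite sE; lia.
have [Xn'|Xn'] := eqVneq (steps X) n.
  move: E; rewrite (eq_bigl _ _ (fun Y => source_preds_end Y Xn')) big_pred0_eq.
  rewrite push_to0 /push_to Xn' => /esym E; rewrite Xn' in lP lT.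
  have [w [wP wE]] := exact_end hn mr lP E.
  exists w; split=> [|Y YX|Y YX].
  - by apply: tau_lift; rewrite tag_sign_tau Xn' eqxx.
  - by rewrite source_preds_end in YX.
  - by have [eY stY ->] := lT _ YX; rewrite /push_to eY stY.
have {Xn Xn'} Xn : (steps X < n)%N by rewrite ltn_neqAle Xn'.
have eX := tag_sign_lt Xn.
have etX : tag_sign (tau X) by rewrite tag_sign_tau ltn_eqF.
have sE Y w : source_move Y X -> grade_sign (i - 1) *: vY Y = push_to (i - 1) Y w -> vY Y = grade_sign (i - 1) *: push_to (i - 1) Y w.
  by move=> _ <-; rewrite grade_sign2.
have [Xn'|Xn'] := eqVneq (steps X).+1 n.
  have [U1 [U2 [eU1 eU2 stU1 stU2 UX]]] := source_preds_fork Xn'.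
  have U12 : U2 != U1 by apply/eqP => U; move: eU2; rewrite U eU1.
  have U1X : source_move U1 X by rewrite UX eqxx.
  have U2X : source_move U2 X by rewrite UX eqxx orbT.
  move: E; rewrite (eq_bigl _ _ UX) (bigD1 U1) ?eqxx //= (bigD1 U2) ?eqxx ?orbT //=.
  rewrite big_pred0 ?addr0; last first.
    by move=> Y; case: (Y == U1); case: (Y == U2).
  have [] := predictedZ (grade_sign (i - 1)) (vs _ U1X); rewrite stU1 eU1 => u1P _.
  have [] := predictedZ (grade_sign (i - 1)) (vs _ U2X); rewrite stU2 (negPf eU2) => u2P _.
  rewrite /push_to eX => E.
  have [w [wP w1 w2 wE]] := exact_fork hn mr Xn' u1P u2P lP E.
  exists w; split=> [|Y YX|Y YX].
  - by apply: tau_lift; rewrite etX.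
  - apply: (sE) => //; move: YX; rewrite UX => /orP[] /eqP ->.
      by rewrite /push_to stU1 eU1 w1.
    by rewrite /push_to stU2 (negPf eU2) w2.
  - by have [eY stY ->] := lT _ YX; rewrite /push_to eY stY.
have Xn2 : (steps X + 2 <= n)%N by lia.
have [U [eU stU UX]] := source_preds_mid Xn2.
have U1X : source_move U X by rewrite UX eqxx.
move: E; rewrite (eq_bigl _ _ UX) big_pred1_eq /push_to eX => E.
have [] := predictedZ (grade_sign (i - 1)) (vs _ U1X); rewrite stU eU => u1P _.
have [w [wP w1 wE]] := exact_mid hn mr X2 Xn2 u1P lP E.
exists w; split=> [|Y YX|Y YX].
- by apply: tau_lift; rewrite etX.
- apply: (sE) => //; move: YX; rewrite UX => /eqP ->.
  by rewrite /push_to stU eU w1.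
- by have [eY stY ->] := lT _ YX; rewrite /push_to eY stY.
Qed.

(** The value of the empty path. *)
Definition start_vec : V :=
  if is_loop M then if tag_sign M then (1, 0) else (0, 1) else (1, 1).

Lemma region_at_start : region_at n m 0 m = if m == n then RegLoop else RegDiag.
Proof.
have /andP[M2 Mn] := mr; rewrite /region_at; case: ifP => Mn'.
  by case: ifP => // /negP[]; apply/andP; lia.
have -> : hammock m 0 m by apply/and3P; split; lia.
by have -> : mirror_hammock n m 0 m = false by apply/negP => /and3P[]; lia.
Qed.

Lemma start_predicted : predicted 0 M start_vec.
Proof.
split; last by right; exists 0; rewrite mul0r.
rewrite /start_vec is_loopE /in_space /on_axis region_at_start.
by case: eqVneq => Mn //; case: (tag_sign M).
Qed.

Lemma start_vec_neq0 : start_vec <> 0.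
Proof.
have n1 : (1 : k^o) <> 0 by apply/eqP; exact: oner_neq0.
by rewrite /start_vec; case: ifP => _; [case: ifP => _|]; case.
Qed.

Lemma predicted_start w : predicted 0 M w -> exists c : k, w = c *: start_vec.
Proof.
case=> + _; rewrite /start_vec is_loopE /in_space /on_axis region_at_start.
case: w => a b; case: eqVneq => Mn /=; last first.
  by case=> -> _; exists b; congr pair; rewrite /= [RHS]mulr1.
case: (tag_sign M) => -[-> _]; [exists a|exists b]; congr pair; rewrite /= ?scaler0 //;
  by rewrite [RHS]mulr1.
Qed.

Lemma mesh_onto i X w : predicted i X w ->
  [\/ w = 0, i = 0 /\ X = M,
      (exists Y1 u1 Y2 u2, [/\ source_move Y1 X, source_move Y2 X, predicted (i - 1) Y1 u1, predicted (i - 1) Y2 u2 &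
          push_to i X u1 + push_to i X u2 = w]) |
      exists Y u, [/\ target_move Y X, predicted i Y u & push_to i X u = w]].
Proof.
move=> [wP [->|L]]; first by apply: Or41.
have /andP[X2 Xn] := steps_range X; have /andP[M2 Mn] := mr.
have isM : i = 0 -> steps X = m -> tag_sign X = tag_sign M -> X = M.
  move=> i0 st e; apply: tedge_eqP => //; apply: val_inj.
  case: L => q; rewrite i0 addr0 => qE.
  have := ltn_ord (src X); have := ltn_ord (src M) => sM sX.
  have q0 : q = 0.
    case: (ltgtP q 0) => // q0; exfalso.
      have : q * n%:Z <= - n%:Z by rewrite -mulN1r ler_wpM2r //; lia.
      by lia.
    have : n%:Z <= q * n%:Z by rewrite -[leLHS]mul1r ler_wpM2r //; lia.
    by lia.
  by move: qE; rewrite q0 mul0r addr0 => -[].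
have viaS Y u : source_move Y X -> in_space n m (tag_sign M) (i - 1) (steps Y) (tag_sign Y) u -> predicted (i - 1) Y u.
  by move=> YX uP; split=> //; right; rewrite -(at_grade_source_move _ _ YX).
have viaT Y u : target_move Y X -> in_space n m (tag_sign M) i (steps Y) (tag_sign Y) u -> predicted i Y u.
  by move=> YX uP; split=> //; right; rewrite -(at_grade_target_move _ _ YX).
have [Xn'|Xn'] := eqVneq (steps X) n.
  rewrite Xn' in wP; case: (onto_end hn mr wP) => [->|[i0 nm e]|[l [lP lE]]].
  - exact: Or41.
  - by apply: Or42; split=> //; apply: isM; rewrite // Xn'.
  - have [|L' [eL stL LX]] := @target_preds _ X; first by lia.
    have LX' : target_move L' X by rewrite LX.
    apply: Or44; exists L', l; split=> //; last by rewrite /push_to Xn'.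
    by apply: viaT; rewrite // stL Xn' eL.
have {Xn Xn'} Xn : (steps X < n)%N by rewrite ltn_neqAle Xn'.
have eX := tag_sign_lt Xn; rewrite eX in wP.
have isM' : i = 0 -> steps X = m -> X = M.
  by move=> i0 st; apply: isM => //; rewrite eX tag_sign_lt // -st.
have tcase : [/\ (3 <= steps X)%N, in_space n m (tag_sign M) i (steps X).-1 true w &
    push (region_at n m i (steps X)) true w = w] ->
    exists Y u, [/\ target_move Y X, predicted i Y u & push_to i X u = w].
  move=> [X3 uP uE]; have [L' [eL stL LX]] := target_preds X3.
  have LX' : target_move L' X by rewrite LX.
  exists L', w; split=> //; last by rewrite /push_to eX.
  by apply: viaT; rewrite // stL eL.
have [Xn'|Xn'] := eqVneq (steps X).+1 n.
  have [U1 [U2 [eU1 eU2 stU1 stU2 UX]]] := source_preds_fork Xn'.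
  have U1X : source_move U1 X by rewrite UX eqxx.
  have U2X : source_move U2 X by rewrite UX eqxx orbT.
  case: (onto_fork hn mr Xn' wP) => [->|[i0 sm]|[u1 [u2 [u1P u2P uE]]]|H].
  - exact: Or41.
  - by apply: Or42; split=> //; exact: isM'.
  - apply: Or43; exists U1, u1, U2, u2; split=> //; last by rewrite /push_to eX.
      by apply: viaS; rewrite // stU1 eU1.
    by apply: viaS; rewrite // stU2 (negPf eU2).
  - by apply: Or44; exact: tcase.
have Xn2 : (steps X + 2 <= n)%N by lia.
have [U [eU stU UX]] := source_preds_mid Xn2.
have U1X : source_move U X by rewrite UX.
case: (onto_mid hn mr X2 Xn2 wP) => [->|[i0 sm]|[uP uE]|H].
- exact: Or41.
- by apply: Or42; split=> //; exact: isM'.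
- apply: Or43; exists U, w, U, 0; split=> //; last by rewrite push_to0 addr0 /push_to eX uE.
    by apply: viaS; rewrite // stU eU.
  exact: predicted0.
- by apply: Or44; exact: tcase.
Qed.

End Exactness.

(** * Linear combinations of sequences of moves *)

Section FreeLift.
Context (k : fieldType) (K : choiceType).
Implicit Types (f g : {freeg K / k}).

Lemma fgliftU (W : lmodType k) (h : K -> W) p : fglift h << p >> = h p.
Proof. by rewrite liftU scale1r. Qed.

Lemma fglift0 (W : lmodType k) (h : K -> W) : fglift h 0 = 0.
Proof. by have := lift_is_additive h 0 0; rewrite !subrr. Qed.

Lemma fgliftD (W : lmodType k) (h : K -> W) f g : fglift h (f + g) = fglift h f + fglift h g.
Proof.
have gN : fglift h (- g) = - fglift h g.
  by rewrite -[- g]sub0r (lift_is_additive h) fglift0 sub0r.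
by rewrite -{1}[g]opprK (lift_is_additive h) gN opprK.
Qed.

Lemma fglift_sum (W : lmodType k) (h : K -> W) I (r : seq I) (P : pred I) (F : I -> {freeg K / k}) :
  fglift h (\sum_(i <- r | P i) F i) = \sum_(i <- r | P i) fglift h (F i).
Proof. by elim/big_rec2: _ => [|i a b _ <-]; rewrite ?fglift0 ?fgliftD. Qed.

Lemma fgliftE (W : lmodType k) (h : K -> W) f : fglift h f = \sum_(p <- dom f) coeff p f *: h p.
Proof.
rewrite -[in LHS](freeg_sumE f) fglift_sum; apply: eq_bigr => p _.
by rewrite liftU.
Qed.

Lemma fgliftZ (W : lmodType k) (h : K -> W) c f : fglift h (c *: f) = c *: fglift h f.
Proof.
have -> : c *: f = fgscale c f by [].
rewrite [in RHS]fgliftE scaler_sumr /fgscale fglift_sum.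
by apply: eq_bigr => p _; rewrite liftU scalerA.
Qed.

Lemma fglift_linear (W : lmodType k) (h : K -> W) c f g :
  fglift h (c *: f + g) = c *: fglift h f + fglift h g.
Proof. by rewrite fgliftD fgliftZ. Qed.

Lemma eq_fglift (W : lmodType k) (h h' : K -> W) f :
  {in dom f, h =1 h'} -> fglift h f = fglift h' f.
Proof. by move=> hh; rewrite !fgliftE; apply: eq_big_seq => p pf; rewrite hh. Qed.

Lemma fglift_id f : fglift (fun p => << p >>) f = f.
Proof.
rewrite fgliftE -[in RHS](freeg_sumE f); apply: eq_bigr => p _.
apply/eqP/freeg_eqP => q; by rewrite coeffZ !coeffU mul1r.
Qed.

Lemma fglift_addf (W : lmodType k) I (r : seq I) (P : pred I) (h : I -> K -> W) f :
  \sum_(i <- r | P i) fglift (h i) f = fglift (fun p => \sum_(i <- r | P i) h i p) f.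
Proof.
under eq_bigr => i _ do rewrite fgliftE.
by rewrite exchange_big fgliftE; apply: eq_bigr => p _; rewrite scaler_sumr.
Qed.

Lemma fglift_comp (W U : lmodType k) (T : W -> U) (h : K -> W) f :
  (forall c a b, T (c *: a + b) = c *: T a + T b) ->
  T (fglift h f) = fglift (fun p => T (h p)) f.
Proof.
move=> Tlin; rewrite !fgliftE.
have T0 : T 0 = 0.
  by have := Tlin (-1) 0 0; rewrite scaler0 addr0 scaleN1r addNr.
elim/big_rec2: _ => [//|p a b _ <-]; exact: Tlin.
Qed.

End FreeLift.

Lemma fglift_exchange (k : fieldType) (K K' : choiceType) (W : lmodType k) (h : K -> K' -> W)
    (f : {freeg K / k}) (g : {freeg K' / k}) :
  fglift (fun p => fglift (h p) g) f = fglift (fun q => fglift (h^~ q) f) g.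
Proof.
rewrite [LHS]fgliftE; under eq_bigr => p _ do rewrite fgliftE scaler_sumr.
rewrite exchange_big [RHS]fgliftE; apply: eq_bigr => q _.
rewrite fgliftE scaler_sumr; apply: eq_bigr => p _.
by rewrite !scalerA mulrC.
Qed.

Section PathAlgebra.
Context (k : fieldType) {n : nat}.
Local Notation kpath X Y := {freeg (mpath X Y) / k}.
Implicit Types X Y Z : tedge n.

Fact edge_subproof X Y : emove Y X -> path (@emove n) Y [:: X] && (last Y [:: X] == X).
Proof. by move=> YX; rewrite /= YX eqxx. Qed.

Definition edge X Y (YX : emove Y X) : mpath Y X := MPath (edge_subproof YX).

Lemma fglift_kcomp (W : lmodType k) L X Y (h : mpath L Y -> W) (f : kpath L X) (g : kpath X Y) :
  fglift h (kcomp f g) = fglift (fun p => fglift (fun q => h (mpath_cat p q)) g) f.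
Proof.
pose c p (q : mpath X Y) := << mpath_cat p q >> : kpath L Y.
have E1 := @fglift_comp k (mpath L X) (kpath L Y) W (fglift h) (fun p => fglift (c p) g) f (fglift_linear h).
rewrite [LHS]E1; apply: eq_fglift => p _.
have E2 := @fglift_comp k (mpath X Y) (kpath L Y) W (fglift h) (c p) g (fglift_linear h).
by rewrite [LHS]E2; apply: eq_fglift => q _; exact: fgliftU.
Qed.

Lemma kcompU L X Y (f : kpath L X) (q : mpath X Y) :
  kcomp f << q >> = fglift (fun p => << mpath_cat p q >>) f.
Proof. by rewrite /kcomp; apply: eq_fglift => p _; rewrite fgliftU. Qed.

Lemma kcomp_linearl L X Y c (f f' : kpath L X) (g : kpath X Y) :
  kcomp (c *: f + f') g = c *: kcomp f g + kcomp f' g.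
Proof. exact: fglift_linear. Qed.

Lemma kcompDl L X Y (f f' : kpath L X) (g : kpath X Y) :
  kcomp (f + f') g = kcomp f g + kcomp f' g.
Proof. exact: fgliftD. Qed.

Lemma kcomp_sumr L X Y (f : kpath L X) I (r : seq I) (P : pred I) (G : I -> kpath X Y) :
  kcomp f (\sum_(i <- r | P i) G i) = \sum_(i <- r | P i) kcomp f (G i).
Proof.
pose h i (p : mpath L X) := fglift (fun q => << mpath_cat p q >> : kpath L Y) (G i).
transitivity (fglift (fun p => \sum_(i <- r | P i) h i p) f); last first.
  exact: (esym (fglift_addf r P h f)).
by apply: eq_fglift => p _; exact: fglift_sum.
Qed.

Lemma kcompAU L X Y Z (f : kpath L X) (p : mpath X Y) (q : mpath Y Z) :
  kcomp (kcomp f << p >>) << q >> = kcomp f << mpath_cat p q >>.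
Proof.
rewrite !kcompU (fglift_comp _ _ (fglift_linear _)); apply: eq_fglift => u _.
by rewrite fgliftU; congr << _ >>; apply: val_inj => /=; rewrite catA.
Qed.

Lemma mesh_ideal_sum X Y I (r : seq I) (P : pred I) (F : I -> kpath X Y) :
  (forall i, P i -> mesh_ideal (F i)) -> mesh_ideal (\sum_(i <- r | P i) F i).
Proof.
move=> FP; elim/big_rec: _ => [|i a Pi aI]; first exact: mesh_ideal_zero.
by rewrite -[F i]scale1r; apply: mesh_ideal_lin => //; exact: FP.
Qed.

End PathAlgebra.

(** * Values of combinations of sequences of moves *)

Section Evaluation.
Context (k : fieldType) {n : nat} (M : tedge n).
Hypothesis hn : (3 <= n)%N.
Local Notation V := (k^o * k^o)%type.
Local Notation m := (steps M).
Local Notation predicted := (predicted (k := k) M).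
Local Notation push_to := (push_to (k := k) M).
Local Notation move_act := (move_act (k := k) M).
Local Notation kpath X Y := {freeg (mpath X Y) / k}.
Implicit Types (X Y Z L N : tedge n) (i j : int) (w : V) (v : int -> V).

Fixpoint act X (p : seq (tedge n)) v : int -> V :=
  if p is Y :: p' then act Y p' (move_act X Y v) else v.

Lemma act_cat X p q v : act X (p ++ q) v = act (last X p) q (act X p v).
Proof. by elim: p X v => //= Y p IHp X v. Qed.

Lemma move_act_linear Y X c v v' :
  move_act Y X (fun i => c *: v i + v' i) = (fun i => c *: move_act Y X v i + move_act Y X v' i).
Proof.
apply/funext => i; rewrite /move_act; case: ifP => _; rewrite push_to_linear //.
by rewrite scalerDr !scalerA mulrC.
Qed.

Lemma act_linear X p c v v' :
  act X p (fun i => c *: v i + v' i) = (fun i => c *: act X p v i + act X p v' i).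
Proof. by elim: p X v v' => //= Y p IHp X v v'; rewrite move_act_linear IHp. Qed.

Lemma act0 X p : act X p (fun _ => 0) = (fun _ => 0).
Proof.
have := act_linear X p (-1) (fun _ => 0) (fun _ => 0).
have -> : (fun _ : int => -1 *: (0 : V) + 0) = (fun _ => 0).
  by apply/funext => i; rewrite scaler0 addr0.
by move=> ->; apply/funext => i; rewrite scaleN1r addNr.
Qed.

Lemma act_predicted X p v : path (@emove n) X p -> (forall i, predicted i X (v i)) ->
  forall i, predicted i (last X p) (act X p v i).
Proof.
elim: p X v => //= Y p IHp X v /andP[XY Yp] vS; apply: IHp => //.
by move=> i; exact: move_act_predicted XY vS i.
Qed.

Definition path_value X Y v i (f : kpath X Y) : V := fglift (fun p : mpath X Y => act X p v i) f.

Lemma path_value_linear X Y v i c (f g : kpath X Y) :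
  path_value v i (c *: f + g) = c *: path_value v i f + path_value v i g.
Proof. exact: fglift_linear. Qed.

Lemma path_value_sum X Y v i I (r : seq I) (P : pred I) (F : I -> kpath X Y) :
  path_value v i (\sum_(j <- r | P j) F j) = \sum_(j <- r | P j) path_value v i (F j).
Proof. exact: fglift_sum. Qed.

Lemma path_valueU X Y v i (p : mpath X Y) : path_value v i << p >> = act X p v i.
Proof. exact: fgliftU. Qed.

Lemma mpath_last X Y (p : mpath X Y) : last X p = Y.
Proof. by have /andP[_ /eqP] := mpathP p. Qed.

Lemma mpath_path X Y (p : mpath X Y) : path (@emove n) X p.
Proof. by have /andP[] := mpathP p. Qed.

Lemma path_value_kcomp X Y Z v i (f : kpath X Y) (g : kpath Y Z) :
  path_value v i (kcomp f g) = fglift (fun p : mpath X Y => path_value (act X p v) i g) f.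
Proof.
etransitivity; first exact: (fglift_kcomp (fun p : mpath X Z => act X p v i) f g).
apply: eq_fglift => p _; apply: eq_fglift => q _.
by rewrite /= act_cat mpath_last.
Qed.

(** Acting by a sequence of moves is linear in the function acted upon. *)
Lemma path_value_kcomp2 X Y Z v i (f : kpath X Y) (g : kpath Y Z) :
  path_value v i (kcomp f g) = path_value (fun j => path_value v j f) i g.
Proof.
rewrite path_value_kcomp /path_value fglift_exchange; apply: eq_fglift => q _.
have H : forall c v v', act Y q (fun i => c *: v i + v' i) i = c *: act Y q v i + act Y q v' i.
  by move=> c u u'; rewrite act_linear.
rewrite fgliftE.
have -> : (fun j => fglift (fun p : mpath X Y => act X p v j) f) =
  (fun j => \sum_(p <- dom f) coeff p f *: act X p v j).
  by apply/funext => j; rewrite fgliftE.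
elim: (dom f) => [|p s IHs].
  have -> : (fun j => \sum_(p <- [::]) coeff p f *: act X p v j) = (fun _ => 0).
    by apply/funext => j; rewrite big_nil.
  by rewrite big_nil act0.
have -> : (fun j => \sum_(p <- p :: s) coeff p f *: act X p v j) =
  (fun j => coeff p f *: act X p v j + \sum_(p <- s) coeff p f *: act X p v j).
  by apply/funext => j; rewrite big_cons.
by rewrite big_cons H IHs.
Qed.

Lemma path_value_fun0 X Y i (f : kpath X Y) : path_value (fun _ => 0) i f = 0.
Proof. by rewrite /path_value fgliftE big1 // => p _; rewrite act0 scaler0. Qed.

(** The mesh relations act as zero, hence so does the ideal they generate. The start
    function is universally quantified because elements of the ideal occur in the
    middle of compositions. *)
Lemma mesh_ideal_value X Y (g : kpath X Y) : mesh_ideal g ->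
  forall v, (forall i, predicted i X (v i)) -> forall i, path_value v i g = 0.
Proof.
elim=> {X Y g} [X|X Y|X Y c f g _ IHf _ IHg|L X Y f g _ IHg|L X Y f g _ IHf] v vS i.
- rewrite /mesh path_value_sum -[RHS](mesh_relation hn i vS); apply: eq_bigr => y _.
  by rewrite path_valueU.
- exact: fglift0.
- by rewrite path_value_linear IHf // IHg // scaler0 addr0.
- rewrite path_value_kcomp fgliftE big1 // => p _.
  rewrite IHg ?scaler0 // => j.
  by have := act_predicted (mpath_path p) vS j; rewrite mpath_last.
- rewrite path_value_kcomp2 (_ : (fun j => _) = (fun _ => 0)) ?path_value_fun0 //.
  by apply/funext => j; exact: IHf.
Qed.

End Evaluation.

Section Kernel.
Context (k : fieldType) {n : nat} (M : tedge n).
Hypothesis hn : (3 <= n)%N.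
Local Notation V := (k^o * k^o)%type.
Local Notation m := (steps M).
Local Notation predicted := (predicted (k := k) M).
Local Notation push_to := (push_to (k := k) M).
Local Notation move_act := (move_act (k := k) M).
Local Notation act := (act (k := k) M).
Local Notation path_value := (path_value (k := k) M).
Local Notation kpath X Y := {freeg (mpath X Y) / k}.
Implicit Types (X Y Z L N : tedge n) (i j : int) (w : V) (v : int -> V).

Definition start_fun : int -> V := fun i => if i == 0 then start_vec k M else 0.

Definition value i X (f : kpath M X) : V := path_value start_fun i f.

Lemma start_fun_predicted i : predicted i M (start_fun i).
Proof. by rewrite /start_fun; case: eqP => [->|_]; [exact: start_predicted|exact: predicted0]. Qed.

Lemma in_spaceD i s e w w' : in_space n m (tag_sign M) i s e w ->
  in_space n m (tag_sign M) i s e w' -> in_space n m (tag_sign M) i s e (w + w').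
Proof.
case: w w' => [a b] [a' b'] [P1 P2] [Q1 Q2]; split.
  move: P1 Q1; case: region_at => //=.
  - by move=> [-> ->] [-> ->]; rewrite !addr0.
  - by move=> -> ->.
  - by move=> -> ->; rewrite addr0.
  - by case: e => -> ->; rewrite addr0.
move: P2 Q2; rewrite /on_axis; case: ifP => _ //.
by case: ifP => _ /= -> ->; rewrite addr0.
Qed.

Lemma predictedD i X w w' : predicted i X w -> predicted i X w' -> predicted i X (w + w').
Proof.
move=> [wP wL] [wP' wL']; split; first exact: in_spaceD.
case: wL => [->|L]; last by right.
by case: wL' => [->|L]; [left; rewrite [LHS]addr0|right].
Qed.

Lemma value_predicted i X (f : kpath M X) : predicted i X (value i f).
Proof.
rewrite /value /path_value fgliftE; elim/big_rec: _ => [|p w _ wS]; first exact: predicted0.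
apply: predictedD wS; apply: predictedZ.
by have := act_predicted hn (mpath_path p) start_fun_predicted i; rewrite mpath_last.
Qed.

(** Each path from [M] to [X] has the grade determined by this equation, since every
    move changes [2 * i + steps X] by one. *)
Definition homog i X (f : kpath M X) : Prop :=
  forall p, coeff p f != 0 -> (size p)%:Z + m%:Z = 2 * i + (steps X)%:Z.

Lemma homog0 i X : homog i (0 : kpath M X).
Proof. by move=> p; rewrite coeff0 eqxx. Qed.

Lemma homogD i X (f g : kpath M X) : homog i f -> homog i g -> homog i (f + g).
Proof.
move=> hf hg p; rewrite coeffD; case: (eqVneq (coeff p f) 0) => [->|/hf //].
by rewrite add0r; exact: hg.
Qed.

Lemma homogZ i X c (f : kpath M X) : homog i f -> homog i (c *: f).
Proof. by move=> hf p; rewrite coeffZ mulf_eq0 negb_or => /andP[_ /hf]. Qed.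

Lemma homog_sum i X I (r : seq I) (P : pred I) (F : I -> kpath M X) :
  (forall a, P a -> homog i (F a)) -> homog i (\sum_(a <- r | P a) F a).
Proof.
move=> FP; elim/big_rec: _ => [|a f Pa hf]; first exact: homog0.
by apply: homogD => //; exact: FP.
Qed.

Lemma homogU i X (p : mpath M X) : (size p)%:Z + m%:Z = 2 * i + (steps X)%:Z -> homog i << p >>.
Proof.
by move=> pi q; rewrite coeffU mul1r; case: (eqVneq p q) => [<- //|]; rewrite eqxx.
Qed.

Lemma homog_fglift i X (K : choiceType) (f : {freeg K / k}) (h : K -> kpath M X) :
  (forall q, q \in dom f -> homog i (h q)) -> homog i (fglift h f).
Proof.
move=> H; rewrite fgliftE big_seq; apply: homog_sum => q qf; apply: homogZ; exact: H.
Qed.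

Lemma homog_kcompU i j X Y (YX : emove Y X) (f : kpath M Y) :
  2 * i + (steps Y)%:Z + 1 = 2 * j + (steps X)%:Z -> homog i f ->
  homog j (kcomp f << edge YX >>).
Proof.
move=> ij hf; rewrite kcompU; apply: homog_fglift => p; rewrite mem_dom => /hf E.
by apply: homogU; rewrite /= size_cat /=; lia.
Qed.

Lemma value_edge i X Y (YX : emove Y X) (f : kpath M Y) :
  value i (kcomp f << edge YX >>) = move_act Y X (fun j => value j f) i.
Proof.
etransitivity; first exact: path_value_kcomp2.
by rewrite path_valueU.
Qed.

Lemma value_linear i X c (f g : kpath M X) : value i (c *: f + g) = c *: value i f + value i g.
Proof. exact: path_value_linear. Qed.

Lemma value0 i X : value i (0 : kpath M X) = 0.
Proof. exact: fglift0. Qed.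

Lemma valueZ i X c (f : kpath M X) : value i (c *: f) = c *: value i f.
Proof. by rewrite -[c *: f]addr0 value_linear value0 addr0. Qed.

Lemma valueD i X (f g : kpath M X) : value i (f + g) = value i f + value i g.
Proof. by rewrite -[f in LHS]scale1r value_linear scale1r. Qed.

Lemma valueB i X (f g : kpath M X) : value i (f - g) = value i f - value i g.
Proof. by rewrite valueD -scaleN1r valueZ scaleN1r. Qed.

Lemma predicted_neg i X w : i < 0 -> predicted i X w -> w = 0.
Proof.
move=> i0 [[wP _] _]; have /andP[X2 Xn] := steps_range X.
have r0 : region_at n m i (steps X) = RegZero.
  rewrite /region_at; case: ifP => _; first by case: ifP => // /andP[]; lia.
  have -> : hammock m i (steps X) = false by apply/negP => /and3P[]; lia.
  by have -> : mirror_hammock n m i (steps X) = false by apply/negP => /and3P[]; lia.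
by move: wP; rewrite r0; case: w => a b [/= -> ->].
Qed.

Fact nil_subproof X : path (@emove n) X [::] && (last X [::] == X).
Proof. by rewrite /= eqxx. Qed.

(** Induction on the length, by [mesh_onto]. *)
Lemma value_onto i X w : predicted i X w -> exists2 h : kpath M X, homog i h & value i h = w.
Proof.
have [N] : exists N : nat, 2 * i + (steps X)%:Z <= N%:Z.
  by exists (absz (2 * i + (steps X)%:Z)); lia.
elim: N i X w => [|N IHN] i X w iN wS.
  exists 0; first exact: homog0.
  rewrite value0; symmetry; apply: predicted_neg wS; have := steps_range X; lia.
have [->|[i0 XM]|[Y1 [u1 [Y2 [u2 [Y1X Y2X u1S u2S <-]]]]]|[Y [u [YX uS <-]]]] := mesh_onto hn wS.
- by exists 0; [exact: homog0|exact: value0].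
- subst i X; have [c ->] := predicted_start hn wS.
  exists (c *: << MPath (nil_subproof M) >>).
    by apply/homogZ/homogU; rewrite /= mulr0 !add0r.
  by rewrite valueZ /value path_valueU.
- have E Y u : source_move Y X -> predicted (i - 1) Y u ->
      exists2 h : kpath M X, homog i h & value i h = push_to i X u.
    move=> YX uS; have /andP[_ /eqP stY] := YX.
    have [|h hh hE] := IHN _ _ _ _ uS; first by lia.
    have YX' : emove Y X by rewrite emoveE // YX.
    exists (kcomp h << edge YX' >>); first by apply: homog_kcompU hh; lia.
    by rewrite value_edge /move_act YX hE.
  have [h1 h1h h1E] := E _ _ Y1X u1S; have [h2 h2h h2E] := E _ _ Y2X u2S.
  by exists (h1 + h2); [exact: homogD|rewrite valueD h1E h2E].
- have /andP[_ /eqP stX] := YX.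
  have [|h hh hE] := IHN _ _ _ _ uS; first by lia.
  have YX' : emove Y X by rewrite emoveE // YX orbT.
  exists (grade_sign k i *: kcomp h << edge YX' >>).
    by apply/homogZ; apply: homog_kcompU hh; lia.
  by rewrite valueZ value_edge /move_act target_source_moveF // hE scalerA grade_sign_sq scale1r.
Qed.

End Kernel.

(** * Combinations with value zero *)

Section MeshKernel.
Context (k : fieldType) {n : nat} (M : tedge n).
Hypothesis hn : (3 <= n)%N.
Local Notation V := (k^o * k^o)%type.
Local Notation m := (steps M).
Local Notation predicted := (predicted (k := k) M).
Local Notation push_to := (push_to (k := k) M).
Local Notation move_act := (move_act (k := k) M).
Local Notation kpath X Y := {freeg (mpath X Y) / k}.
Implicit Types (X Y Z L : tedge n) (i j : int) (w : V).

(** [<< p >>] without its last move if [p] then ends at [Y], and [0] otherwise; with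
    this convention the last move can be split off without casts. *)
Definition drop_last_move Y X (p : mpath M X) : kpath M Y :=
  if insub (take (size p).-1 p) is Some q then << q >> else 0.

Lemma drop_last_move_edge X (p : mpath M X) : (0 < size p)%N ->
  \sum_(y : {Y | emove Y X}) kcomp (drop_last_move (val y) p) << edge (valP y) >> = << p >>.
Proof.
case: p => s sP /=; case/lastP: s sP => // s Z sP _.
have /andP[+ /eqP] := sP; rewrite rcons_path last_rcons => /andP[sPath sX] ZX.
subst Z; pose y0 : {Y | emove Y X} := Sub (last M s) sX.
have trE : take (size (rcons s X)).-1 (rcons s X) = s.
  by rewrite size_rcons /= -cats1 take_size_cat.
rewrite (bigD1 y0) //= big1 ?addr0 => [|y yy0].
  have qP : path (@emove n) M s && (last M s == last M s) by rewrite sPath eqxx.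
  have tE : drop_last_move (last M s) (MPath sP) = << MPath qP >>.
    rewrite /drop_last_move /= trE; case: insubP => [q _ qE|]; last by rewrite qP.
    by congr << _ >>; apply: val_inj.
  suff E (e : emove (last M s) X) :
      kcomp (drop_last_move (last M s) (MPath sP)) << edge e >> = << MPath sP >> by exact: E.
  rewrite tE kcompU fgliftU; congr << _ >>.
  by apply: val_inj; rewrite /= cats1.
rewrite /drop_last_move /= trE insubN /kcomp ?fglift0 // sPath /=.
by apply: contraNN yy0 => /eqP sy; rewrite -val_eqE /= sy.
Qed.

Definition last_move_part Y X (f : kpath M X) : kpath M Y := fglift (@drop_last_move Y X) f.

Lemma last_move_decomp X (f : kpath M X) : (forall p, p \in dom f -> 0 < size p)%N ->
  f = \sum_(y : {Y | emove Y X}) kcomp (last_move_part (val y) f) << edge (valP y) >>.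
Proof.
move=> f0.
pose h (y : {Y | emove Y X}) (p : mpath M X) := kcomp (drop_last_move (val y) p) << edge (valP y) >>.
transitivity (fglift (fun p => \sum_(y : {Y | emove Y X}) h y p) f).
  rewrite -[LHS]fglift_id; apply: eq_fglift => p pf.
  by rewrite /h drop_last_move_edge // f0.
rewrite -[LHS](fglift_addf _ _ h f); apply: eq_bigr => y _.
by apply: esym; apply: (fglift_comp (T := fun a => kcomp a << edge (valP y) >>)) => c a b; exact: kcomp_linearl.
Qed.

Lemma homog_last_move_part i j X Y (f : kpath M X) : (forall p, p \in dom f -> 0 < size p)%N ->
  2 * i + (steps X)%:Z = 2 * j + (steps Y)%:Z + 1 -> homog i f -> homog j (last_move_part Y f).
Proof.
move=> f0 ij hf; apply: homog_fglift => p pf; rewrite /drop_last_move.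
case: insubP => [q _ qE|_]; last exact: homog0.
apply: homogU; rewrite mem_dom in pf; have := hf _ pf.
have -> : size q = (size p).-1 by rewrite [mpath_seq q]qE size_take; case: ltnP => //; lia.
by have := f0 p; rewrite mem_dom => /(_ pf); lia.
Qed.

(** Write [f] as the sum of the [f_Y] followed by the moves [Y |-> X]. By exactness the
    values of the [f_Y] come from one vector over [tau X], which is the value of some
    [h]. Each [f_Y] differs from [h] followed by [tau X |-> Y] by an element of value
    zero and smaller length, which is in the ideal by induction; what is left of [f]
    is [h] followed by the mesh relation at [X]. *)
Lemma mesh_kernel l X i (f : kpath M X) : homog i f ->
  l%:Z + m%:Z = 2 * i + (steps X)%:Z -> value i f = 0 -> mesh_ideal f.
Proof.
elim: l X i f => [|l IHl] X i f hf lE fE.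
  suff -> : f = 0 by exact: mesh_ideal_zero.
  apply/eqP/freeg_eqP => p; rewrite coeff0; apply/eqP; apply: contraTT isT => pf /=.
  have p0 : size p = 0%N by have := hf _ pf; lia.
  have fU : f = coeff p f *: << p >>.
    apply/eqP/freeg_eqP => q; rewrite coeffZ coeffU mul1r.
    case: eqVneq => [->|pq]; first by rewrite mulr1.
    rewrite mulr0; apply/eqP; apply: contraNT pq => qf; apply/eqP/val_inj.
    have q0 : size q = 0%N by have := hf _ qf; lia.
    by rewrite /= (size0nil p0) (size0nil q0).
  have MX : X = M by rewrite -(mpath_last p) (size0nil p0).
  have i0 : i = 0 by move: lE; rewrite MX; lia.
  move: fE; rewrite fU valueZ /value path_valueU (size0nil p0) /= i0 /start_fun eqxx => /eqP.
  by rewrite scaler_eq0 (negPf pf) /= => /eqP /(start_vec_neq0 (M := M)).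
have f0 p : p \in dom f -> (0 < size p)%N.
  by rewrite mem_dom => /hf; lia.
pose vY Y := if source_move Y X then value (i - 1) (last_move_part Y f) else value i (last_move_part Y f).
have stS Y : source_move Y X -> steps Y = (steps X).+1 by move=> /andP[_ /eqP].
have stT Y : target_move Y X -> steps X = (steps Y).+1 by move=> /andP[_ /eqP].
have [|||w [wS ws wt]] := @mesh_exact k n M hn X i vY.
- by move=> Y YX; rewrite /vY YX; exact: value_predicted.
- by move=> Y YX; rewrite /vY target_source_moveF //; exact: value_predicted.
- rewrite -[RHS]fE [in RHS](last_move_decomp f0) /value path_value_sum; apply: eq_bigr => y _.
  rewrite -/(value i (kcomp (last_move_part (val y) f) << edge (valP y) >>)) value_edge /move_act /vY.
  by case: (source_move _ _).
have [h hh hE] := value_onto hn wS.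
have tE Y : emove Y X -> emove (tau X) Y by exact: tau_emove.
pose hy (y : {Y | emove Y X}) := kcomp h << edge (tE _ (valP y)) >>.
have g0 y : mesh_ideal (last_move_part (val y) f - hy y).
  have := valP y; rewrite emoveE //.
  case S: (source_move (val y) X) => /= T.
    have st := stS _ S.
    apply: (IHl _ (i - 1)); [|rewrite st; lia|].
      apply: homogD; first by apply: homog_last_move_part hf => //; rewrite st; lia.
      rewrite -scaleN1r; apply: homogZ; apply: (homog_kcompU hn _ hh); rewrite steps_tau st; lia.
    rewrite valueB value_edge /move_act target_source_moveF -?source_move_tau // hE -ws //.
    by rewrite /vY S subrr.
  have st := stT _ T.
  apply: (IHl _ i); [|rewrite st in lE; lia|].
    apply: homogD; first by apply: homog_last_move_part hf => //; rewrite st; lia.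
    rewrite -scaleN1r; apply: homogZ; apply: (homog_kcompU hn _ hh); rewrite steps_tau st; lia.
  rewrite valueB value_edge /move_act -target_move_tau T hE -wt //.
  by rewrite /vY S subrr.
have -> : f = \sum_(y : {Y | emove Y X}) kcomp (last_move_part (val y) f - hy y) << edge (valP y) >>
            + kcomp h (mesh k X).
  rewrite [LHS](last_move_decomp f0) /mesh kcomp_sumr -big_split; apply: eq_bigr => y _ /=.
  have -> : kcomp h << mesh_path (valP y) >> = kcomp (hy y) << edge (valP y) >>.
    rewrite /hy kcompAU; congr (kcomp h << _ >>); exact: val_inj.
  by rewrite -kcompDl subrK.
rewrite -[X in mesh_ideal (X + _)]scale1r; apply: mesh_ideal_lin.
  by apply: mesh_ideal_sum => y _; apply: mesh_ideal_compr; exact: g0.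
by apply: mesh_ideal_compl; exact: mesh_ideal_gen.
Qed.

End MeshKernel.

(** * Dimension of the morphism spaces *)

Section QuotientDimension.
Local Open Scope quotient_scope.
Context (k : fieldType) (W : lmodType k) (S : {pred W}) (S_sub : submod_closed S) (d : nat).
Variable (T : W -> 'rV[k]_d).
Hypothesis T_lin : linear T.
Hypothesis T_ker : forall v, (v \in S) = (T v == 0).

Local Notation Q := (lquot S_sub).

Definition quot_map (x : Q) : 'rV[k]_d := T (repr x).

Lemma quot_map_pi v : quot_map (\pi_Q v) = T v.
Proof.
rewrite /quot_map; apply/eqP; rewrite -subr_eq0.
have -> : T (repr (\pi_Q v)) - T v = T (repr (\pi_Q v) - v).
  by rewrite addrC -scaleN1r -T_lin scaleN1r addrC.
by rewrite -T_ker pi_lquotE reprK.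
Qed.

Fact quot_map_linear : linear quot_map.
Proof.
move=> c x y; rewrite -[x]reprK -[y]reprK.
have -> : c *: \pi_Q (repr x) + \pi_Q (repr y) = \pi_Q (c *: repr x + repr y).
  by rewrite -[c *: _]/(lquot_scale c _) pi_lquot_scale -pi_addr.
by rewrite !quot_map_pi T_lin.
Qed.

HB.instance Definition _ := GRing.isLinear.Build k Q 'rV[k]_d *:%R quot_map quot_map_linear.

Lemma has_dim_quot : (forall x, exists v, T v = x) -> has_dim Q d.
Proof.
move=> T_onto; have [g gE] := choice T_onto.
exists quot_map; exists (fun x => \pi_Q (g x)) => x; last by rewrite [LHS]quot_map_pi gE.
rewrite -[RHS]reprK; apply/eqP; rewrite -pi_lquotE T_ker.
have -> : T (g (quot_map x) - repr x) = T (g (quot_map x)) - T (repr x).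
  by rewrite addrC -scaleN1r T_lin scaleN1r addrC.
by rewrite gE subrr.
Qed.

End QuotientDimension.

Section HomDimension.
Context (k : fieldType) {n : nat} (M : tedge n).
Hypothesis hn : (3 <= n)%N.
Local Notation V := (k^o * k^o)%type.
Local Notation m := (steps M).
Local Notation predicted := (predicted (k := k) M).
Local Notation act := (act (k := k) M).
Local Notation kpath X Y := {freeg (mpath X Y) / k}.
Implicit Types (X Y : tedge n) (i j : int) (w : V).

Lemma act_support X p (v : int -> V) i0 : path (@emove n) X p ->
  (forall j, j != i0 -> v j = 0) ->
  forall j, 2 * j + (steps (last X p))%:Z != 2 * i0 + (steps X)%:Z + (size p)%:Z ->
  act X p v j = 0.
Proof.
elim: p X v i0 => [|Y p IHp] X v i0 /= => [_ vi j ji|/andP[XY Yp] vi j ji].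
  by apply: vi; apply: contraNneq ji => ->; rewrite addr0.
have [i1 i1E vi1] : exists2 i1, 2 * i1 + (steps Y)%:Z = 2 * i0 + (steps X)%:Z + 1 &
    forall j, j != i1 -> move_act M X Y v j = 0.
  move: XY; rewrite emoveE // => /orP[XY|XY].
    have /andP[_ /eqP st] := XY; exists (i0 + 1); first by rewrite st; lia.
    move=> a ai; rewrite /move_act XY vi ?push_to0 //.
    by apply: contraNneq ai => <-; rewrite subrK.
  have /andP[_ /eqP st] := XY; exists i0; first by rewrite st; lia.
  by move=> a ai; rewrite /move_act target_source_moveF // vi // push_to0 scaler0.
by apply: IHp Yp vi1 _ _; rewrite i1E; apply: contraNneq ji => ->; lia.
Qed.

Lemma path_grade X p : path (@emove n) X p ->
  exists i, (size p)%:Z + (steps X)%:Z = 2 * i + (steps (last X p))%:Z.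
Proof.
elim: p X => [|Y p IHp] X /=; first by exists 0; rewrite mulr0.
rewrite emoveE // => /andP[XY /IHp [i E]].
case/orP: XY => /andP[_ /eqP st]; [exists (i + 1)|exists i]; lia.
Qed.

(** The only grade at which [X] can be reached from [M] by a nonzero value. *)
Definition offset X : int := (vertex_offset (src M) (src X))%:Z.

Lemma mul_bound (q a : int) : q * n%:Z = a -> `|a| < n%:Z -> q = 0.
Proof.
move=> qa an; case: (ltgtP q 0) => // q0; exfalso.
  have : q * n%:Z <= - n%:Z by rewrite -mulN1r ler_wpM2r //; lia.
  by lia.
have : n%:Z <= q * n%:Z by rewrite -[leLHS]mul1r ler_wpM2r //; lia.
by lia.
Qed.

Lemma offset_at_grade X : at_grade M (offset X) X.
Proof.
rewrite /at_grade /offset; case: (vertex_offsetP (src M) (src X)) => E; [exists 0|exists 1]; lia.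
Qed.

(** The regions confine the grade to an interval of length less than [n], and going
    once around the polygon changes it by [n]. *)
Lemma predicted_offset i X w : predicted i X w -> i != offset X -> w = 0.
Proof.
move=> [[wP _] [//|[q qE]]] ir.
have /andP[X2 Xn] := steps_range X; have /andP[M2 Mn] := steps_range M.
have [r0|rn] : region_at n m i (steps X) = RegZero \/ (0 <= i) && (i < n%:Z).
  rewrite /region_at; case: ifP => _; first by case: ifP => [/andP[? ?]|_]; [right; lia|left].
  case: ifP => [/and3P[? ? ?]|_]; first by right; lia.
  by case: ifP => [/and3P[? ? ?]|_]; [right; lia|left].
  by move: wP; rewrite r0; case: w => a b [/= -> ->].
have := vertex_offset_lt (src M) (src X); have [q' E'] := offset_at_grade X => rlt.
move: ir; rewrite /offset in E' *; set r := vertex_offset _ _ in E' rlt *.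
have : (q - q') * n%:Z = i - r%:Z by rewrite mulrBl; lia.
by move/mul_bound => H; have := H ltac:(lia); lia.
Qed.

(** The homogeneous parts of [f] whose grade is not [offset X] have values in zero
    spaces, so that [mesh_kernel] applies to every part. *)
Lemma value_kernel X (f : kpath M X) : value (offset X) f = 0 -> mesh_ideal f.
Proof.
move=> fE; pose h l (p : mpath M X) : kpath M X := if size p == l then << p >> else 0.
pose N := (\max_(p <- dom f) size p).+1.
have -> : f = \sum_(l < N) fglift (h l) f.
  rewrite -[LHS]fglift_id; symmetry.
  rewrite [LHS](fglift_addf _ _ (fun l : 'I_N => h l) f); apply: eq_fglift => p pf.
  have pN : (size p < N)%N by rewrite ltnS; by apply: leq_bigmax_seq.
  rewrite (bigD1 (Ordinal pN)) //= big1 ?addr0 => [|l lp]; first by rewrite /h eqxx.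
  by rewrite /h ifN // eq_sym.
apply: mesh_ideal_sum => l _.
have [[i iE]|no] := pselect (exists i, (nat_of_ord l)%:Z + m%:Z = 2 * i + (steps X)%:Z); last first.
  suff -> : fglift (h l) f = 0 by exact: mesh_ideal_zero.
  rewrite fgliftE big1 // => p _; rewrite /h; case: eqP => pl; last by rewrite scaler0.
  by case: no; have := path_grade (mpath_path p); rewrite mpath_last pl.
apply: (mesh_kernel hn _ iE).
  by apply: homog_fglift => p _; rewrite /h; case: eqP => [pl|_]; [apply: homogU; rewrite pl|exact: homog0].
have [ir|ir] := eqVneq i (offset X); last by apply: predicted_offset ir; exact: value_predicted.
rewrite ir -[RHS]fE /value /path_value.
rewrite [LHS](fglift_comp (T := fglift (fun p : mpath M X => act M p (start_fun k M) (offset X))) _ _ (fglift_linear _)).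
apply: eq_fglift => p _; rewrite /h; case: eqP => pl; first by rewrite fgliftU.
rewrite fglift0; symmetry; apply: (@act_support M p _ 0) (mpath_path p) _ _ _.
  by move=> j j0; rewrite /start_fun (negPf j0).
by rewrite mpath_last -ir; apply/eqP; move: pl; lia.
Qed.

Lemma value_mesh_ideal X (f : kpath M X) i : mesh_ideal f -> value i f = 0.
Proof. by move=> fI; apply: (mesh_ideal_value hn fI) => j; exact: start_fun_predicted. Qed.

(** The map [c] reads coordinates off the value at the only grade that contributes. *)
Lemma Hom_dim X d (c : V -> 'rV[k]_d) :
  linear c -> (forall w, predicted (offset X) X w -> c w = 0 -> w = 0) ->
  (forall x, exists2 w, predicted (offset X) X w & c w = x) ->
  has_dim (Hom k M X) d.
Proof.
move=> cl ck co; apply: (@has_dim_quot _ _ _ _ _ (fun f => c (value (offset X) f))).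
- by move=> a f g; rewrite value_linear cl.
- move=> f; have c0 : c 0 = 0.
    by have := cl (-1) 0 0; rewrite scaler0 addr0 scaleN1r addNr.
  apply/asboolP/eqP => [/value_mesh_ideal ->//|fE].
  by apply: value_kernel; apply: ck fE; exact: value_predicted.
- move=> x; have [w wS <-] := co x; have [h _ hE] := value_onto hn wS.
  by exists h; rewrite hE.
Qed.

Lemma Hom_dim0 X : (forall w, predicted (offset X) X w -> w = 0) -> has_dim (Hom k M X) 0.
Proof.
move=> H; apply: (@Hom_dim X 0%N (fun _ => 0)); first by move=> a w w'; rewrite scaler0 addr0.
  by move=> w /H.
by move=> x; exists 0; [exact: predicted0|rewrite [RHS]thinmx0].
Qed.

Lemma Hom_dim1 X (e : bool) (a : V) : (if e then a.1 else a.2) = 1 ->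
  (forall t : k, predicted (offset X) X (t *: a)) ->
  (forall w, predicted (offset X) X w -> w = (if e then w.1 else w.2 : k) *: a) ->
  has_dim (Hom k M X) 1.
Proof.
move=> ae aS wa; pose c (w : V) : 'rV[k]_1 := const_mx (if e then w.1 else w.2).
apply: (@Hom_dim X 1%N c).
- by move=> t w w'; apply/rowP => j; rewrite /c !mxE; case: e {ae wa c}.
- move=> w wS /rowP /(_ 0); rewrite /c !mxE => w0.
  by rewrite [w]wa // w0 scale0r.
- move=> x; exists (x 0 0 *: a); first exact: aS.
  apply/rowP => j; rewrite /c !mxE ord1.
  by case: e ae {wa c} => /= ae; rewrite ae [LHS]mulr1.
Qed.

Lemma Hom_dim2 X : (forall w, predicted (offset X) X w) -> has_dim (Hom k M X) 2.
Proof.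
move=> wS; pose c (w : V) : 'rV[k]_2 := \row_j (if j == 0 then w.1 else w.2).
apply: (@Hom_dim X 2%N c).
- by move=> t w w'; apply/rowP => j; rewrite !mxE; case: ifP.
- move=> [a b] _ /rowP H; have := H 0; have := H 1; rewrite !mxE /= => -> ->.
  by [].
- move=> x; exists (x 0 0, x 0 1); first exact: wS.
  apply/rowP => j; rewrite !mxE /=; case: eqVneq => [-> //|j0].
  by congr (x 0 _); apply: val_inj; case: j j0 => [[|[]]].
Qed.

End HomDimension.

(** * Dimension of the extension spaces *)

Section ExtDimension.
Context (k : fieldType) {n : nat}.
Hypothesis hn : (3 <= n)%N.
Local Notation V := (k^o * k^o)%type.
Implicit Types (M N X : tedge n).

Lemma offset_tau M N : offset M (tau N) =
  (if vertex_offset (src M) (src N) == 0%N then n.-1 else (vertex_offset (src M) (src N)).-1)%:Z.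
Proof.
rewrite /offset src_tau /vertex_offset val_ord_pred.
have := ltn_ord (src M); have := ltn_ord (src N) => bn an; congr Posz.
have n1 : (0 < n)%N by lia.
case: (ltngtP (src M) (src N)) => H; case: eqP => E; case: ifP => E'; case: ifP => E''; lia.
Qed.

Lemma predicted_offsetE M X (w : V) : predicted M (offset M X) X w <->
  in_space n (steps M) (tag_sign M) (offset M X) (steps X) (tag_sign X) w.
Proof.
by split=> [[]//|wP]; split=> //; right; exact: offset_at_grade.
Qed.

(** Passing from [N] to [tau N] lowers the grade by one and turns the weak inequalities
    of the hammocks into the strict ones of interleaving. *)
Lemma Ext1_dim M N : has_dim (Ext1 k M N) (crossing_count M N).
Proof.
rewrite /Ext1 /crossing_count !is_loopE -/(steps M) -/(steps N).
have /andP[N2 Nn] := steps_range N; have /andP[M2 Mn] := steps_range M.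
have rE := offset_tau M N; set r := vertex_offset _ _ in rE *.
have rn : (r < n)%N by exact: vertex_offset_lt.
have P := @predicted_offsetE M (tau N); rewrite steps_tau tag_sign_tau in P.
set i := offset M (tau N) in P rE.
have r0E : (src M != src N) = (r != 0%N).
  rewrite /r /vertex_offset -val_eqE /=.
  have := ltn_ord (src M); have := ltn_ord (src N) => bn an.
  by case: (ltngtP (src M) (src N)) => H; apply/idP/idP => //; lia.
rewrite r0E; clearbody r.
have eN : (steps N < n)%N -> tag_sign N by exact: tag_sign_lt.
have [Ml|Ml] := eqVneq (steps M) n; have [Nl|Nl] := eqVneq (steps N) n.
- rewrite Nl eqxx in P.
  have regE : region_at n (steps M) i n = if r != 0%N then RegLoop else RegZero.
    by rewrite region_at_loop rE; case: eqVneq => r0; case: ifP => //; lia.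
  case: eqVneq regE => r0 regE /=.
    apply: Hom_dim0 => // w /P []; rewrite regE /=.
    by case: w => a b /= [-> ->].
  case: eqVneq => eMN /=.
    apply: Hom_dim0 => // w /P []; rewrite regE /on_axis Ml eqxx /= eMN.
    by case: w => a b; case: (tag_sign N) => /= -> ->.
  have eMN' : tag_sign N = ~~ tag_sign M by case: (tag_sign M) (tag_sign N) eMN => [] [].
  apply: (@Hom_dim1 _ _ M hn (tau N) (tag_sign M) (if tag_sign M then (1, 0) else (0, 1))).
  + by case: (tag_sign M).
  + move=> t; apply/P; split; rewrite ?regE /on_axis ?Ml ?eqxx ?eMN' ?negbK /=;
      by case: (tag_sign M); rewrite /= scaler0.
  + move=> w /P []; rewrite regE /on_axis Ml eqxx eMN' negbK /=.
    by case: w => a b; case: (tag_sign M) => /= -> _; congr pair; rewrite /= ?scaler0 // [RHS]mulr1.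
- have Nn' : (steps N < n)%N by rewrite ltn_neqAle Nl.
  have regE : region_at n (steps M) i (steps N) = if (n < r + steps N)%N then RegAll else RegZero.
    rewrite region_at_lt // /hammock /mirror_hammock rE; case: eqVneq => r0; case: ifP => h; case: ifP => h'; case: ifP => h''; rewrite ?h''//; lia.
  case: ifP regE => _ regE.
    apply: (@Hom_dim1 _ _ M hn (tau N) (tag_sign M) (if tag_sign M then (1, 0) else (0, 1))).
    + by case: (tag_sign M).
    + move=> t; apply/P; split; rewrite ?regE /on_axis ?Ml ?eqxx //=;
      by case: (tag_sign M); rewrite /= scaler0.
    + move=> w /P []; rewrite regE /on_axis Ml eqxx => _.
      by case: w => a b; case: (tag_sign M) => /= ->; congr pair; rewrite /= ?scaler0 // [RHS]mulr1.
  apply: Hom_dim0 => // w /P []; rewrite regE /=.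
  by case: w => a b /= [-> ->].
- rewrite Nl eqxx in P.
  have regE : region_at n (steps M) i n = if (0 < r < steps M)%N then RegLoop else RegZero.
    by rewrite region_at_loop rE; case: eqVneq => r0; case: ifP => h; case: ifP => h' //; lia.
  case: ifP regE => _ regE.
    apply: (@Hom_dim1 _ _ M hn (tau N) (~~ tag_sign N) (if ~~ tag_sign N then (1, 0) else (0, 1))).
    + by case: (tag_sign N).
    + move=> t; apply/P; split; rewrite ?regE /on_axis ?(negPf Ml) //=;
      by case: (tag_sign N); rewrite /= scaler0.
    + move=> w /P []; rewrite regE /on_axis (negPf Ml) /= => + _.
      by case: w => a b; case: (tag_sign N) => /= ->; congr pair; rewrite /= ?scaler0 // [RHS]mulr1.
  apply: Hom_dim0 => // w /P []; rewrite regE /=.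
  by case: w => a b /= [-> ->].
- have Nn' : (steps N < n)%N by rewrite ltn_neqAle Nl.
  have h1 : hammock (steps M) i (steps N) = [&& 0 < r, r < steps M & steps M < r + steps N]%N.
    by rewrite /hammock rE; case: eqVneq => r0; lia.
  have h2 : mirror_hammock n (steps M) i (steps N) = (n < r + steps N < n + steps M)%N.
    by rewrite /mirror_hammock rE; case: eqVneq => r0; lia.
  have regE : region_at n (steps M) i (steps N) = _ := region_at_lt _ _ Nn'.
  rewrite h1 h2 in regE.
  have axis w : on_axis n (steps M) (tag_sign M) w by rewrite /on_axis (negPf Ml).
  case: ifP regE => _; case: ifP => _ regE /=.
  + by apply: Hom_dim2 => // w; apply/P; split; rewrite ?regE.
  + apply: (@Hom_dim1 _ _ M hn (tau N) true (1, 1)) => // [t|w /P [+ _]].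
      by apply/P; split; rewrite ?regE.
    by rewrite regE; case: w => a b /= ->; congr pair; rewrite /= [RHS]mulr1.
  + apply: (@Hom_dim1 _ _ M hn (tau N) true (1, 0)) => // [t|w /P [+ _]].
      by apply/P; split; rewrite ?regE //= scaler0.
    by rewrite regE; case: w => a b /= ->; congr pair; rewrite /= ?scaler0 // [RHS]mulr1.
  + apply: Hom_dim0 => // w /P []; rewrite regE /=.
    by case: w => a b /= [-> ->].
Qed.

End ExtDimension.

Theorem theorem4p3 (R : realType) (k : closedFieldType) (n : nat)
    (hn : (3 <= n)%N) (M N : tedge n) :
  exists2 d : nat, is_crossing_number R M N d & has_dim (Ext1 k M N) d.
Proof.
exists (crossing_count M N); [exact: crossing_numberP|exact: Ext1_dim].
Qed.
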